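(* Let $d\in\mathbb{N}$, $m\in\mathbb{N}_0$, and let a hyperbolic cross $I_N^d$ with $N\ge2^{d+1}$ and a reconstructing rank-1 lattice $\Lambda(\mathbf{z},M,I_N^d)$ be given. Let $\psi(\mathbf{x})=(\psi_1(x_1),\ldots,\psi_d(x_d))^\top$ be a multivariate transformation with density function $\varrho(\mathbf{y})=\prod_{j=1}^d\varrho_j(y_j)$, let $\omega(\mathbf{y})=\prod_{j=1}^d\omega_j(y_j)$ be a product weight function, and let $h\in L_2(\mathbb{R}^d,\omega)\cap H^m_{\mathrm{mix}}(\mathbb{R}^d)$. Assume that for all multi-indices $\mathbf{m}=(m_1,\ldots,m_d)^\top\in\mathbb{N}_0^d$ with $\|\mathbf{m}\|_{\ell_\infty}\le m$, all $\ell=1,\ldots,d$ and all $j_\ell=0,\ldots,m$ $$\varrho_\ell^{(j_\ell)}\in\mathcal{C}_0(\mathbb{R}),\qquad\psi_\ell^{(j_\ell)}\in\mathcal{C}\left((-\tfrac12,\tfrac12)\right)$$ and $$\max_{j_\ell=0,\ldots,m_\ell}\left\|\frac{\mathrm{d}^{m_\ell-j_\ell}}{\mathrm{d}x_\ell^{m_\ell-j_\ell}}\left[\sqrt{(\omega_\ell\circ\psi_\ell)\,\psi_\ell'}\right](x_\ell)\;\psi_\ell'(x_\ell)^{\max(-\frac12,\,2j_\ell-\frac32)}\right\|_{L_\infty(\mathbb{T})}<\infty.$$ Then $$\left\|h-S^\Lambda_{I_N^d}h\right\|_{L_2(\mathbb{R}^d,\omega)}\lesssim N^{-m}\,(\log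 N)^{(d-1)/2}\,\|h\|_{\mathcal{H}^m(\mathbb{R}^d)}.$$
   Context: $A\lesssim B$ means $A\le C\,B$ with a constant $C>0$ that does not depend on $N$, on the lattice, or on $h$. Torus, transformations and weights. $\mathbb{T}^d\simeq[-\frac12,\frac12)^d$. A univariate transformation is a map $\psi_j:(-\frac12,\frac12)\to\mathbb{R}$ that is continuously differentiable, strictly increasing, odd, and satisfies $\lim_{x\to-1/2}\psi_j(x)=-\infty$, $\lim_{x\to1/2}\psi_j(x)=\infty$; its density function is $\varrho_j(y):=(\psi_j^{-1})'(y)=\frac{1}{\psi_j'(\psi_j^{-1}(y))}$. A multivariate transformation acts componentwise by univariate transformations $\psi_1,\ldots,\psi_d$, with density $\varrho(\mathbf{y})=\prod_j\varrho_j(y_j)$ and $\psi'(\mathbf{x})=\prod_j\psi_j'(x_j)$. A product weight function has univariate factors $\omega_j:\mathbb{R}\to[0,\infty)$. Function spaces. $\mathcal{C}_0(\mathbb{R})$: continuous functions $\mathbb{R}\to\mathbb{C}$ vanishing at infinity; $\mathcal{C}((-\frac12,\frac12))$: continuous functions. A superscript $(j)$ denotes the $j$-th derivative of a univariate function; $\|\mathbf{m}\|_{\ell_\infty}=\max_j|m_j|$. $L_2(\mathbb{R}^d,\omega)=\{h\in L_2(\mathbb{R}^d):\|h\|_{L_2(\mathbb{R}^d,\omega)}^2:=\int_{\mathbb{R}^d}|h|^2\omega\,\mathrm{d}\mathbf{y}<\infty\}$. $H^m_{\mathrm{mix}}(\mathbb{R}^d)$ is the space of $h\in L_2(\mathbb{R}^d)$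 with $\sum_{\|\boldsymbol{\alpha}\|_{\ell_\infty}\le m}\|D^{\boldsymbol{\alpha}}[h]\|_{L_2(\mathbb{R}^d)}^2<\infty$, the sum running over $\boldsymbol{\alpha}\in\mathbb{N}_0^d$, where $D^{\boldsymbol{\alpha}}=\frac{\partial^{\alpha_1}}{\partial x_1^{\alpha_1}}\cdots\frac{\partial^{\alpha_d}}{\partial x_d^{\alpha_d}}$. Frequency sets and lattices. $\omega_{\mathrm{hc}}(\mathbf{k}):=\prod_{j=1}^d\max(1,|k_j|)$ for $\mathbf{k}\in\mathbb{Z}^d$; for $N\in\mathbb{N}$ the hyperbolic cross is $I_N^d:=\{\mathbf{k}\in\mathbb{Z}^d:\omega_{\mathrm{hc}}(\mathbf{k})\le N\}$. For $\mathbf{z}\in\mathbb{Z}^d$, $M\in\mathbb{N}$ the rank-1 lattice is $\Lambda(\mathbf{z},M):=\{\mathbf{x}_j:=\frac{j}{M}\mathbf{z}\bmod\mathbf{1}\in\mathbb{T}^d:j=0,\ldots,M-1\}$, with points represented in $[-\frac12,\frac12)^d$ before applying $\psi$. It is a reconstructing rank-1 lattice for a finite set $I\subset\mathbb{Z}^d$, denoted $\Lambda(\mathbf{z},M,I)$, if $\mathbf{t}\cdot\mathbf{z}\not\equiv0\pmod M$ for all $\mathbf{t}\in\{\mathbf{k}_1-\mathbf{k}_2:\mathbf{k}_1,\mathbf{k}_2\in I\}\setminus\{\mathbf{0}\}$. The transformed lattice points are $\mathbf{y}_j:=\psi(\mathbf{x}_j)$. Fourier objects on $\mathbb{R}^d$.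 $\varphi_{\mathbf{k}}(\mathbf{y}):=\sqrt{\frac{\varrho(\mathbf{y})}{\omega(\mathbf{y})}}\,\mathrm{e}^{2\pi\mathrm{i}\mathbf{k}\cdot\psi^{-1}(\mathbf{y})}$; the Fourier coefficients of $h$ are $\hat h_{\mathbf{k}}:=\int_{\mathbb{R}^d}h(\mathbf{y})\,\overline{\varphi_{\mathbf{k}}(\mathbf{y})}\,\omega(\mathbf{y})\,\mathrm{d}\mathbf{y}=\int_{\mathbb{R}^d}h(\mathbf{y})\sqrt{\varrho(\mathbf{y})\omega(\mathbf{y})}\,\mathrm{e}^{-2\pi\mathrm{i}\mathbf{k}\cdot\psi^{-1}(\mathbf{y})}\,\mathrm{d}\mathbf{y}$, and $\|h\|_{\mathcal{H}^m(\mathbb{R}^d)}:=\left(\sum_{\mathbf{k}\in\mathbb{Z}^d}\omega_{\mathrm{hc}}(\mathbf{k})^{2m}|\hat h_{\mathbf{k}}|^2\right)^{1/2}$. The approximated Fourier coefficients and partial sum are $$\hat h^\Lambda_{\mathbf{k}}:=\frac1M\sum_{j=0}^{M-1}h(\mathbf{y}_j)\sqrt{\frac{\omega(\mathbf{y}_j)}{\varrho(\mathbf{y}_j)}}\,\mathrm{e}^{-2\pi\mathrm{i}\mathbf{k}\cdot\psi^{-1}(\mathbf{y}_j)}=\frac1M\sum_{j=0}^{M-1}f(\mathbf{x}_j)\,\mathrm{e}^{-2\pi\mathrm{i}\mathbf{k}\cdot\mathbf{x}_j},\qquad S_I^\Lambda h(\mathbf{y}):=\sum_{\mathbf{k}\in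 I}\hat h^\Lambda_{\mathbf{k}}\,\varphi_{\mathbf{k}}(\mathbf{y}),$$ where $f(\mathbf{x}):=h(\psi(\mathbf{x}))\sqrt{\omega(\psi(\mathbf{x}))\,\psi'(\mathbf{x})}$ is the transformed function on $\mathbb{T}^d$. When sampled, $f$ is identified with its continuous representative given by its Fourier series.
   Formalization: The formal theorem assumes m ≥ 1 instead of m ∈ ℕ₀: for m = 0 the estimate is false (d = 1, ψ = tan(πx), ω = 1, transformed functions equal to 1 at all lattice points with arbitrarily small L₂ norm). *)

(* Defs.v *)
From HB Require Import structures.
From mathcomp Require Import all_boot all_order all_algebra.
From mathcomp Require Import all_classical all_reals all_analysis.
From mathcomp Require Import complex.
From mathcomp.analysis Require showcase.summability.
Set Implicit Arguments.
Unset Strict Implicit.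
Unset Printing Implicit Defensive.
Import Order.TTheory GRing.Theory Num.Theory numFieldNormedType.Exports.
Local Open Scope classical_set_scope.
Local Open Scope ring_scope.

(* Points of R^d are tuples [y : d.-tuple R] with coordinates [tnth y j],
   because tuples carry the product sigma-algebra in the library.  The
   library has no Lebesgue measure on them: it is built here as the d-fold
   product of [lebesgue_measure]. *)
Section tuple_measure.
Context {dT : measure_display} {T : measurableType dT} {R : realType}.
Variable m1 : {sigma_finite_measure set T -> \bar R}.

Definition tuple_cons n (p : T * n.-tuple T) : n.+1.-tuple T :=
  [tuple of p.1 :: p.2].

Definition measure_cons n (m2 : {sigma_finite_measure set (n.-tuple T) -> \bar R})
    : set (n.+1.-tuple T) -> \bar R :=
  pushforward (m1 \x m2)%E (@tuple_cons n).

Section cons.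
Variables (n : nat) (m2 : {sigma_finite_measure set (n.-tuple T) -> \bar R}).

Let measurable_tuple_cons : measurable_fun [set: T * n.-tuple T] (@tuple_cons n).
Proof. exact: measurable_cons. Qed.

Let measure_cons0 : measure_cons m2 set0 = 0%E.
Proof. by rewrite /measure_cons /pushforward preimage_set0 measure0. Qed.

Let measure_cons_ge0 A : (0 <= measure_cons m2 A)%E.
Proof. exact: measure_ge0. Qed.

Let measure_cons_sigma_additive : semi_sigma_additive (measure_cons m2).
Proof.
move=> F mF tF mUF; rewrite /measure_cons /pushforward preimage_bigcup.
apply: measure_semi_sigma_additive.
- by move=> k; rewrite -[X in measurable X]setTI; exact: measurable_tuple_cons.
- apply/trivIsetP => /= i j _ _ ij; rewrite -preimage_setI.
  by move/trivIsetP : tF => /(_ _ _ _ _ ij) ->//; rewrite preimage_set0.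
- rewrite -preimage_bigcup -[X in measurable X]setTI.
  exact: measurable_tuple_cons.
Qed.

HB.instance Definition _ := isMeasure.Build _ _ _ (measure_cons m2)
  measure_cons0 measure_cons_ge0 measure_cons_sigma_additive.

Let measure_cons_sigma_finite :
  sigma_finite [set: n.+1.-tuple T] (measure_cons m2).
Proof.
have /sigma_finiteP[F [TF ndF Foo]] := sigma_finiteT m1.
have /sigma_finiteP[G [TG ndG Goo]] := sigma_finiteT m2.
pose g (t : n.+1.-tuple T) : T * n.-tuple T := (thead t, [tuple of behead t]).
have mg : measurable_fun [set: n.+1.-tuple T] g.
  apply/measurable_fun_pairP; split; last exact: measurable_behead.
  exact: measurable_tnth.
have gK : cancel (@tuple_cons n) g.
  by case=> x t; rewrite /g theadE; congr pair; exact/val_inj.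
exists (fun k => g @^-1` (F k `*` G k)) => [|k].
  rewrite -preimage_bigcup predeqE => t; split => // _.
  have [i _ Fi] : (\bigcup_i F i) (g t).1 by rewrite -TF.
  have [j _ Gj] : (\bigcup_i G i) (g t).2 by rewrite -TG.
  exists (maxn i j) => //; split.
  - by move: Fi; exact/subsetPset/ndF/leq_maxl.
  - by move: Gj; exact/subsetPset/ndG/leq_maxr.
have [mF Fk] := Foo k; have [mG Gk] := Goo k; split.
  by rewrite -[X in measurable X]setTI; apply: mg => //; exact: measurableX.
rewrite /measure_cons /pushforward -comp_preimage (_ : g \o _ = id); last first.
  exact/funext.
by rewrite preimage_id product_measure1E// lte_mul_pinfty// ge0_fin_numE.
Qed.

HB.instance Definition _ := Measure_isSigmaFinite.Build _ _ _ (measure_cons m2)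
  measure_cons_sigma_finite.

End cons.

Fixpoint measure_tuple (d : nat) :
    {sigma_finite_measure set (d.-tuple T) -> \bar R} :=
  match d with
  | 0 => [the {sigma_finite_measure set (0.-tuple T) -> \bar R} of
           @dirac _ _ [tuple] R]
  | n.+1 => [the {sigma_finite_measure set (n.+1.-tuple T) -> \bar R} of
           measure_cons (measure_tuple n)]
  end.

End tuple_measure.

(* [measurableTypeR R] is R with the Borel sigma-algebra on which the library
   defines [lebesgue_measure]. *)
Definition lebesgue_tuple {R : realType} (d : nat) :
    {sigma_finite_measure set (d.-tuple (measurableTypeR R)) -> \bar R} :=
  measure_tuple (@lebesgue_measure R) d.

Section complex_valued.
Context {R : realType} {d : nat}.
Implicit Types (f g : d.-tuple (measurableTypeR R) -> R[i]) (D : set (d.-tuple (measurableTypeR R))).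

Definition cabs (z : R[i]) : R := ComplexField.Normc.normc z.

Definition expi2pi (t : R) : R[i] :=
  (cos (2 * pi * t) +i* sin (2 * pi * t))%C.

Definition cmeasurable f :=
  measurable_fun setT (fun y => complex.Re (f y)) /\
  measurable_fun setT (fun y => complex.Im (f y)).

Definition cintegral D f : R[i] :=
  ((\int[lebesgue_tuple d]_(y in D) complex.Re (f y)) +i*
   (\int[lebesgue_tuple d]_(y in D) complex.Im (f y)))%C.

(* Unordered sum over Z^d: limit along finite sets ordered by inclusion. *)
Definition csum (c : d.-tuple int -> R[i]) : R[i] :=
  (@showcase.summability.sum (d.-tuple int) R R^o (fun k => complex.Re (c k)) +i*
   @showcase.summability.sum (d.-tuple int) R R^o (fun k => complex.Im (c k)))%C.

Definition dotp (k : d.-tuple int) (x : d.-tuple (measurableTypeR R)) : R :=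
  \sum_(j < d) (tnth k j)%:~R * tnth x j.

End complex_valued.

Section transformations.
Context {R : realType}.
Implicit Types (f psi : R -> R) (A : set R) (n : nat).

Definition Ihalf : set R := `]- 2^-1, 2^-1[%classic.

(* A map defined on (-1/2,1/2) is a total function R -> R whose values
   outside of the interval are irrelevant. *)
Record univariate_transformation psi : Prop := {
  transf_derivable : forall x, Ihalf x -> derivable psi x 1;
  transf_C1 : forall x, Ihalf x -> {for x, continuous (derive1 psi)};
  transf_incr : forall x y, Ihalf x -> Ihalf y -> x < y -> psi x < psi y;
  transf_odd : forall x, Ihalf x -> psi (- x) = - psi x;
  transf_left : psi x @[x --> (- 2^-1)^'+] --> -oo;
  transf_right : psi x @[x --> (2^-1)^'-] --> +oo }.

Definition transf_inv psi : R -> R := 'pinv_(fun=> 0) Ihalf psi.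

Definition density psi : R -> R := derive1 (transf_inv psi).

Definition nderivable_on A n f :=
  forall i x, (i < n)%N -> A x -> derivable (derive1n i f) x 1.

Definition derivative_in_C0 n f :=
  [/\ nderivable_on setT n f, continuous (derive1n n f),
      derive1n n f x @[x --> +oo] --> 0 & derive1n n f x @[x --> -oo] --> 0].

Definition derivative_in_C_Ihalf n f :=
  nderivable_on Ihalf n f /\
  forall x, Ihalf x -> {for x, continuous (derive1n n f)}.

Definition Linfty_norm_Ihalf f : \bar R :=
  'N[@lebesgue_measure R]_+oo%E[EFin \o (f \_ Ihalf)]%E.

Definition sqrt_weight_transf (omega psi : R -> R) (x : R) : R :=
  Num.sqrt (omega (psi x) * derive1 psi x).

End transformations.

Section function_spaces.
Context {R : realType} {d : nat}.
Implicit Types (h g : d.-tuple (measurableTypeR R) -> R[i]) (phi : 'rV[R]_d -> R).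

Definition L2_norm_weight (w : d.-tuple (measurableTypeR R) -> R) h : \bar R :=
  ((\int[lebesgue_tuple d]_y (cabs (h y) ^+ 2 * w y)%:E) `^ 2^-1)%E.

Definition in_L2 h := cmeasurable h /\ (L2_norm_weight (fun=> 1%R) h < +oo)%E.

Definition in_L2_weight (w : d.-tuple (measurableTypeR R) -> R) h :=
  in_L2 h /\ (L2_norm_weight w h < +oo)%E.

(* Test functions live on row vectors, on which the library has topology and
   directional derivatives. *)
Definition pderiv phi (i : 'I_d) : 'rV[R]_d -> R :=
  fun x => 'D_(delta_mx ord0 i) phi x.

Definition pderivs (s : seq 'I_d) phi : 'rV[R]_d -> R :=
  foldr (fun i f => pderiv f i) phi s.

Definition multi_pderiv (alpha : 'I_d -> nat) phi : 'rV[R]_d -> R :=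
  pderivs (flatten [seq nseq (alpha i) i | i <- enum 'I_d]) phi.

Definition test_function phi :=
  (forall s : seq 'I_d, continuous (pderivs s phi) /\
     forall i x, derivable (pderivs s phi) x (delta_mx ord0 i)) /\
  compact (closure [set x | phi x != 0]).

Definition row_of_tuple (y : d.-tuple (measurableTypeR R)) : 'rV[R]_d := \row_i tnth y i.

Definition weak_derivative (alpha : 'I_d -> nat) h g :=
  forall phi, test_function phi ->
    cintegral setT
      (fun y => h y * (multi_pderiv alpha phi (row_of_tuple y))%:C%C) =
    (-1) ^+ (\sum_i alpha i)%N *
    cintegral setT (fun y => g y * (phi (row_of_tuple y))%:C%C).

(* The sum of squared norms over the finitely many multi-indices is finite iff
   each derivative is square integrable. *)
Definition in_Hmix (m : nat) h :=
  in_L2 h /\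
  forall alpha : 'I_d -> nat, (forall i, (alpha i <= m)%N) ->
    exists2 g, weak_derivative alpha h g & in_L2 g.

End function_spaces.

Section lattices.
Context {d : nat}.

Definition omega_hc (k : d.-tuple int) : nat :=
  (\prod_(j < d) maxn 1 `|tnth k j|)%N.

Definition hyperbolic_cross (N : nat) : set (d.-tuple int) :=
  [set k | (omega_hc k <= N)%N].

Definition reconstructing (z : d.-tuple int) (M : nat)
    (I : set (d.-tuple int)) :=
  forall k1 k2, I k1 -> I k2 -> k1 != k2 ->
    ~~ (M%:Z %| \sum_(j < d) (tnth k1 j - tnth k2 j) * tnth z j)%Z.

(* representative of t modulo 1 in [-1/2, 1/2) *)
Definition torus_repr {R : realType} (t : R) : R :=
  t - (Num.floor (t + 2^-1))%:~R.

Definition lattice_point {R : realType} (z : d.-tuple int) (M j : nat) :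
    d.-tuple (measurableTypeR R) :=
  [tuple torus_repr (j%:R / M%:R * (tnth z i)%:~R) | i < d].

End lattices.

Section transformed_fourier.
Context {R : realType} {d : nat}.
Variables psi omega : 'I_d -> R -> R.
Implicit Types (h : d.-tuple (measurableTypeR R) -> R[i]) (x y : d.-tuple (measurableTypeR R)).
Implicit Types (k z : d.-tuple int).

Definition Psi x : d.-tuple (measurableTypeR R) := [tuple psi j (tnth x j) | j < d].

Definition Psi_inv y : d.-tuple (measurableTypeR R) :=
  [tuple transf_inv (psi j) (tnth y j) | j < d].

Definition Psi' x : R := \prod_(j < d) derive1 (psi j) (tnth x j).

Definition rho y : R := \prod_(j < d) density (psi j) (tnth y j).

Definition weight y : R := \prod_(j < d) omega j (tnth y j).

(* Where the weight vanishes the quotient, hence phi_k, is 0 by 0^-1 = 0; such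
   points do not contribute to any integral against the weight. *)
Definition phi_ k y : R[i] :=
  (Num.sqrt (rho y / weight y))%:C%C * expi2pi (dotp k (Psi_inv y)).

Definition hhat h k : R[i] :=
  cintegral setT (fun y => h y * (phi_ k y)^*%C * (weight y)%:C%C).

Definition Hnorm (m : nat) h : \bar R :=
  ((\esum_(k in [set: d.-tuple int])
      ((omega_hc k)%:R ^+ (2 * m) * cabs (hhat h k) ^+ 2)%:E) `^ 2^-1)%E.

Definition transformed h x : R[i] :=
  h (Psi x) * (Num.sqrt (weight (Psi x) * Psi' x))%:C%C.

Definition cube : set (d.-tuple (measurableTypeR R)) := [set x | forall j, Ihalf (tnth x j)].

Definition torus_coef (f : d.-tuple (measurableTypeR R) -> R[i]) k : R[i] :=
  cintegral cube (fun x => f x * expi2pi (- dotp k x)).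

Definition fourier_series (f : d.-tuple (measurableTypeR R) -> R[i]) x : R[i] :=
  csum (fun k => torus_coef f k * expi2pi (dotp k x)).

(* h is only defined almost everywhere: the samples are those of the Fourier
   series of the transformed function, its continuous representative. *)
Definition hhat_lattice z (M : nat) h k : R[i] :=
  (M%:R)^-1 * \sum_(j < M)
    fourier_series (transformed h) (lattice_point z M j) *
    expi2pi (- dotp k (lattice_point z M j)).

Definition partial_sum_lattice z M (I : set (d.-tuple int)) h y : R[i] :=
  \sum_(k \in I) hhat_lattice z M h k * phi_ k y.

End transformed_fourier.

(* Main.v *)
Require Import Defs.
From HB Require Import structures.
From mathcomp Require Import all_boot all_order all_algebra finmap.
From mathcomp Require Import all_classical all_reals all_analysis.
From mathcomp Require Import measurable_realfun complex.
From mathcomp Require Import zify ring lra.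
From mathcomp.analysis Require showcase.summability.
Set Implicit Arguments.
Unset Strict Implicit.
Unset Printing Implicit Defensive.
Import Order.TTheory GRing.Theory Num.Theory numFieldNormedType.Exports.
Local Open Scope classical_set_scope.
Local Open Scope ring_scope.

(* If the norm of h in H^m is infinite there is nothing to prove.  Otherwise,
   as m >= 1, Cauchy-Schwarz against the summable weights omega_hc^(-2m) makes
   the Fourier coefficients of the transformed function f absolutely summable,
   so f is a.e. equal on the cube to its continuous Fourier series g.  By
   aliasing, the k-th lattice coefficient of a trigonometric polynomial with
   coefficients c is the sum of c_l over all l with (l - k).z = 0 mod M.  By
   the reconstruction property, for fixed k two such l cannot be close: their
   difference lies outside of the cross.  Hence a dyadic block of volume 2^s
   contains at most 2^(d + s - n) of them, where 2^n <= N < 2^(n+1), and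
   summing omega_hc^(-2m) over the dyadic blocks with s >= n gives
   N^(-2m) (log N)^(d-1).  With Cauchy-Schwarz and Parseval this bounds the
   squared error of every box partial sum of g, Fatou's lemma passes to g, and
   the change of variables y = psi(x) carries the bound to R^d. *)

(** Cauchy-Schwarz bounds the error at each [k] of the cross by a weighted sum over the aliases of
    [k]. These bounds can be added over [k] because a frequency is an alias of at most one element
    of the cross, so the norm of [h] is counted once. Every alias [l != k] has [omega_hc l > N]: all
    but two of the [2 * m] powers are traded for powers of [N], only exponent 2 is ever summed, and
    the constant depends on [d] alone. The power of the logarithm counts the tuples of dyadic scales
    with a given sum. The samples belong to the Fourier series [g] while the error concerns [f], so
    [f = g] almost everywhere is a uniqueness statement for integrable functions. It is obtained by
    approximating indicators of half spaces boundedly by trigonometric polynomials and closing under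
    the sigma-algebra operations. The change of variables needs [psi' > 0], whereas strict
    monotonicity alone allows zeros of [psi']; the continuity of the density excludes them. *)

Section exponentials.
Context {R : realType}.
Local Notation e := (@expi2pi R).

Lemma expi2piD a b : e (a + b) = e a * e b.
Proof.
rewrite /expi2pi mulrDr cosD sinD; apply/eqP; rewrite eq_complex /= eqxx /=.
by rewrite addrC [X in X + _]mulrC [X in _ + X]mulrC eqxx.
Qed.

Lemma expi2pi0 : e 0 = 1.
Proof. by rewrite /expi2pi mulr0 cos0 sin0. Qed.

Lemma expi2piN a : e (- a) = (e a)^*%C.
Proof. by rewrite /expi2pi mulrN cosN sinN. Qed.

Lemma expi2piMn a n : e (n%:R * a) = e a ^+ n.
Proof.
elim: n => [|n IH]; first by rewrite mul0r expi2pi0.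
by rewrite -natr1 mulrDl mul1r addrC exprS expi2piD IH.
Qed.

Lemma expi2pi1 : e 1 = 1.
Proof. by rewrite /expi2pi mulr1 mulrC mulr_natr cos2pi sin2pi. Qed.

Lemma expi2pi_int (n : int) : e n%:~R = 1.
Proof.
case: (intP n) => [|k|k]; first by rewrite expi2pi0.
  by rewrite -pmulrn -[_%:R]mulr1 expi2piMn expi2pi1 expr1n.
by rewrite mulrNz expi2piN -pmulrn -[k.+1%:R]mulr1 expi2piMn expi2pi1 expr1n conjc1.
Qed.

(** Only the fractional part [u] of [t] matters. The real part of the equation gives
    [sin (pi * u) = 0], while this sine is positive for [0 < u < 1]. *)
Lemma expi2pi_eq1 t : e t = 1 -> exists n : int, t = n%:~R.
Proof.
move=> et; exists (Num.floor t).
have := floor_itv t; rewrite intrD1.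
set u := t - (Num.floor t)%:~R => /andP[ft tf].
have eu : e u = 1 by rewrite expi2piD et mul1r expi2piN expi2pi_int conjc1.
have [u0|u0] := eqVneq u 0; first by apply/eqP; rewrite -subr_eq0 -/u u0.
have up : 0 < u by rewrite lt_neqAle eq_sym u0/= /u subr_ge0.
have u1 : u < 1 by rewrite /u ltrBlDr addrC.
have : 0 < sin (pi * u).
  by apply: sin_gt0_pi; rewrite mulr_gt0 ?pi_gt0//= gtr_pMr// pi_gt0.
move: eu; rewrite /expi2pi -mulrA mulrC mulr_natr cos_mulr2n => -[+ _].
rewrite cos2sin2 => H; have -> : sin (pi * u) = 0; last by rewrite ltxx.
by apply/eqP; rewrite -sqrf_eq0; apply/eqP; lra.
Qed.

Lemma expi2pi_torus_repr (t : R) (n : int) :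
  e (n%:~R * torus_repr t) = e (n%:~R * t).
Proof.
by rewrite /torus_repr mulrBr expi2piD -intrM expi2piN expi2pi_int conjc1 mulr1.
Qed.

End exponentials.

(** * Lattice characters and the aliasing identity *)

Section lattice_aliasing.
Context {R : realType} {d : nat}.
Local Notation e := (@expi2pi R).
Implicit Types (k l z : d.-tuple int) (c : d.-tuple int -> R[i]).

Definition freqB k l : d.-tuple int := [tuple tnth k j - tnth l j | j < d].

Lemma dotpB k l x : dotp (R := R) (freqB k l) x = dotp k x - dotp l x.
Proof.
rewrite /dotp -sumrB; apply: eq_bigr => j _.
by rewrite tnth_mktuple intrB mulrBl.
Qed.

Definition freq_dot k z : int := \sum_(j < d) tnth k j * tnth z j.

Lemma expi2pi_lattice_point k z M j :
  e (dotp k (lattice_point z M j)) = e ((freq_dot k z)%:~R / M%:R) ^+ j.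
Proof.
have es (I : finType) (F : I -> R) : e (\sum_i F i) = \prod_i e (F i).
  by apply: (big_morph e expi2piD expi2pi0).
rewrite -expi2piMn /dotp es.
under eq_bigr do rewrite tnth_mktuple expi2pi_torus_repr.
rewrite -es; congr e; rewrite /freq_dot rmorph_sum/= big_distrl big_distrr/=.
by apply: eq_bigr => i _; rewrite intrM; ring.
Qed.

(** A geometric sum of an [M]-th root of unity [w]: either [w = 1], or the factor [w - 1] can be
    cancelled in [w ^+ M - 1 = 0]. *)
Lemma lattice_mean k z M : (0 < M)%N ->
  M%:R^-1 * \sum_(j < M) e (dotp k (lattice_point z M j)) =
  (M%:Z %| freq_dot k z)%Z%:R.
Proof.
move=> M0; have Mn0 : M%:R != 0 :> R by rewrite pnatr_eq0 -lt0n.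
have Mn0' : M%:R != 0 :> R[i] by rewrite pnatr_eq0 -lt0n.
under eq_bigr do rewrite expi2pi_lattice_point.
set w := e _; case: (boolP (M%:Z %| freq_dot k z)%Z) => [|Mk].
  move=> /dvdzP[q qE]; have -> : w = 1.
    by rewrite /w qE intrM mulfK// expi2pi_int.
  under eq_bigr do rewrite expr1n.
  by rewrite sumr_const card_ord mulVf.
have w1 : w != 1.
  apply: contra Mk => /eqP /expi2pi_eq1[q] /(congr1 ( *%R^~ M%:R)).
  rewrite divfK// -[M%:R]/(M%:Z%:~R) -intrM => /intr_inj ->.
  exact: dvdz_mull.
have := subrX1 w M.
have -> : w ^+ M = 1.
  by rewrite /w -expi2piMn mulrC divfK// expi2pi_int.
rewrite subrr => /esym/eqP; rewrite mulf_eq0 subr_eq0 (negbTE w1)/= => /eqP ->.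
by rewrite mulr0.
Qed.

Lemma lattice_aliasing c (K : seq (d.-tuple int)) k z M : (0 < M)%N ->
  M%:R^-1 * \sum_(j < M)
    (\sum_(l <- K) c l * e (dotp l (lattice_point z M j))) *
    e (- dotp k (lattice_point z M j)) =
  \sum_(l <- K | (M%:Z %| freq_dot (freqB l k) z)%Z) c l.
Proof.
move=> M0; under eq_bigr do rewrite big_distrl/=.
rewrite exchange_big big_distrr/= [RHS]big_mkcond/=; apply: eq_bigr => l _.
under eq_bigr do rewrite -mulrA -expi2piD -dotpB.
by rewrite -big_distrr/= mulrCA lattice_mean//; case: ifP; rewrite ?mulr1 ?mulr0.
Qed.

End lattice_aliasing.

(** * Iterated integrals over tuples *)

Section tuple_integral.
Context {R : realType}.
Local Notation lambda := (@lebesgue_measure R).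
Local Open Scope ereal_scope.
Local Notation tcons x t := (@tuple_cons _ (measurableTypeR R) _ (x, t)).

Lemma measurable_tuple_cons_fun n :
  measurable_fun [set: measurableTypeR R * n.-tuple (measurableTypeR R)] (@tuple_cons _ (measurableTypeR R) n).
Proof. exact: measurable_cons. Qed.

Lemma ge0_integral_tuple_cons n (F : n.+1.-tuple (measurableTypeR R) -> \bar R) :
  measurable_fun setT F -> (forall x, 0 <= F x) ->
  \int[lebesgue_tuple n.+1]_x F x =
  \int[lambda]_x \int[lebesgue_tuple n]_t F (tcons x t).
Proof.
move=> mF F0.
have mc := @measurable_tuple_cons_fun n.
rewrite [LHS](@ge0_integral_pushforward _ _ _ _ R _ mc (lambda \x lebesgue_tuple n))//=.
rewrite preimage_setT fubini_tonelli1//.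
by apply: measurableT_comp.
Qed.

Definition tuple_fun d (g : 'I_d -> R -> R) (y : d.-tuple (measurableTypeR R)) :
  d.-tuple (measurableTypeR R) := [tuple g j (tnth y j) | j < d].

Lemma measurable_tuple_fun d (g : 'I_d -> R -> R) :
  (forall j, measurable_fun setT (g j)) -> measurable_fun setT (tuple_fun g).
Proof.
move=> mg; apply/measurable_fun_tnthP => i.
rewrite (_ : _ \o _ = g i \o (fun y => tnth y i)); last first.
  by apply/funext => y /=; rewrite tnth_mktuple.
by apply: measurableT_comp; [exact: mg|exact: measurable_tnth].
Qed.

Lemma measurable_tuple_prod d (u : 'I_d -> R -> R) :
  (forall j, measurable_fun setT (u j)) ->
  measurable_fun setT (fun x : d.-tuple (measurableTypeR R) => (\prod_j u j (tnth x j))%R).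
Proof.
move=> mu; apply: measurable_prod => i _.
by apply: (measurableT_comp (mu i)); exact: measurable_tnth.
Qed.

Lemma tuple_fun_cons d (g : 'I_d.+1 -> R -> R) x (t : d.-tuple (measurableTypeR R)) :
  tuple_fun g (tcons x t) =
  tcons (g ord0 x) (tuple_fun (fun j => g (lift ord0 j)) t).
Proof.
apply: eq_from_tnth => j; rewrite tnth_mktuple.
have [->|[i ->]] : j = ord0 \/ exists i, j = lift ord0 i.
  by case: (unliftP ord0 j) => [i ->|->]; [right; exists i|left].
- by rewrite !tnth0.
- by rewrite !tnthS tnth_mktuple.
Qed.

(** Tonelli, one coordinate at a time: a substitution rule valid on the line for all nonnegative
    integrands holds for products. It serves with [u] the indicator of the unit interval, [g] the
    inverse transformation and [r] the density. *)
Lemma ge0_integral_tuple_transfer d (g u r : 'I_d -> R -> R) :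
  (forall j, measurable_fun setT (g j)) ->
  (forall j, measurable_fun setT (u j)) ->
  (forall j, measurable_fun setT (r j)) ->
  (forall j x, (0 <= u j x)%R) -> (forall j x, (0 <= r j x)%R) ->
  (forall j (f : R -> \bar R), measurable_fun setT f -> (forall x, 0 <= f x) ->
    \int[lambda]_x (f x * (u j x)%:E) = \int[lambda]_y (f (g j y) * (r j y)%:E)) ->
  forall F : d.-tuple (measurableTypeR R) -> \bar R,
  measurable_fun setT F -> (forall x, 0 <= F x) ->
  \int[lebesgue_tuple d]_x (F x * (\prod_j u j (tnth x j))%:E) =
  \int[lebesgue_tuple d]_y (F (tuple_fun g y) * (\prod_j r j (tnth y j))%:E).
Proof.
elim: d g u r => [|d IH] g u r mg mu mr u0 r0 H F mF F0.
  by apply: eq_integral => x _; rewrite !big_ord0; congr (F _ * _); rewrite [LHS]tuple0 [RHS]tuple0.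
have pu0 x : (0 <= \prod_j u j (tnth x j))%R by apply: prodr_ge0.
have pr0 x : (0 <= \prod_j r j (tnth x j))%R by apply: prodr_ge0.
have mpu := measurable_tuple_prod mu.
have mpr := measurable_tuple_prod mr.
have mFg := measurableT_comp mF (measurable_tuple_fun mg).
have mcons x : measurable_fun setT (fun t : d.-tuple (measurableTypeR R) => tcons x t).
  exact: (@measurable_cons _ _ _ (measurableTypeR R) (cst x) _ id).
set g' := fun j => g (lift ord0 j).
set u' := fun j => u (lift ord0 j).
set r' := fun j => r (lift ord0 j).
have mpr' : measurable_fun setT (fun x => (\prod_j r' j (tnth x j))%R).
  by apply: measurable_tuple_prod => j; exact: mr.
have mpu' : measurable_fun setT (fun x => (\prod_j u' j (tnth x j))%R).
  by apply: measurable_tuple_prod => j; exact: mu.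
have pr'0 x : (0 <= \prod_j r' j (tnth x j))%R by apply: prodr_ge0 => *; exact: r0.
have pu'0 x : (0 <= \prod_j u' j (tnth x j))%R by apply: prodr_ge0 => *; exact: u0.
have mg' : measurable_fun setT (tuple_fun g') by apply: measurable_tuple_fun => j; exact: mg.
(* The intermediate stage: all coordinates but the first are already substituted, and [Phi] is the
   integrand left for the one-dimensional rule. *)
pose Phi x := \int[lebesgue_tuple d]_t (F (tcons x (tuple_fun g' t)) * (\prod_j r' j (tnth t j))%:E).
have mPhi : measurable_fun setT Phi.
  apply: (@measurable_fun_fubini_tonelli_F _ _ _ _ R (lebesgue_tuple d)
    (fun p : measurableTypeR R * d.-tuple (measurableTypeR R) =>
       F (tcons p.1 (tuple_fun g' p.2)) * (\prod_j r' j (tnth p.2 j))%:E)).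
  - apply: emeasurable_funM.
      apply: (measurableT_comp mF).
      apply: (@measurable_cons _ _ _ (measurableTypeR R) fst _ (fun p => tuple_fun g' p.2)) => //.
      by apply: (measurableT_comp mg').
    by apply/measurable_EFinP; apply: (measurableT_comp mpr').
  - by move=> x; rewrite mule_ge0// lee_fin.
have Phi0 x : 0 <= Phi x by apply: integral_ge0 => t _; rewrite mule_ge0// lee_fin.
rewrite ge0_integral_tuple_cons; last 2 first.
- by apply: emeasurable_funM => //; exact/measurable_EFinP.
- by move=> x; rewrite mule_ge0// lee_fin.
rewrite [RHS]ge0_integral_tuple_cons; last 2 first.
- by apply: emeasurable_funM => //; exact/measurable_EFinP.
- by move=> x; rewrite mule_ge0// lee_fin.
transitivity (\int[lambda]_x (Phi x * (u ord0 x)%:E)).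
  apply: eq_integral => x _.
  have IHx := IH g' u' r' (fun j => mg _) (fun j => mu _) (fun j => mr _)
    (fun j => u0 _) (fun j => r0 _) (fun j => H _) (fun t => F (tcons x t))
    (measurableT_comp mF (mcons x)) (fun t => F0 _).
  rewrite muleC /Phi -IHx.
  rewrite -ge0_integralZl; last 4 first.
  - by [].
  - by apply: emeasurable_funM; [exact: (measurableT_comp mF)|exact/measurable_EFinP].
  - by move=> t _; rewrite mule_ge0// lee_fin.
  - by rewrite lee_fin.
  apply: eq_integral => t _; rewrite big_ord_recl tnth0 muleCA.
  congr (_ * _); rewrite EFinM; congr (_ * _%:E).
  by apply: eq_bigr => j _; rewrite tnthS.
rewrite H//; apply: eq_integral => x _.
rewrite muleC -ge0_integralZl; last 4 first.
- by [].
- apply: emeasurable_funM; last exact/measurable_EFinP.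
  by apply: (measurableT_comp mF); exact: (measurableT_comp (mcons _) mg').
- by move=> t _; rewrite mule_ge0// lee_fin.
- by rewrite lee_fin.
apply: eq_integral => t _; rewrite tuple_fun_cons big_ord_recl tnth0 muleCA.
congr (_ * _); rewrite EFinM; congr (_ * _%:E).
by apply: eq_bigr => j _; rewrite tnthS.
Qed.

End tuple_integral.

(** * Separated points in dyadic blocks of frequencies *)

Section dyadic_tail.
Context {R : realFieldType}.

Lemma sum_half_tail n L :
  \sum_(i < L | (n <= i)%N) 2^-1 ^+ i <= 2 * 2^-1 ^+ n :> R.
Proof.
(* The added term is the remainder of the series from [maxn n L] on; keeping it makes the bound
   stable under the induction on [L]. *)
suff: \sum_(i < L | (n <= i)%N) 2^-1 ^+ i + 2 * 2^-1 ^+ maxn n L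
    <= 2 * 2^-1 ^+ n :> R.
  by apply: le_trans; rewrite lerDl mulr_ge0.
elim: L => [|L IH]; first by rewrite big_ord0 maxn0 add0r.
rewrite big_mkcond big_ord_recr /= -big_mkcond /=.
apply: le_trans IH; have [nL|Ln] := leqP n L.
  rewrite (maxn_idPr _) ?leqW// exprS; lra.
by rewrite addr0 (maxn_idPl Ln).
Qed.

(** At most [n] equal terms below [n], then a geometric tail worth two of them. This sum is the
    source of the factor linear in [n], hence of one logarithm, that each further dimension
    costs. *)
Lemma sum_half_max n L :
  \sum_(i < L) 2^-1 ^+ maxn n i <= n.+2%:R * 2^-1 ^+ n :> R.
Proof.
suff: \sum_(i < L) 2^-1 ^+ maxn n i + 2 * 2^-1 ^+ maxn n L
    <= (minn L n).+2%:R * 2^-1 ^+ n :> R.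
  move=> H; apply: (@le_trans _ _ ((minn L n).+2%:R * 2^-1 ^+ n)).
    by apply: le_trans H; rewrite lerDl mulr_ge0.
  by rewrite ler_wpM2r // ler_nat !ltnS geq_minr.
elim: L => [|L IH]; first by rewrite big_ord0 maxn0 add0r min0n.
rewrite big_ord_recr /=; move: IH; have [nL|Ln] := leqP n L => IH.
  rewrite (minn_idPr _) ?leqW//; apply: le_trans IH; rewrite (maxn_idPr _) ?leqW// exprS; lra.
rewrite (minn_idPl Ln) (maxn_idPl Ln).
rewrite -[L.+3%:R]natr1 mulrDl; lra.
Qed.

(** Tail of the [d]-fold geometric series over dyadic scales. The cut-off [L] makes the sum finite;
    the bounds below are uniform in it. *)
Definition dyadic_tail d n L : R :=
  \sum_(s : d.-tuple 'I_L | (n <= \sum_i tnth s i)%N)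
     2^-1 ^+ (\sum_i tnth s i).

(** Splits off the first scale. The truncated difference [n - i] is 0 once [i >= n], when the other
    scales are unconstrained. *)
Lemma dyadic_tailS d n L :
  dyadic_tail d.+1 n L = \sum_(i < L) 2^-1 ^+ i * dyadic_tail d (n - i) L.
Proof.
rewrite /dyadic_tail.
rewrite (reindex (fun p : 'I_L * d.-tuple 'I_L => [tuple of p.1 :: p.2])); last first.
  exists (fun s => (thead s, [tuple of behead s])).
    by case=> x t _; rewrite theadE; congr pair; exact/val_inj.
  by move=> s _; rewrite /= -tuple_eta.
under [RHS]eq_bigr do rewrite big_distrr /=.
rewrite pair_big_dep /=; apply: eq_big => -[i t] /=.
  rewrite big_ord_recl tnth0 leq_subLR.
  by under [X in (_ <= _ + X)%N]eq_bigr do rewrite tnthS.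
move=> _; rewrite big_ord_recl tnth0 exprD; congr (_ * _ ^+ _).
by apply: eq_bigr => j _; rewrite tnthS.
Qed.

Lemma dyadic_tail0 n L : dyadic_tail 0 n L = (n == 0%N)%:R.
Proof.
rewrite /dyadic_tail big_mkcond (big_pred1 [tuple])/=; last first.
  by move=> s; apply/esym/eqP; exact: tuple0.
by rewrite big_ord0 leqn0 expr0; case: eqP.
Qed.

(** In the induction step [2^-1 ^+ i * 2^-1 ^+ (n - i)] is [2^-1 ^+ maxn n i], which [sum_half_max]
    sums to [n.+2] times [2^-1 ^+ n]; [n.+2 <= 2 * n.+1] explains the factor 2 per dimension. *)
Lemma dyadic_tail_le d n L :
  dyadic_tail d.+1 n L <= 2 ^+ d.+1 * 2^-1 ^+ n * n.+1%:R ^+ d.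
Proof.
elim: d n => [|d IH] n.
  rewrite dyadic_tailS expr1 expr0 mulr1; apply: le_trans (sum_half_tail n L).
  rewrite [leRHS]big_mkcond; apply: ler_sum => i _.
  by rewrite dyadic_tail0 subn_eq0; case: ifP; rewrite ?mulr1 ?mulr0.
rewrite dyadic_tailS.
apply: (@le_trans _ _ (\sum_(i < L) (2 ^+ d.+1 * n.+1%:R ^+ d) * 2^-1 ^+ maxn n i)).
  apply: ler_sum => i _.
  apply: (@le_trans _ _ (2^-1 ^+ i * (2 ^+ d.+1 * 2^-1 ^+ (n - i) * (n - i).+1%:R ^+ d))).
    by rewrite ler_wpM2l.
  rewrite (_ : maxn n i = i + (n - i))%N; last by rewrite maxnC maxnE.
  rewrite exprD -!mulrA [leLHS]mulrCA; apply: ler_wpM2l; first exact: exprn_ge0.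
  rewrite [leRHS]mulrC -!mulrA ler_wpM2l // ler_wpM2l //.
  by rewrite lerXn2r ?nnegrE// ler_nat ltnS leq_subr.
rewrite -big_distrr /=.
apply: (@le_trans _ _ ((2 ^+ d.+1 * n.+1%:R ^+ d) * (n.+2%:R * 2^-1 ^+ n))).
  by rewrite ler_wpM2l// ?sum_half_max// mulr_ge0// exprn_ge0.
rewrite [2 ^+ d.+2]exprS [n.+1%:R ^+ d.+1]exprS.
rewrite (_ : 2 * _ * _ * _ = (2 ^+ d.+1 * n.+1%:R ^+ d) * (2 * n.+1%:R * 2^-1 ^+ n)); last by ring.
rewrite ler_wpM2l ?mulr_ge0 ?exprn_ge0// ler_wpM2r //.
by rewrite -natrM ler_nat; lia.
Qed.

End dyadic_tail.

Lemma sub_sum_exists d (s : 'I_d -> nat) n : (n <= \sum_j s j)%N ->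
  exists2 a : 'I_d -> nat, (forall j, a j <= s j)%N & (\sum_j a j = n)%N.
Proof.
elim: n => [|n IH] ns; first by exists (fun=> 0%N) => //; rewrite big1.
have [a as_ an] := IH (ltnW ns).
have [j ajs] : exists j, (a j < s j)%N.
  apply/existsP; rewrite -[X in is_true X]negbK negb_exists; apply/negP => /forallP H.
  move: ns; rewrite -an ltnNge => /negP; apply; apply: leq_sum => j _.
  by rewrite leqNgt H.
exists (fun i => if i == j then (a i).+1 else a i).
  by move=> i; case: eqP => [->//|_]; exact: as_.
rewrite (bigD1 j)//= eqxx -an [in RHS](bigD1 j)//= addSn; congr (_ + _).+1%N.
by apply: eq_bigr => i /negbTE ->.
Qed.

Lemma ltn_prod d (x y : 'I_d -> nat) i : (forall j, (0 < y j)%N) ->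
  (forall j, (x j <= y j)%N) -> (x i < y i)%N -> (\prod_j x j < \prod_j y j)%N.
Proof.
move=> y0 xy xyi; rewrite (bigD1 i)//= [ltnRHS](bigD1 i)//=.
apply: (@leq_ltn_trans (x i * \prod_(j | j != i) y j)).
  by rewrite leq_mul// leq_prod.
by rewrite ltn_pmul2r// prodn_gt0.
Qed.

(* Pigeonhole: with sum_j a_j = n and a_j <= s_j, each box with sides 2^(a_j)
   contains at most one of the points. *)
Lemma dyadic_block_card d n (s : 'I_d -> nat) (A : seq (d.-tuple int)) :
  uniq A -> (n <= \sum_j s j)%N ->
  (forall l, l \in A -> forall j, (`|tnth l j| < 2 ^ s j)%N) ->
  (forall l l', l \in A -> l' \in A -> l != l' ->
     (2 ^ n <= \prod_j maxn 1 `|tnth l j - tnth l' j|)%N) ->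
  (size A <= 2 ^ d * 2 ^ (\sum_j s j - n))%N.
Proof.
move=> uA ns As Asep; have [a as_ an] := sub_sum_exists ns.
have pos j : (0 < 2 ^ (s j - a j))%N by rewrite expn_gt0.
(* For each coordinate, its sign and the interval of length [2 ^ a j] containing its absolute value;
   the signs account for the factor [2 ^ d]. The modulus merely provides the bound of the ordinal
   type: on [A] the quotient is already smaller. *)
pose phi (l : d.-tuple int) : {dffun forall j, (bool * 'I_(2 ^ (s j - a j)))%type} :=
  [ffun j : 'I_d => (0 <= tnth l j, Ordinal (ltn_pmod (`|tnth l j|%N %/ 2 ^ a j) (pos j)))
    : (bool * 'I_(2 ^ (s j - a j)))%type].
have phi_inj : {in A &, injective phi}.
  move=> l l' lA l'A /ffunP pll'; apply/eqP/negPn/negP => ll'.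
  have := Asep _ _ lA l'A ll'; apply/negP; rewrite -ltnNge.
  have lt_j j : (`|tnth l j - tnth l' j|%N < 2 ^ a j)%N.
    have := pll' j; rewrite !ffunE => -[sg].
    rewrite !modn_small; last first.
    - by rewrite ltn_divLR ?expn_gt0// -expnD subnK ?as_//; exact: As.
    - by rewrite ltn_divLR ?expn_gt0// -expnD subnK ?as_//; exact: As.
    move=> q; have := divn_eq `|tnth l j|%N (2 ^ a j).
    have := divn_eq `|tnth l' j|%N (2 ^ a j); rewrite -q.
    have := @ltn_pmod `|tnth l j|%N (2 ^ a j); have := @ltn_pmod `|tnth l' j|%N (2 ^ a j).
    rewrite expn_gt0 => /(_ isT) + /(_ isT); move: sg.
    set x := (`|tnth l j| %/ _)%N; set y := (`|tnth l j| %% _)%N.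
    set z := (`|tnth l' j| %% _)%N; set t := (2 ^ a j)%N; clearbody x y z t.
    move: (tnth l j) (tnth l' j) => p p'; clear; lia.
  (* Coordinates that agree may give equality, [1 = 2 ^ 0]; a coordinate that differs makes the
     product inequality strict. *)
  have [j0 j0P] : exists j, tnth l j != tnth l' j.
    apply/existsP; move: ll'; apply: contraNT; rewrite negb_exists => /forallP H.
    by apply/eqP/eq_from_tnth => j; apply/eqP; rewrite -[_ == _]negbK H.
  rewrite -an expn_sum; apply: (@ltn_prod _ _ _ j0) => [j|j|].
  - by rewrite expn_gt0.
  - by rewrite geq_max expn_gt0 (ltnW (lt_j j)).
  - by rewrite (maxn_idPr _) ?lt_j// absz_gt0 subr_eq0.
rewrite -(size_map phi) -(card_uniqP _); last by rewrite map_inj_in_uniq.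
apply: leq_trans (max_card _) _.
rewrite card_dep_ffun.
rewrite foldrE big_image /=.
under eq_bigr do rewrite card_prod card_bool card_ord.
rewrite big_split /= prod_nat_const card_ord -expn_sum sumnB ?an//.
Qed.

(** The number of binary digits of [k] in absolute value, so that scale 0 holds only the frequency
    0. *)
Definition dyadic_index (k : int) : nat :=
  if k == 0 then 0%N else (trunc_log 2 `|k|).+1.

Lemma ltn_dyadic_index k : (`|k| < 2 ^ dyadic_index k)%N.
Proof.
by rewrite /dyadic_index; case: eqP => [->//|_]; exact: trunc_log_ltn.
Qed.

Lemma leq_dyadic_index k : (2 ^ dyadic_index k <= 2 * maxn 1 `|k|)%N.
Proof.
rewrite /dyadic_index; case: eqP => [->//|/eqP k0].
rewrite expnS leq_mul2l/= leq_max.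
by apply/orP; right; rewrite trunc_logP ?absz_gt0.
Qed.

(** Group [A] by the tuple of dyadic indices, of sum [S]. Such a block has at most
    [2 ^ (d.+1 + S - n)] elements, each of weight at most [4 ^ d.+1 * 2 ^- (2 * S)], hence total
    weight at most [8 ^ d.+1 * 2 ^- n * 2 ^- S]. Blocks with [S < n] are empty, and [dyadic_tail_le]
    supplies the last factor 2 of [16 = 2 * 4 * 2], a second [2 ^- n] and the power of [n.+1]. *)
Lemma sum_omega_hc_sqr (R : realFieldType) d n (A : seq (d.+1.-tuple int)) :
  uniq A -> (forall l, l \in A -> (2 ^ n <= omega_hc l)%N) ->
  (forall l l', l \in A -> l' \in A -> l != l' ->
     (2 ^ n <= \prod_j maxn 1 `|tnth l j - tnth l' j|)%N) ->
  \sum_(l <- A) (omega_hc l)%:R ^- 2 <=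
    16 ^+ d.+1 * (2^-1 ^+ n) ^+ 2 * n.+1%:R ^+ d :> R.
Proof.
move=> uA Age Asep.
pose L := \max_(l <- A) \max_j dyadic_index (tnth l j).
have ltL l j : l \in A -> (dyadic_index (tnth l j) < L.+1)%N.
  move=> lA; rewrite ltnS /L.
  rewrite (big_rem l lA)/= leq_max; apply/orP; left.
  exact: (@leq_bigmax _ (fun j => dyadic_index (tnth l j)) j).
pose sig (l : d.+1.-tuple int) : d.+1.-tuple 'I_L.+1 :=
  [tuple inord (dyadic_index (tnth l j)) | j < d.+1].
have sigE l j : l \in A -> tnth (sig l) j = dyadic_index (tnth l j) :> nat.
  by move=> lA; rewrite tnth_mktuple inordK// ltL.
rewrite (partition_big sig xpredT)//=.
apply: (@le_trans _ _ (\sum_(s : d.+1.-tuple 'I_L.+1 | (n <= \sum_i tnth s i)%N)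
   8 ^+ d.+1 * 2^-1 ^+ n * 2^-1 ^+ (\sum_i tnth s i))); last first.
  rewrite -big_distrr/=.
  apply: (@le_trans _ _ (8 ^+ d.+1 * 2^-1 ^+ n * (2 ^+ d.+1 * 2^-1 ^+ n * n.+1%:R ^+ d))).
    by rewrite ler_wpM2l ?dyadic_tail_le// mulr_ge0// exprn_ge0// invr_ge0.
  rewrite (_ : 16 = 8 * 2 :> R) ?exprMn; last by rewrite -natrM.
  by rewrite le_eqVlt; apply/orP; left; apply/eqP; ring.
rewrite [leRHS]big_mkcond; apply: ler_sum => s _; rewrite -big_filter.
set B := [seq l <- A | sig l == s].
have BA l : l \in B -> l \in A by rewrite mem_filter => /andP[].
have Bs l j : l \in B -> dyadic_index (tnth l j) = tnth s j.
  by move=> lB; rewrite -(sigE _ _ (BA _ lB)); move: lB; rewrite mem_filter => /andP[/eqP->].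
case: ifPn => [ns|]; last first.
  rewrite -ltnNge => ns; rewrite big_seq big1// => l lB; exfalso.
  have := Age _ (BA _ lB); rewrite leqNgt => /negP; apply.
  apply: (@leq_ltn_trans (2 ^ (\sum_i tnth s i))); last by rewrite ltn_exp2l.
  rewrite expn_sum; apply: leq_prod => j _.
  by rewrite geq_max expn_gt0/= -(Bs _ _ lB) ltnW// ltn_dyadic_index.
have sB : (size B <= 2 ^ d.+1 * 2 ^ (\sum_j tnth s j - n))%N.
  apply: dyadic_block_card => //.
  - exact: filter_uniq.
  - by move=> l lB j; rewrite -(Bs _ _ lB) ltn_dyadic_index.
  - by move=> l l' /BA lA /BA l'A; exact: Asep.
apply: (@le_trans _ _ (\sum_(l <- B) 4 ^+ d.+1 * (2^-1 ^+ (\sum_i tnth s i)) ^+ 2)).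
  rewrite big_seq [leRHS]big_seq; apply: ler_sum => l lB.
  have : (2 ^ (\sum_i tnth s i) <= 2 ^ d.+1 * omega_hc l)%N.
    rewrite expn_sum -[X in (2 ^ X * _)%N]card_ord -prod_nat_const -big_split/=.
    by apply: leq_prod => j _; rewrite -(Bs _ _ lB) leq_dyadic_index.
  rewrite -(ler_nat R) natrM !natrX => H.
  have w0 : 0 < (omega_hc l)%:R :> R by rewrite ltr0n prodn_gt0// => i; rewrite leq_max.
  have t0 : 0 < 2 ^+ (\sum_i tnth s i) :> R by exact: exprn_gt0.
  rewrite (_ : 4 = 2 ^+ 2 :> R); last by rewrite -natrX.
  rewrite [2 ^+ 2 ^+ _]exprAC -exprMn -exprVn lerXn2r ?nnegrE ?invr_ge0 ?mulr_ge0 ?exprn_ge0 ?invr_ge0//.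
  by rewrite exprVn ler_pdivlMr// mulrC ler_pdivrMr.
rewrite big_const_seq count_predT iter_addr_0 -[_ *+ size B]mulr_natr.
have : (size B)%:R <= (2 ^ d.+1 * 2 ^ (\sum_j tnth s j - n))%:R :> R by rewrite ler_nat.
move: ns; set S := (\sum_i _)%N => nS.
rewrite natrM !natrX exprB// ?unitfE ?pnatr_eq0// => H.
apply: le_trans (ler_wpM2l _ H) _; first by rewrite mulr_ge0 ?exprn_ge0 ?invr_ge0.
rewrite (_ : 8 = 4 * 2 :> R) ?exprMn; last by rewrite -natrM.
rewrite !exprVn le_eqVlt; apply/orP; left; apply/eqP; field.
by rewrite !expf_neq0 ?pnatr_eq0.
Qed.

(** * Trigonometric polynomials on the cube *)

Section cube_integral.
Context {R : realType}.
Local Notation lambda := (@lebesgue_measure R).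
Local Notation Rn d := (d.-tuple (measurableTypeR R)).

Lemma measurable_Ihalf : measurable (@Ihalf R).
Proof. exact: measurable_itv. Qed.

Lemma indic_cube d (x : Rn d) :
  \1_(@cube R d) x = \prod_j \1_(@Ihalf R) (tnth x j) :> R.
Proof.
rewrite indicE; have [cx|cx] := pselect (cube x).
  rewrite mem_set// big1// => j _; rewrite indicE mem_set//; exact: cx.
rewrite memNset//; move/existsNP : cx => [j cx].
by rewrite (bigD1 j)//= indicE memNset// mul0r.
Qed.

Lemma measurable_cube d : measurable (@cube R d).
Proof.
rewrite [X in measurable X](_ : _ =
  \bigcap_(j : 'I_d) [set x : Rn d | Ihalf (tnth x j)]); last first.
  by apply/seteqP; split => [x cx j _|x cx j]; exact: cx.
apply: fin_bigcap_measurable => [|j _]; first exact: finite_finset.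
rewrite -[X in measurable X]setTI.
exact: (measurable_tnth j measurableT measurable_Ihalf).
Qed.

Lemma integral_cubeE d (F : Rn d -> \bar R) :
  (\int[lebesgue_tuple d]_(x in @cube R d) F x =
   \int[lebesgue_tuple d]_x (F x * (\prod_j \1_(@Ihalf R) (tnth x j))%:E))%E.
Proof.
rewrite integral_mkcond; apply: eq_integral => x _.
by rewrite -indic_cube patchE indicE; case: (x \in cube); rewrite ?mule1 ?mule0.
Qed.

Lemma is_derive_affine (a c x : R) : is_derive x 1 (fun x : R => a * x + c) a.
Proof.
apply: is_derive_eq; rewrite /GRing.scale/=; ring.
Qed.

Lemma is_derive_sin2pi (theta w x : R) :
  is_derive x 1 (fun x => sin (2 * pi * (w * x + theta)) : R)
    (2 * pi * w * cos (2 * pi * (w * x + theta))).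
Proof.
have -> : (fun x => sin (2 * pi * (w * x + theta))) =
    sin \o (fun x => (2 * pi * w) * x + 2 * pi * theta) :> (R -> R).
  by apply/funext => y /=; congr sin; ring.
have := is_derive_affine (2 * pi * w) (2 * pi * theta) x => H.
have D := is_derive1_comp (is_derive_sin _) H.
by apply: (is_derive_eq D); rewrite mulrC; congr (_ * cos _); ring.
Qed.

(** The constant 1 keeps the integrand nonnegative for the iterated integrals, and the boolean [b]
    is the coefficient left by the integration over the other coordinates. *)
Lemma integral_Ihalf_cos (k : int) (b : bool) (theta : R) :
  (\int[lambda]_(x in Ihalf) (1 + b%:R * cos (2 * pi * (k%:~R * x + theta)))%:E =
   (1 + (b && (k == 0))%:R * cos (2 * pi * theta))%:E)%E.
Proof.
pose F x : R := x + b%:R * (if k == 0 then cos (2 * pi * theta) * x else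
  (2 * pi * k%:~R)^-1 * sin (2 * pi * (k%:~R * x + theta))).
have dF (x : R) : is_derive x 1 F (1 + b%:R * cos (2 * pi * (k%:~R * x + theta))).
  rewrite /F; have [->|k0] := eqVneq k 0.
    have -> : (fun x => x + b%:R * (cos (2 * pi * theta) * x)) =
      (fun x => (1 + b%:R * cos (2 * pi * theta)) * x + 0) :> (R -> R).
      by apply/funext => y; ring.
    by rewrite mul0r add0r; exact: is_derive_affine.
  have D := is_derive_sin2pi theta k%:~R x.
  have pk : 2 * pi * k%:~R != 0 :> R by rewrite !mulf_neq0 ?intr_eq0// gt_eqF// pi_gt0.
  apply: is_derive_eq.
  by rewrite /GRing.scale/= mulKf ?mul0r ?addr0.
have derF x : derivable F x 1 by have D := dF x; exact: ex_derive.
have cf : continuous (fun x : R => 1 + b%:R * cos (2 * pi * (k%:~R * x + theta))).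
  move=> x; apply: cvgD; first exact: cvg_cst.
  apply: cvgM; first exact: cvg_cst.
  apply: (@continuous_comp _ _ _ (fun x : R => 2 * pi * (k%:~R * x + theta)) cos); last exact: continuous_cos.
  apply: cvgM; first exact: cvg_cst.
  apply: cvgD; last exact: cvg_cst.
  by apply: cvgM; [exact: cvg_cst|exact: cvg_id].
have ltI : - 2^-1 < 2^-1 :> R by rewrite gtrN// invr_gt0.
rewrite -(@integral_itv_bndoo _ _ _ _ true false); last first.
  apply/measurable_EFinP/measurable_funTS; exact: continuous_measurable_fun.
rewrite (@continuous_FTC2 _ _ F)//.
- rewrite /F -EFinB; congr _%:E; have [_|k0] := eqVneq k 0; first by rewrite andbT; field.
  rewrite andbF mul0r addr0.
  have -> : 2 * pi * (k%:~R * 2^-1 + theta) = 2 * pi * (k%:~R * - 2^-1 + theta) + 2 * pi * k%:~R :> R by field.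
  have sinp : forall t : R, sin (t + 2 * pi * k%:~R) = sin t.
    move=> t; have := @expi2pi_int R k; rewrite /expi2pi => -[ck sk].
    by rewrite sinD ck sk mulr1 mulr0 addr0.
  rewrite sinp; move: (sin _) => s.
  have p0 : (pi : R) != 0 by rewrite gt_eqF// pi_gt0.
  have kR0 : k%:~R != 0 :> R by rewrite intr_eq0.
  move: p0 kR0; generalize (pi : R) (k%:~R : R) => p q p0 q0.
  by field; rewrite p0 q0.
- exact: continuous_subspaceT.
- split => [x _||].
  + exact: derF.
  + by apply: cvg_at_right_filter; apply: differentiable_continuous; apply/derivable1_diffP; exact: derF.
  + by apply: cvg_at_left_filter; apply: differentiable_continuous; apply/derivable1_diffP; exact: derF.
- by move=> x _; have D := dF x; rewrite derive1E derive_val.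
Qed.

Lemma tnth_lift d (A : Type) (k : d.+1.-tuple A) j :
  tnth k (lift ord0 j) = tnth [tuple of behead k] j.
Proof. by rewrite {1}(tuple_eta k) tnthS. Qed.

Lemma dotp_cons d (k : d.+1.-tuple int) x (t : Rn d) :
  dotp k (tuple_cons (x, t)) = (thead k)%:~R * x + dotp [tuple of behead k] t.
Proof.
rewrite /dotp big_ord_recl tnth0; congr (_ + _); apply: eq_bigr => j _.
by rewrite tnthS tnth_lift.
Qed.

Definition freq0 d (k : d.-tuple int) : bool := [forall j, tnth k j == 0].

Lemma freq0S d (k : d.+1.-tuple int) :
  freq0 k = (thead k == 0) && freq0 [tuple of behead k].
Proof.
apply/forallP/andP => [k0|[k0 /forallP ks] j].
  by split; [exact: k0|apply/forallP => j; rewrite -tnth_lift].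
case: (unliftP ord0 j) => [i ->|->]; last exact: k0.
by rewrite tnth_lift ks.
Qed.

Lemma measurable_dotp d (k : d.-tuple int) : measurable_fun setT (@dotp R d k).
Proof.
apply: measurable_sum => j; apply: measurable_funM => //.
exact: measurable_tnth.
Qed.

Lemma measurable_cos_dotp d (k : d.-tuple int) (theta : R) :
  measurable_fun setT (fun x => cos (2 * pi * (@dotp R d k x + theta))).
Proof.
apply: measurableT_comp; first by apply: continuous_measurable_fun; exact: continuous_cos.
apply: measurable_funM => //; apply: measurable_funD => //.
exact: measurable_dotp.
Qed.

(** Adding 1 gives access to Tonelli. The free phase [theta] carries the induction: it absorbs the
    contribution of the first coordinate. *)
Lemma ge0_integral_cube_cos d (k : d.-tuple int) (theta : R) :
  (\int[lebesgue_tuple d]_(x in @cube R d)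
     (1 + cos (2 * pi * (dotp k x + theta)))%:E =
   (1 + (freq0 k)%:R * cos (2 * pi * theta))%:E)%E.
Proof.
have mcos d' (k' : d'.-tuple int) th D : measurable_fun D
    (fun x => (1 + cos (2 * pi * (dotp k' x + th)))%:E : \bar R).
  apply/measurable_EFinP; apply: measurable_funTS.
  by apply: measurable_funD => //; exact: measurable_cos_dotp.
elim: d k theta => [|d IH] k theta.
  rewrite (_ : cube = setT); last by apply/seteqP; split => // x _ [].
  rewrite integral_dirac//=; last exact: mcos.
  rewrite diracT mul1e /dotp big_ord0 add0r.
  by rewrite (_ : freq0 k) ?mul1r//; apply/forallP => -[].
have m1 d' : measurable_fun setT (fun x : Rn d' => (\prod_j \1_(@Ihalf R) (tnth x j) : R)%:E).
  apply/measurable_EFinP; apply: (@measurable_tuple_prod R d' (fun=> \1_(@Ihalf R))) => j.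
  by apply: measurable_indic; exact: measurable_Ihalf.
have p0 d' (x : Rn d') : 0 <= \prod_j \1_(@Ihalf R) (tnth x j) :> R.
  by apply: prodr_ge0.
rewrite integral_cubeE ge0_integral_tuple_cons; last 2 first.
- by apply: emeasurable_funM; [exact: mcos|exact: m1].
- by move=> x; rewrite mule_ge0// lee_fin.
rewrite freq0S andbC -integral_Ihalf_cos [RHS]integral_mkcond.
apply: eq_integral => x _; rewrite patchE.
transitivity ((\1_(@Ihalf R) x)%:E * \int[lebesgue_tuple d]_(t in @cube R d)
   (1 + cos (2 * pi * (dotp [tuple of behead k] t + ((thead k)%:~R * x + theta))))%:E)%E.
  rewrite integral_cubeE -ge0_integralZl//; last 2 first.
  - by apply: emeasurable_funM; [exact: mcos|exact: m1].
  - by move=> t _; rewrite mule_ge0// lee_fin.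
  apply: eq_integral => t _; rewrite big_ord_recl tnth0 dotp_cons muleCA EFinM.
  congr ((1 + cos (_ * _))%:E * (_ * _%:E))%E; first by rewrite addrCA addrA.
  by apply: eq_bigr => j _; rewrite tnthS.
by rewrite IH indicE; case: (x \in Ihalf); rewrite ?mul1e ?mul0e.
Qed.

Lemma lebesgue_tuple_cube d : lebesgue_tuple d (@cube R d) = 1%E.
Proof.
(* At frequency 0 the phase [4^-1] makes the cosine vanish, so that the formula reduces to the
   integral of 1. *)
have := @ge0_integral_cube_cos d [tuple 0 | _ < d] 4^-1.
have -> : 2 * pi * 4^-1 = pi / 2 :> R by field.
rewrite cos_pihalf mulr0 addr0 => <-.
rewrite -[LHS]mul1e -integral_cst; last exact: measurable_cube.
apply: eq_integral => x _; rewrite /dotp big1 => [|j _]; last first.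
  by rewrite tnth_mktuple mul0r.
have -> : 2 * pi * (0 + 4^-1) = pi / 2 :> R by field.
by rewrite cos_pihalf addr0.
Qed.

Lemma integrable_cube_bounded d (f : Rn d -> R) (M : R) :
  measurable_fun (@cube R d) f -> (forall x, cube x -> `|f x| <= M) ->
  (lebesgue_tuple d).-integrable (@cube R d) (EFin \o f).
Proof.
move=> mf fM; apply: measurable_bounded_integrable => //.
- exact: measurable_cube.
- by rewrite [X in (X < _)%E]lebesgue_tuple_cube ltry.
- exists M; split; first by rewrite num_real.
  by move=> A MA x /fM fxM; apply: (le_trans fxM); exact: ltW.
Qed.

Lemma integrable_cos_dotp d (k : d.-tuple int) (theta : R) :
  (lebesgue_tuple d).-integrable (@cube R d)
    (EFin \o (fun x => cos (2 * pi * (dotp k x + theta)))).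
Proof.
apply: (@integrable_cube_bounded _ _ 1) => [|x _]; last exact: cos_max.
by apply: measurable_funTS; exact: measurable_cos_dotp.
Qed.

Lemma Rintegral_cube_cos d (k : d.-tuple int) (theta : R) :
  \int[lebesgue_tuple d]_(x in @cube R d) cos (2 * pi * (dotp k x + theta)) =
  (freq0 k)%:R * cos (2 * pi * theta).
Proof.
have mc := @measurable_cube d.
have i1 : (lebesgue_tuple d).-integrable (@cube R d) (EFin \o (fun=> 1 : R)).
  by apply: (@integrable_cube_bounded _ _ 1) => // x _; rewrite normr1.
have H : fine (\int[lebesgue_tuple d]_(x in @cube R d)
     (1 + cos (2 * pi * (dotp k x + theta)))%:E)%E =
     (1 + (freq0 k)%:R * cos (2 * pi * theta)).
  by rewrite ge0_integral_cube_cos.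
move: H; rewrite [LHS](RintegralD mc i1 (integrable_cos_dotp k theta)).
rewrite Rintegral_cst// [fine _](_ : _ = 1) ?mul1r; first by move=> /addrI.
by rewrite [X in fine X]lebesgue_tuple_cube.
Qed.

End cube_integral.

Section trigonometric_polynomials.
Context {R : realType} {d : nat}.
Local Notation Rn := (d.-tuple (measurableTypeR R)).
Local Notation mu := (lebesgue_tuple d).
Local Notation e := (@expi2pi R).
Implicit Types (k l : d.-tuple int) (c : d.-tuple int -> R[i]).

Lemma integrable_sumR (I : eqType) (s : seq I) (f : I -> Rn -> R) (D : set Rn) :
  measurable D -> (forall i, mu.-integrable D (EFin \o f i)) ->
  mu.-integrable D (EFin \o (fun x => \sum_(i <- s) f i x)).
Proof.
move=> mD fi; rewrite (_ : EFin \o _ = fun x => (\sum_(i <- s) (EFin \o f i) x)%E).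
  by apply: integrable_sum => // j _; exact: fi.
by apply/funext => x /=; rewrite sumEFin.
Qed.

Lemma Rintegral_sum (I : eqType) (s : seq I) (f : I -> Rn -> R) (D : set Rn) :
  measurable D -> (forall i, mu.-integrable D (EFin \o f i)) ->
  \int[mu]_(x in D) (\sum_(i <- s) f i x) = \sum_(i <- s) \int[mu]_(x in D) f i x.
Proof.
move=> mD fi; elim: s => [|i s IH].
  under eq_Rintegral do rewrite big_nil.
  by rewrite big_nil Rintegral_cst// mul0r.
under eq_Rintegral do rewrite big_cons.
by rewrite big_cons -IH RintegralD//; exact: integrable_sumR.
Qed.

Lemma Re_mul_expi (c : R[i]) (t : R) : complex.Re (c * e t) =
  complex.Re c * cos (2 * pi * t) - complex.Im c * sin (2 * pi * t).
Proof. by case: c. Qed.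

Lemma Im_mul_expi (c : R[i]) (t : R) : complex.Im (c * e t) =
  complex.Re c * sin (2 * pi * t) + complex.Im c * cos (2 * pi * t).
Proof. by case: c. Qed.

(** Shifted cosines thus represent real and imaginary parts alike, and one integral formula serves
    both. *)
Lemma sin_cos2pi (t : R) : sin (2 * pi * t) = cos (2 * pi * (t + - 4^-1)).
Proof.
have -> : 2 * pi * (t + - 4^-1) = 2 * pi * t - pi / 2 by field.
by rewrite cosBpihalf.
Qed.

Let Re_expiE (c : R[i]) k : (fun x => complex.Re (c * e (dotp k x))) =
  (fun x => complex.Re c * cos (2 * pi * (dotp k x + 0)) +
            (- complex.Im c) * cos (2 * pi * (dotp k x + - 4^-1))).
Proof. by apply/funext => x; rewrite Re_mul_expi sin_cos2pi addr0 mulNr. Qed.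

Let integrableZ (a : R) k (theta : R) : mu.-integrable (@cube R d)
  (EFin \o (fun x => a * cos (2 * pi * (dotp k x + theta)))).
Proof.
exact: (integrableZl (@measurable_cube R d) a (integrable_cos_dotp k theta)).
Qed.

Lemma integrable_Re_expi (c : R[i]) k :
  mu.-integrable (@cube R d) (EFin \o (fun x => complex.Re (c * e (dotp k x)))).
Proof.
rewrite Re_expiE.
exact: (integrableD (@measurable_cube R d) (integrableZ _ _ _) (integrableZ _ _ _)).
Qed.

Lemma Rintegral_Re_expi (c : R[i]) k :
  \int[mu]_(x in @cube R d) complex.Re (c * e (dotp k x)) = (freq0 k)%:R * complex.Re c.
Proof.
have mc := @measurable_cube R d.
rewrite Re_expiE RintegralD// !RintegralZl//; try exact: integrable_cos_dotp.
have c0 : cos (2 * pi * - 4^-1) = 0 :> R by rewrite -[- _]add0r -sin_cos2pi mulr0 sin0.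
by rewrite !Rintegral_cube_cos mulr0 cos0 c0 !mulr0 addr0 mulr1 mulrC.
Qed.

Definition trig_poly c (K : seq (d.-tuple int)) (x : Rn) : R[i] :=
  \sum_(k <- K) c k * e (dotp k x).

Lemma cabs_sqr (z : R[i]) : cabs z ^+ 2 = complex.Re (z * (z^*)%C).
Proof.
case: z => a b; rewrite /cabs /= sqr_sqrtr ?addr_ge0 ?sqr_ge0//.
by rewrite mulrN opprK !expr2.
Qed.

Lemma Re_sum (I : Type) (s : seq I) (P : pred I) (F : I -> R[i]) :
  complex.Re (\sum_(i <- s | P i) F i) = \sum_(i <- s | P i) complex.Re (F i).
Proof. by apply: (big_morph (@complex.Re R)) => // -[? ?] [? ?]. Qed.

Lemma Im_sum (I : Type) (s : seq I) (P : pred I) (F : I -> R[i]) :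
  complex.Im (\sum_(i <- s | P i) F i) = \sum_(i <- s | P i) complex.Im (F i).
Proof. by apply: (big_morph (@complex.Im R)) => // -[? ?] [? ?]. Qed.

Lemma freq0B k l : freq0 (freqB k l) = (k == l).
Proof.
apply/forallP/eqP => [H|-> j]; last by rewrite tnth_mktuple subrr.
by apply: eq_from_tnth => j; have := H j; rewrite tnth_mktuple subr_eq0 => /eqP.
Qed.

Lemma cabs_trig_polyE c (K : seq (d.-tuple int)) x :
  cabs (trig_poly c K x) ^+ 2 = \sum_(k <- K) \sum_(l <- K)
    complex.Re (c k * ((c l)^*)%C * e (dotp (freqB k l) x)).
Proof.
rewrite cabs_sqr /trig_poly rmorph_sum/= big_distrl/= Re_sum; apply: eq_bigr => k _.
rewrite big_distrr/= Re_sum; apply: eq_bigr => l _.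
rewrite dotpB expi2piD expi2piN rmorphM/=; congr complex.Re; ring.
Qed.

Lemma parseval c (K : seq (d.-tuple int)) : uniq K ->
  \int[mu]_(x in @cube R d) (cabs (trig_poly c K x) ^+ 2) = \sum_(k <- K) cabs (c k) ^+ 2.
Proof.
move=> uK; under eq_Rintegral do rewrite cabs_trig_polyE.
have mc := @measurable_cube R d.
rewrite Rintegral_sum//; last first.
  by move=> k; apply: integrable_sumR => // l; exact: integrable_Re_expi.
apply: eq_big_seq => k kK.
rewrite Rintegral_sum//; last by move=> l; exact: integrable_Re_expi.
under eq_bigr do rewrite Rintegral_Re_expi freq0B.
rewrite (bigD1_seq k)//= eqxx mul1r -cabs_sqr big1 ?addr0// => l.
by rewrite eq_sym => /negbTE ->; rewrite mul0r.
Qed.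

Lemma integrable_cabs_trig_poly c (K : seq (d.-tuple int)) :
  mu.-integrable (@cube R d) (EFin \o (fun x => cabs (trig_poly c K x) ^+ 2)).
Proof.
rewrite (_ : (fun _ => _) = (fun x => \sum_(k <- K) \sum_(l <- K)
    complex.Re (c k * ((c l)^*)%C * e (dotp (freqB k l) x)))); last first.
  by apply/funext => x; exact: cabs_trig_polyE.
have mc := @measurable_cube R d.
by do 2 (apply: integrable_sumR => // ?); exact: integrable_Re_expi.
Qed.

Lemma measurable_cabs_trig_poly c (K : seq (d.-tuple int)) D :
  measurable_fun D (fun x => cabs (trig_poly c K x) ^+ 2).
Proof.
apply: measurable_funTS.
rewrite (_ : (fun _ => _) = (fun x => \sum_(k <- K) \sum_(l <- K)
    complex.Re (c k * ((c l)^*)%C * e (dotp (freqB k l) x)))).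
  apply: measurable_sum => k; apply: measurable_sum => l; rewrite Re_expiE.
  by apply: measurable_funD; apply: measurable_funM => //; exact: measurable_cos_dotp.
by apply/funext => x; exact: cabs_trig_polyE.
Qed.

End trigonometric_polynomials.

(** * Aliasing errors of trigonometric polynomials *)

Section finite_sums.
Context {R : realType}.

Lemma cauchy_schwarz_sum (I : Type) (s : seq I) (P : pred I) (a b : I -> R) :
  (\sum_(i <- s | P i) a i * b i) ^+ 2 <=
  (\sum_(i <- s | P i) a i ^+ 2) * (\sum_(i <- s | P i) b i ^+ 2).
Proof.
set T := \sum_(i <- s | P i) a i * b i.
set A := \sum_(i <- s | P i) a i ^+ 2; set B := \sum_(i <- s | P i) b i ^+ 2.
have A0 : 0 <= A by apply: sumr_ge0 => i _; exact: sqr_ge0.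
have B0 : 0 <= B by apply: sumr_ge0 => i _; exact: sqr_ge0.
have H t : 0 <= t ^+ 2 * A - 2 * t * T + B.
  have -> : t ^+ 2 * A - 2 * t * T + B = \sum_(i <- s | P i) (t * a i - b i) ^+ 2.
    rewrite /A /B /T !big_distrr/= -sumrB -big_split/=.
    by apply: eq_bigr => i _; ring.
  by apply: sumr_ge0 => i _; exact: sqr_ge0.
have [A00|A00] := eqVneq A 0.
  have [->|T0] := eqVneq T 0; first by rewrite expr0n mulr_ge0.
  (* With [A = 0] the quadratic is affine in [t]; this value of [t] makes it -1. *)
  have := H ((B + 1) / (2 * T)).
  have -> : ((B + 1) / (2 * T)) ^+ 2 * A - 2 * ((B + 1) / (2 * T)) * T + B = -1.
    by rewrite A00; field.
  by rewrite oppr_ge0 ler10.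
(* The minimiser of the quadratic. *)
have := H (T / A); have -> : (T / A) ^+ 2 * A - 2 * (T / A) * T + B = (A * B - T ^+ 2) / A by field.
by rewrite pmulr_lge0 ?invr_gt0 ?lt_neqAle 1?eq_sym ?A00// subr_ge0.
Qed.

Lemma sum_unique_le (I : eqType) (s : seq I) (P : pred I) (w : R) :
  uniq s -> 0 <= w -> (forall i j, i \in s -> j \in s -> P i -> P j -> i = j) ->
  \sum_(i <- s | P i) w <= w.
Proof.
move=> us w0 H; have [/hasP[i is_ Pi]|/hasPn nP] := boolP (has P s).
  rewrite big_mkcond (bigD1_seq i)//= Pi big_seq_cond big1 ?addr0// => j /andP[js ji].
  by case: ifP => // Pj; move: ji; rewrite (H j i) ?eqxx.
by rewrite big_seq_cond big1// => i /andP[/nP/negbTE ->].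
Qed.

Lemma cabs0 : cabs (0 : R[i]) = 0.
Proof. exact: ComplexField.Normc.normc0. Qed.

Lemma cabs_ge0 (z : R[i]) : 0 <= cabs z.
Proof. by case: z => a b; exact: sqrtr_ge0. Qed.

Lemma cabsD (y z : R[i]) : cabs (y + z) <= cabs y + cabs z.
Proof. exact: le_normcD. Qed.

Lemma cabsN (z : R[i]) : cabs (- z) = cabs z.
Proof. exact: normcN. Qed.

Lemma cabs_sum (I : Type) (s : seq I) (P : pred I) (c : I -> R[i]) :
  cabs (\sum_(i <- s | P i) c i) <= \sum_(i <- s | P i) cabs (c i).
Proof.
elim/big_rec2: _ => [|i x y _ H]; first by rewrite cabs0.
by apply: le_trans (cabsD _ _) _; rewrite lerD2l.
Qed.

End finite_sums.

Section aliasing_error.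
Context {R : realType} {d : nat}.
Variables (m N M : nat) (z : d.+1.-tuple int).
Hypotheses (m0 : (0 < m)%N) (N1 : (1 < N)%N) (M0 : (0 < M)%N).
Hypothesis zM : reconstructing z M (hyperbolic_cross N).
Local Notation freq := (d.+1.-tuple int).
Local Notation alias l k := (M%:Z %| freq_dot (freqB l k) z)%Z.
Implicit Types (k l : freq) (c : freq -> R[i]) (K : seq freq).

Lemma omega_hc_gt0 k : (0 < omega_hc k)%N.
Proof. by rewrite prodn_gt0// => j; rewrite leq_max. Qed.

Lemma alias_refl k : alias k k.
Proof. by rewrite /freq_dot big1 ?dvdz0// => j _; rewrite tnth_mktuple subrr mul0r. Qed.

Lemma alias_trans k l1 l2 : alias l1 k -> alias l2 k -> alias l1 l2.
Proof.
have -> : freq_dot (freqB l1 l2) z = freq_dot (freqB l1 k) z - freq_dot (freqB l2 k) z.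
  by rewrite /freq_dot -sumrB; apply: eq_bigr => j _; rewrite !tnth_mktuple; ring.
by move=> a1 a2; rewrite rpredB.
Qed.

Lemma alias_sym k l : alias l k -> alias k l.
Proof. by move=> lk; apply: (@alias_trans l) => //; rewrite ?alias_refl//; apply: alias_trans (alias_refl _) lk. Qed.

Lemma alias_cross k1 k2 : (omega_hc k1 <= N)%N -> (omega_hc k2 <= N)%N ->
  alias k1 k2 -> k1 = k2.
Proof.
move=> h1 h2 a12; apply/eqP; apply: contraT => /(zM h1 h2)/negP; case.
by move: a12; rewrite /freq_dot; under eq_bigr do rewrite tnth_mktuple.
Qed.

(** The difference of two aliases is an alias of 0, and 0 lies in the cross. Were the difference in
    the cross too, the reconstruction property would make it 0. *)
Lemma alias_separated l1 l2 : alias l1 l2 -> l1 != l2 ->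
  (N < \prod_j maxn 1 `|tnth l1 j - tnth l2 j|)%N.
Proof.
move=> a12 l12; rewrite ltnNge; apply/negP => le_N.
pose z0 : freq := [tuple 0 | _ < d.+1].
have h0 : (omega_hc z0 <= N)%N.
  by rewrite /omega_hc big1 => [|j _]; [exact: ltnW|rewrite tnth_mktuple].
have h1 : (omega_hc (freqB l1 l2) <= N)%N.
  by rewrite /omega_hc; under eq_bigr do rewrite tnth_mktuple.
move: l12; rewrite -freq0B => /negP; apply.
rewrite (alias_cross h1 h0).
  by apply/forallP => j; rewrite tnth_mktuple.
move: a12; rewrite /freq_dot; congr (_ %| _)%Z; apply: eq_bigr => j _.
by rewrite !tnth_mktuple subr0.
Qed.

(** Bound for the sum of [omega_hc l ^- (2 * m)] over the nontrivial aliases of a frequency of the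
    cross. The 4 is the squared loss in [2^-1 ^+ n <= 2 / N] for [n = trunc_log 2 N]. *)
Definition alias_const : R :=
  4 * 16 ^+ d.+1 * (trunc_log 2 N).+1%:R ^+ d / (N ^ (2 * m))%:R.

Lemma sum_alias_weight K k : uniq K -> (omega_hc k <= N)%N ->
  \sum_(l <- K | (l != k) && alias l k) (omega_hc l ^ m)%:R^-1 ^+ 2 <= alias_const.
Proof.
move=> uK kN; set n := trunc_log 2 N.
have nN : (2 ^ n <= N)%N by rewrite trunc_logP// ltnW.
have Nn : (N < 2 ^ n.+1)%N by rewrite trunc_log_ltn.
rewrite -big_filter; set A := [seq l <- K | _].
have AP l : l \in A -> [/\ l != k, alias l k & (N < omega_hc l)%N].
  rewrite mem_filter => /andP[/andP[lk al] _]; split => //.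
  by rewrite ltnNge; apply/negP => lN; move: lk; rewrite (alias_cross lN kN al) eqxx.
have NR0 : 0 < N%:R :> R by rewrite ltr0n ltnW.
(* Nontrivial aliases satisfy [N < omega_hc l]: the powers beyond the second are bounded by powers
   of [N], and the dyadic estimate is needed for exponent 2 alone. *)
apply: (@le_trans _ _ (\sum_(l <- A) N%:R ^- (2 * m.-1) * (omega_hc l)%:R ^- 2)).
  rewrite big_seq [leRHS]big_seq; apply: ler_sum => l /AP[_ _ Nl].
  have w0 : 0 < (omega_hc l)%:R :> R by rewrite ltr0n omega_hc_gt0.
  rewrite natrX -exprVn -exprM -!exprVn (_ : (m * 2 = 2 * m.-1 + 2)%N); last by lia.
  rewrite exprD ler_wpM2r ?sqr_ge0// lerXn2r// ?nnegrE ?invr_ge0 ?(ltW w0) ?(ltW NR0)//.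
  by rewrite lef_pV2 ?posrE// ler_nat ltnW.
rewrite -big_distrr/=.
have H : \sum_(l <- A) (omega_hc l)%:R ^- 2 <= 16 ^+ d.+1 * (2^-1 ^+ n) ^+ 2 * n.+1%:R ^+ d :> R.
  apply: sum_omega_hc_sqr.
  - exact: filter_uniq.
  - by move=> l /AP[_ _]; move=> /ltnW; exact: leq_trans.
  - move=> l1 l2 /AP[_ a1 _] /AP[_ a2 _] l12.
    by apply: (leq_trans nN); apply/ltnW/alias_separated => //; exact: alias_trans a1 a2.
apply: le_trans (ler_wpM2l _ H) _; first by rewrite invr_ge0 exprn_ge0// ltW.
rewrite /alias_const natrX -/n.
have hx : 2^-1 ^+ n <= 2 * N%:R^-1 :> R.
  rewrite ler_pdivlMr// exprVn ler_pdivrMl ?exprn_gt0// mulrC -exprS -natrX.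
  by rewrite ler_nat ltnW.
rewrite -!exprVn (_ : (2 * m = 2 * m.-1 + 2)%N); last by lia.
rewrite exprD (_ : _ * (_ * _ * _) =
  (N%:R^-1 ^+ (2 * m.-1) * 16 ^+ d.+1 * n.+1%:R ^+ d) * (2^-1 ^+ n) ^+ 2); last by ring.
rewrite (_ : 4 * _ * _ * _ =
  (N%:R^-1 ^+ (2 * m.-1) * 16 ^+ d.+1 * n.+1%:R ^+ d) * (2 * N%:R^-1) ^+ 2); last by ring.
have x0 : 0 <= N%:R^-1 :> R by rewrite invr_ge0 ltW.
rewrite ler_wpM2l ?mulr_ge0 ?exprn_ge0//.
by rewrite lerXn2r ?nnegrE ?mulr_ge0 ?exprn_ge0 ?invr_ge0.
Qed.

Definition lattice_coef c K k : R[i] := \sum_(l <- K | alias l k) c l.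

Definition error_coef c K k : R[i] :=
  if (omega_hc k <= N)%N then c k - lattice_coef c K k else c k.

Lemma error_trig_poly c K x : trig_poly c K x -
    \sum_(k <- K | (omega_hc k <= N)%N) lattice_coef c K k * expi2pi (dotp k x) =
  trig_poly (error_coef c K) K x.
Proof.
rewrite [X in _ - X]big_mkcond/= /trig_poly -sumrB; apply: eq_bigr => k _.
by rewrite /error_coef; case: ifP => _; rewrite ?subr0// mulrBl.
Qed.

(** The alias [l = k] cancels [c k]. The other ones are weighted by [omega_hc l ^ m] and its inverse
    before Cauchy-Schwarz. *)
Lemma cabs_error_coef c K k : uniq K -> k \in K -> (omega_hc k <= N)%N ->
  cabs (error_coef c K k) ^+ 2 <= alias_const *
    \sum_(l <- K | (l != k) && alias l k) ((omega_hc l ^ m)%:R * cabs (c l)) ^+ 2.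
Proof.
move=> uK kK kN; rewrite /error_coef kN /lattice_coef.
have -> : c k - \sum_(l <- K | alias l k) c l = - \sum_(l <- K | (l != k) && alias l k) c l.
  rewrite big_mkcond (bigD1_seq k)//= alias_refl opprD addrA subrr add0r.
  by rewrite -big_mkcondr.
rewrite cabsN; apply: (@le_trans _ _ ((\sum_(l <- K | (l != k) && alias l k)
    (omega_hc l ^ m)%:R^-1 * ((omega_hc l ^ m)%:R * cabs (c l))) ^+ 2)).
  rewrite lerXn2r ?nnegrE ?cabs_ge0//.
    by apply: sumr_ge0 => l _; rewrite !mulr_ge0 ?invr_ge0 ?cabs_ge0.
  apply: le_trans (cabs_sum _ _ _) _; apply: ler_sum => l _.
  by rewrite mulKf// pnatr_eq0 -lt0n expn_gt0 omega_hc_gt0.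
apply: le_trans (cauchy_schwarz_sum _ _ _ _) _.
rewrite ler_wpM2r ?sum_alias_weight//.
by apply: sumr_ge0 => l _; exact: sqr_ge0.
Qed.

(** Outside of the cross the error is pure truncation and [omega_hc k > N] pays for [N ^- (2 * m)].
    Inside, the sums over [k] and over its aliases [l] are exchanged; two elements of the cross
    sharing the alias [l] would be aliases of each other, hence equal, so each [l] occurs at most
    once. *)
Lemma sum_error_coef c K : uniq K ->
  \sum_(k <- K) cabs (error_coef c K k) ^+ 2 <=
  (((N ^ (2 * m))%:R)^-1 + alias_const) *
    \sum_(k <- K) (omega_hc k)%:R ^+ (2 * m) * cabs (c k) ^+ 2.
Proof.
move=> uK; have wE l : (omega_hc l)%:R ^+ (2 * m) * cabs (c l) ^+ 2 =
    ((omega_hc l ^ m)%:R * cabs (c l)) ^+ 2.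
  by rewrite exprMn natrX -exprM mulnC.
under [X in _ <= _ * X]eq_bigr do rewrite wE.
rewrite (bigID (fun k => (omega_hc k <= N)%N))/= addrC mulrDl lerD//.
  rewrite big_distrr/= [leRHS](bigID (fun k => (omega_hc k <= N)%N))/=.
  rewrite ler_wpDl//.
    by apply: sumr_ge0 => k _; rewrite mulr_ge0 ?invr_ge0 ?sqr_ge0.
  apply: ler_sum => k kN; rewrite /error_coef (negbTE kN) exprMn mulrA.
  rewrite ler_peMl ?sqr_ge0// mulrC ler_pdivlMr ?mul1r; last first.
    by rewrite ltr0n expn_gt0 (ltnW N1).
  by rewrite -natrX ler_nat -expnM mulnC leq_exp2r ?muln_gt0 ?m0// ltnW// ltnNge.
have alias0 : 0 <= alias_const by rewrite !mulr_ge0 ?exprn_ge0 ?invr_ge0.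
apply: (@le_trans _ _ (\sum_(k <- K | (omega_hc k <= N)%N) alias_const *
    \sum_(l <- K | (l != k) && alias l k) ((omega_hc l ^ m)%:R * cabs (c l)) ^+ 2)).
  rewrite big_seq_cond [leRHS]big_seq_cond; apply: ler_sum => k /andP[kK kN].
  exact: cabs_error_coef.
rewrite -big_distrr/= ler_wpM2l// (exchange_big_dep xpredT)//=.
apply: ler_sum => l _; apply: sum_unique_le; rewrite ?sqr_ge0//.
move=> k1 k2 _ _ /andP[k1N /andP[_ a1]] /andP[k2N /andP[_ a2]].
apply: alias_cross => //; apply: alias_trans (alias_refl k1) _.
by apply: alias_trans (alias_sym a2) _; exact: alias_sym.
Qed.

End aliasing_error.

(** * Uniqueness of Fourier coefficients *)

Section step_polynomials.
Context {R : realType}.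

Lemma bernoulli_ineq (x : R) n : -1 <= x -> 1 + n%:R * x <= (1 + x) ^+ n.
Proof.
move=> x1; elim: n => [|n IH]; first by rewrite mul0r addr0 expr0.
have x10 : 0 <= 1 + x by rewrite addrC -lerBlDr sub0r.
rewrite exprSr; apply: le_trans (ler_wpM2r x10 IH).
rewrite -natr1; have : 0 <= n%:R * x ^+ 2 by rewrite mulr_ge0// sqr_ge0.
by nra.
Qed.

(** With [s] the square root of [r], one factor [s ^+ n] absorbs [n] by Bernoulli's inequality for
    [s^-1], and the other one still tends to 0. *)
Lemma cvg_natr_mul_expr (r : R) : 0 <= r -> r < 1 ->
  n%:R * r ^+ n @[n --> \oo] --> 0.
Proof.
move=> r0 r1; have [->|rn0] := eqVneq r 0.
  rewrite -(@cvg_shiftS R^o) /=; under eq_fun do rewrite exprS mul0r mulr0.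
  exact: cvg_cst.
have rp : 0 < r by rewrite lt_neqAle eq_sym rn0.
set s := Num.sqrt r; have sp : 0 < s by rewrite sqrtr_gt0.
have s1 : s < 1 by rewrite -[ltRHS]sqrtr1 ltr_sqrt.
have d0 : 0 < s^-1 - 1 by rewrite subr_gt0 invf_gt1.
apply: (@squeeze_cvgr _ _ _ _ (fun=> 0) (fun n => (s^-1 - 1)^-1 * s ^+ n)).
- apply: nearW => n; rewrite mulr_ge0 ?exprn_ge0//=.
  have -> : r = s * s by rewrite -expr2 sqr_sqrtr.
  rewrite exprMn mulrA ler_wpM2r ?exprn_ge0 ?(ltW sp)//.
  rewrite -[leRHS]mulr1 ler_pdivlMl// mulrA -ler_pdivlMr ?exprn_gt0// div1r -exprVn.
  have := @bernoulli_ineq (s^-1 - 1) n; rewrite (_ : 1 + (s^-1 - 1) = s^-1) => [H|]; last by ring.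
  apply: le_trans (H _); last by rewrite lerBrDl subrr invr_ge0 ltW.
  by rewrite [leLHS]mulrC lerDr.
- exact: cvg_cst.
- rewrite -[X in _ --> X](mulr0 (s^-1 - 1)^-1); apply: cvgM; first exact: cvg_cst.
  by apply: cvg_expr; rewrite ger0_norm ?ltW.
Qed.

(* Maps trigonometric polynomials to trigonometric polynomials, and converges
   boundedly on [0, 1] to the indicator of [0, 1/2). *)
Definition step_pow n (t : R) : R := (1 - t ^+ n) ^+ (n * 2 ^ n).

Lemma step_pow_itv n (t : R) : 0 <= t <= 1 -> 0 <= step_pow n t <= 1.
Proof.
move=> /andP[t0 t1]; have tn0 : 0 <= t ^+ n by exact: exprn_ge0.
have tn1 : t ^+ n <= 1 by exact: exprn_ile1.
by rewrite exprn_ge0 ?subr_ge0//= exprn_ile1 ?subr_ge0// gerBl.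
Qed.

(** The exponent [n * 2 ^ n] compares [t] with 1/2 through [n * (2 * t) ^ n]. For [t < 2^-1]
    Bernoulli's inequality bounds the distance to 1 by this quantity, which tends to 0. Otherwise
    [(1 - x) * (1 + x) <= 1] with [x = t ^+ n] bounds [step_pow n t] by the inverse of
    [(1 + x) ^+ (n * 2 ^ n)], which is at least [n.+1]. *)
Lemma cvg_step_pow (t : R) : 0 <= t <= 1 ->
  (fun n => step_pow n t) @ \oo --> ((t < 2^-1)%R%:R : R).
Proof.
move=> t01; have /andP[t0 t1] := t01; have [t2|t2] := ltP t 2^-1.
  apply: (@squeeze_cvgr _ _ _ _ (fun n => 1 - n%:R * (2 * t) ^+ n) (fun=> 1)).
  - apply: nearW => n; have /andP[_ ->] := @step_pow_itv n _ t01; rewrite andbT.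
    have := @bernoulli_ineq (- t ^+ n) (n * 2 ^ n).
    rewrite lerN2 exprn_ile1// => /(_ isT).
    by rewrite exprMn natrM natrX mulrN -mulrA.
  - rewrite -[X in _ --> X]subr0; apply: cvgB; first exact: cvg_cst.
    apply: cvg_natr_mul_expr; first by rewrite mulr_ge0.
    by rewrite mulrC -ltr_pdivlMr// div1r.
  - exact: cvg_cst.
apply: (@squeeze_cvgr _ _ _ _ (fun=> 0) (fun n => n.+1%:R^-1)).
- apply: nearW => n; have /andP[-> _] /= := @step_pow_itv n _ t01.
  have tn0 : 0 <= t ^+ n by exact: exprn_ge0.
  have tn1 : t ^+ n <= 1 by exact: exprn_ile1.
  have H1 : step_pow n t * (1 + t ^+ n) ^+ (n * 2 ^ n) <= 1.
    rewrite /step_pow -exprMn exprn_ile1//.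
      by rewrite mulr_ge0 ?subr_ge0// addr_ge0.
    by rewrite -subr_sqr expr1n gerBl sqr_ge0.
  have H2 : n.+1%:R <= (1 + t ^+ n) ^+ (n * 2 ^ n).
    apply: le_trans (@bernoulli_ineq _ _ _); last exact: le_trans tn0.
    rewrite -natr1 addrC lerD2l natrM natrX -mulrA -exprMn ler_peMr// exprn_ege1//.
    by rewrite -ler_pdivrMl ?mulr1.
  rewrite -[leRHS]mul1r ler_pdivlMr//; apply: le_trans H1.
  by rewrite ler_wpM2l//; have /andP[] := @step_pow_itv n _ t01.
- exact: cvg_cst.
- exact: cvg_harmonic.
Qed.

End step_polynomials.

Section fourier_uniqueness.
Context {R : realType} {d : nat}.
Local Notation Rn := (d.-tuple (measurableTypeR R)).
Local Notation mu := (lebesgue_tuple d).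
Implicit Types (k l : d.-tuple int) (p q : Rn -> R).

(** The real trigonometric polynomials: the phases provide sines and constants, and boundedness,
    measurability and products follow by induction. *)
Inductive real_trig : (Rn -> R) -> Prop :=
| real_trig_cos k (theta : R) : real_trig (fun x => cos (2 * pi * (dotp k x + theta)))
| real_trigD p q : real_trig p -> real_trig q -> real_trig (fun x => p x + q x)
| real_trigZ (a : R) p : real_trig p -> real_trig (fun x => a * p x).

Lemma real_trig_cst (a : R) : real_trig (fun=> a).
Proof.
have := real_trigZ a (real_trig_cos [tuple 0 | _ < d] 0).
congr real_trig; apply/funext => x.
rewrite /dotp big1 ?addr0 ?mulr0 ?cos0 ?mulr1// => j _.
by rewrite tnth_mktuple mul0r.
Qed.

Lemma real_trigM p q : real_trig p -> real_trig q -> real_trig (fun x => p x * q x).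
Proof.
elim=> {p} [k theta|p1 p2 _ IH1 _ IH2|a p _ IH] tq.
- elim: tq => {q} [l eta|q1 q2 _ IH1 _ IH2|a q _ IH].
  + pose z0 : d.-tuple int := [tuple 0 | _ < d].
    (* Product-to-sum formula; [freqB k (freqB z0 l)] is the frequency [k + l]. *)
    have := real_trigZ 2^-1 (real_trigD
      (real_trig_cos (freqB k l) (theta - eta))
      (real_trig_cos (freqB k (freqB z0 l)) (theta + eta))).
    congr real_trig; apply/funext => x; rewrite !dotpB.
    have -> : dotp z0 x = 0 :> R.
      by rewrite /dotp big1// => j _; rewrite tnth_mktuple mul0r.
    have -> : 2 * pi * (dotp k x - dotp l x + (theta - eta)) =
      2 * pi * (dotp k x + theta) - 2 * pi * (dotp l x + eta) :> R by ring.
    have -> : 2 * pi * (dotp k x - (0 - dotp l x) + (theta + eta)) =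
      2 * pi * (dotp k x + theta) + 2 * pi * (dotp l x + eta) :> R by ring.
    by rewrite cosB cosD; field.
  + have := real_trigD IH1 IH2; congr real_trig; apply/funext => x; ring.
  + have := real_trigZ a IH; congr real_trig; apply/funext => x; ring.
- have := real_trigD (IH1 tq) (IH2 tq); congr real_trig; apply/funext => x; ring.
- have := real_trigZ a (IH tq); congr real_trig; apply/funext => x; ring.
Qed.

Lemma real_trigX p n : real_trig p -> real_trig (fun x => p x ^+ n).
Proof.
move=> tp; elim: n => [|n IH]; first exact: real_trig_cst.
have := real_trigM tp IH; congr real_trig; apply/funext => x; by rewrite exprS.
Qed.

Lemma real_trig_step_pow p n : real_trig p -> real_trig (fun x => step_pow n (p x)).
Proof.
move=> tp; apply: real_trigX.
have := real_trigD (real_trig_cst 1) (real_trigZ (-1) (real_trigX n tp)).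
by congr real_trig; apply/funext => x; rewrite mulN1r.
Qed.

Lemma measurable_real_trig p : real_trig p -> measurable_fun setT p.
Proof.
elim=> [k theta|{}p q _ mp _ mq|a {}p _ mp].
- exact: measurable_cos_dotp.
- exact: measurable_funD.
- exact: measurable_funM.
Qed.

Lemma bounded_real_trig p : real_trig p -> exists M, forall x, `|p x| <= M.
Proof.
elim=> [k theta|{}p q _ [M Mp] _ [N Nq]|a {}p _ [M Mp]].
- by exists 1 => x; exact: cos_max.
- by exists (M + N) => x; apply: le_trans (ler_normD _ _) (lerD _ _).
- by exists (`|a| * M) => x; rewrite normrM ler_wpM2l.
Qed.

Variable f : Rn -> R.
Hypothesis fi : mu.-integrable (@cube R d) (EFin \o f).
Hypothesis f_cos : forall k theta,
  (\int[mu]_(x in @cube R d) (f x * cos (2 * pi * (dotp k x + theta)))%:E = 0)%E.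

Let mc : measurable (@cube R d). Proof. exact: measurable_cube. Qed.

Let integrable_fM (h : Rn -> R) (M : R) (E : set Rn) : measurable E ->
  measurable_fun setT h -> (forall x, `|h x| <= M) ->
  mu.-integrable (cube `&` E) (EFin \o (fun x => f x * h x)).
Proof.
move=> mE mh hM; have mcE : measurable (cube `&` E) by exact: measurableI.
apply: (@integrableMl _ _ _ mu _ mcE (EFin \o f) h).
- by apply: integrableS fi => //; exact: subIsetl.
- exact: measurable_funTS.
- exists M; split; first by rewrite num_real.
  by move=> A MA x _; apply: le_trans (hM x) _; exact: ltW.
Qed.

Let integrable_fp p (E : set Rn) : measurable E -> real_trig p ->
  mu.-integrable (cube `&` E) (EFin \o (fun x => f x * p x)).
Proof.
move=> mE tp; have [M pM] := bounded_real_trig tp.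
by apply: integrable_fM pM => //; exact: measurable_real_trig.
Qed.

Definition annihilates (E : set Rn) := forall p, real_trig p ->
  (\int[mu]_(x in cube `&` E) (f x * p x)%:E = 0)%E.

(** Quantifying over all [E] gives closure under intersection, by cutting twice; with complements
    and countable unions the class is then a sigma-algebra. *)
Definition cuts (A : set Rn) := measurable A /\
  forall E, measurable E -> annihilates E -> annihilates (E `&` A).

Lemma annihilatesT : annihilates setT.
Proof.
have ip p : real_trig p -> mu.-integrable cube (EFin \o (fun x => f x * p x)).
  by move=> tp; have := integrable_fp measurableT tp; rewrite setIT.
move=> p; rewrite setIT; elim => [k theta|{}p q tp IHp tq IHq|a {}p tp IHp].
- exact: f_cos.
- under eq_integral do rewrite mulrDr EFinD.
  rewrite (integralD mc (ip _ tp) (ip _ tq)) IHp IHq; exact: adde0.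
- under eq_integral do rewrite mulrCA EFinM.
  by rewrite (integralZl mc (ip _ tp)) IHp mule0.
Qed.

Lemma cutsC A : cuts A -> cuts (~` A).
Proof.
move=> [mA cA]; split; first exact: measurableC.
move=> E mE aE p tp.
have mEA := measurableI _ _ mE mA; have mEC := measurableI _ _ mE (measurableC mA).
have := aE p tp.
rewrite (_ : cube `&` E = (cube `&` (E `&` A)) `|` (cube `&` (E `&` ~` A))); last first.
  by rewrite -setIUr -setIUr setUv setIT.
rewrite integral_setU//; last 4 first.
- exact: measurableI.
- exact: measurableI.
- rewrite -setIUr -setIUr setUv setIT.
  exact: (measurable_int mu (integrable_fp mE tp)).
- by apply/disj_set2P; rewrite setIACA [E `&` A `&` _]setIACA setICr !setI0.
by rewrite (cA _ mE aE p tp) add0e.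
Qed.

Lemma cutsI A B : cuts A -> cuts B -> cuts (A `&` B).
Proof.
move=> [mA cA] [mB cB]; split; first exact: measurableI.
by move=> E mE aE; rewrite setIA; apply: cB; [exact: measurableI|exact: cA].
Qed.

Lemma cuts0 : cuts set0.
Proof.
by split => // E mE aE p tp; rewrite !setI0 integral_set0.
Qed.

(** The disjoint pieces [seqDU F n] are Boolean combinations of cutting sets, and the integral is
    countably additive over them. *)
Lemma cuts_bigcup (F : (set Rn)^nat) : (forall n, cuts (F n)) -> cuts (\bigcup_n F n).
Proof.
move=> cF; have cD n : cuts (seqDU F n).
  rewrite /seqDU setDE; apply: cutsI => //; apply: cutsC.
  elim/big_ind: _ => [|A B cA cB|i _]; [exact: cuts0| |exact: cF].
  by rewrite -[A `|` B]setCK setCU; apply/cutsC/cutsI; exact: cutsC.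
have mF n : measurable (F n) by have [] := cF n.
have mD n : measurable (seqDU F n) by have [] := cD n.
split; first exact: bigcup_measurable.
move=> E mE aE p tp; rewrite seqDU_bigcup_eq !setI_bigcupr.
rewrite integral_bigcup//.
- by apply: eseries0 => n _ _; have [_ /(_ E mE aE p tp)] := cD n.
- exact/trivIset_setIl/trivIset_setIl/trivIset_seqDU.
- by move=> n; do 2 apply: measurableI => //.
- rewrite -!setI_bigcupr; apply: integrable_fp => //; apply: measurableI => //.
  exact: bigcup_measurable.
Qed.

Let unit_freq (j : 'I_d) : d.-tuple int := [tuple (i == j)%:Z | i < d].

Let dotp_unit j (x : Rn) : dotp (unit_freq j) x = tnth x j.
Proof.
rewrite /dotp (bigD1 j)//= tnth_mktuple eqxx mul1r big1 ?addr0// => i.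
by rewrite tnth_mktuple => /negbTE ->; rewrite mul0r.
Qed.

(* The half space [a < x_j] is, inside the cube, the set where this
   trigonometric polynomial is less than 1/2. *)
Let separator j (a : R) (x : Rn) : R :=
  2^-1 - 2^-1 * (sin (pi * (tnth x j - a)) * cos (pi * tnth x j)).

(** By itself [sin (pi * (x_j - a))] has a half-integer frequency. Its product with [cos (pi * x_j)]
    is half of [sin (2 * pi * x_j - pi * a) - sin (pi * a)], of frequency 1. *)
Let real_trig_separator j a : real_trig (separator j a).
Proof.
have := real_trigD (real_trig_cst (2^-1 + 4^-1 * sin (pi * a)))
  (real_trigZ (- 4^-1) (real_trig_cos (unit_freq j) (- (a / 2) - 4^-1))).
congr real_trig; apply/funext => x; rewrite dotp_unit /separator.
have -> : 2 * pi * (tnth x j + (- (a / 2) - 4^-1)) =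
  pi * (tnth x j - a) + pi * tnth x j - pi / 2 :> R by field.
rewrite cosBpihalf sinD.
have -> : pi * a = pi * tnth x j - pi * (tnth x j - a) :> R by ring.
by rewrite sinB; field.
Qed.

Let separator_itv j a x : 0 <= separator j a x <= 1.
Proof.
have : `|sin (pi * (tnth x j - a)) * cos (pi * tnth x j)| <= 1.
  by rewrite normrM mulr_ile1// ?sin_max ?cos_max.
rewrite ler_norml /separator; set u := sin _ * _ => /andP[? ?].
by apply/andP; split; lra.
Qed.

(** In the cube the cosine is positive, and the sine has the sign of [x_j - a] because this
    difference is less than 1 in absolute value. *)
Let separator_lt j a x : - 2^-1 < a -> a < 2^-1 -> cube x ->
  (separator j a x < 2^-1) = (a < tnth x j).
Proof.
move=> a1 a2 /(_ j); rewrite /Ihalf/= in_itv/= => /andP[x1 x2].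
have p0 : 0 < pi :> R := pi_gt0 R.
have c0 : 0 < cos (pi * tnth x j).
  apply: cos_gt0_pihalf; apply/andP; split; nra.
rewrite /separator ltrBlDr ltrDl pmulr_rgt0 ?invr_gt0// pmulr_lgt0//.
have [ax|xa] := ltP a (tnth x j).
  by apply: sin_gt0_pi; apply/andP; split; [rewrite mulr_gt0// subr_gt0|nra].
apply/negbTE; rewrite -leNgt -oppr_ge0 -sinN; apply: sin_ge0_pi.
by apply/andP; split; nra.
Qed.

(** For [a] in the open interval, [p] times a step power of the separator is again a trigonometric
    polynomial, so its integral against [f] over [E] is 0; dominated convergence turns the step
    power into the indicator of the half space. For other [a] the half space contains the cube or
    misses it. *)
Lemma cuts_half_space j (a : R) : cuts [set x : Rn | a < tnth x j].
Proof.
set A := [set x | _]; have mA : measurable A.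
  rewrite [A](_ : _ = setT `&` (fun x : Rn => tnth x j) @^-1` `]a, +oo[%classic); last first.
    by rewrite setTI; apply/seteqP; split => x /=; rewrite in_itv/= andbT.
  exact: (measurable_tnth j measurableT (measurable_itv _)).
split => // E mE aE p tp.
have [a1|a1] := leP a (- 2^-1).
  rewrite (_ : cube `&` (E `&` A) = cube `&` E); first exact: aE.
  apply/seteqP; split => [x [cx []//]|x [cx Ex]]; split => //; split => //.
  by have := cx j; rewrite /Ihalf/= in_itv/= => /andP[+ _]; exact: le_lt_trans.
have [a2|a2] := leP 2^-1 a.
  rewrite (_ : cube `&` _ = set0) ?integral_set0//.
  apply/seteqP; split => // x [cx [_ /=]]; have := cx j; rewrite /Ihalf/= in_itv/=.
  by move=> /andP[_ xj] /(le_lt_trans a2)/(lt_trans xj); rewrite ltxx.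
pose g n x := (f x * (p x * step_pow n (separator j a x)))%:E.
have tpn n := real_trigM tp (real_trig_step_pow n (real_trig_separator j a)).
have [M pM] := bounded_real_trig tp.
have M0 : 0 <= M by apply: le_trans (normr_ge0 _) (pM [tuple 0 | _ < d]).
have mcE := measurableI _ _ mc mE.
have fcE : mu.-integrable (cube `&` E) (EFin \o f).
  by apply: integrableS fi => //; exact: subIsetl.
pose g_lim x := (f x * (p x * (separator j a x < 2^-1)%R%:R))%:E.
have mg n : measurable_fun (cube `&` E) (g n).
  exact: (measurable_int mu (integrable_fp mE (tpn n))).
have g_cvg x : g ^~ x @ \oo --> g_lim x.
  apply: cvg_EFin; first exact: nearW.
  apply: cvgM; first exact: cvg_cst.
  apply: cvgM; first exact: cvg_cst.
  exact: cvg_step_pow (separator_itv j a x).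
have [] := @dominated_convergence _ _ _ mu _ mcE g g_lim (fun x => (`|f x| * M)%:E).
- exact: mg.
- by apply: (emeasurable_fun_cvg g) => // x _; exact: g_cvg.
- by apply: aeW => x _; exact: g_cvg.
- exact: (integrableZr mcE M (integrable_norm fcE)).
- apply: aeW => x n _; rewrite /g lee_fin normrM ler_wpM2l// normrM.
  rewrite -[leRHS]mulr1 ler_pM//.
  by have /andP[s0 s1] := step_pow_itv n (separator_itv j a x); rewrite ger0_norm.
move=> _ _.
rewrite (_ : [sequence _]_n = fun=> 0%E); last by apply/funext => n; exact: aE.
move=> /(cvg_lim (@ereal_hausdorff R)); rewrite lim_cst// => int0.
rewrite setIA integral_mkcondr int0; apply: eq_integral => x; rewrite inE => -[cx Ex].
rewrite patchE /g_lim separator_lt//.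
have [ax|ax] := boolP (a < tnth x j); first by rewrite mem_set// mulr1.
by rewrite memNset ?mulr0//; exact/negP.
Qed.

(** Minimality is used twice: the product sigma-algebra is generated by preimages under coordinates,
    the Borel one by open rays. *)
Lemma cuts_measurable A : measurable A -> cuts A.
Proof.
move: A; apply: smallest_sub; first split.
- exact: cuts0.
- by move=> A cA; rewrite setTD; exact: cutsC.
- by move=> F; exact: cuts_bigcup.
elim/big_ind: _ => [|S1 S2 c1 c2|j _] //; first by rewrite subUset.
move=> _ [B mB <-]; rewrite setTI.
move: B mB; rewrite RGenOInfty.measurableE; apply: smallest_sub; first split.
- by rewrite /= preimage_set0; exact: cuts0.
- by move=> B cB; rewrite setTD/= -preimage_setC; exact: cutsC.
- by move=> F cF; rewrite /= preimage_bigcup; exact: cuts_bigcup.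
move=> _ [a ->] /=.
rewrite [X in cuts X](_ : _ = [set x : Rn | a < tnth x j]); first exact: cuts_half_space.
by apply/seteqP; split => x /=; rewrite in_itv/= andbT.
Qed.

Lemma fourier_uniqueness : ae_eq mu (@cube R d) (EFin \o f) (cst 0%E).
Proof.
apply: integral_ae_eq => //.
move=> E Ec mE; have [_ /(_ setT measurableT annihilatesT)] := cuts_measurable mE.
move=> /(_ _ (real_trig_cst 1)); rewrite setTI setIidr// integral0 => <-.
by apply: eq_integral => x _ /=; rewrite mulr1.
Qed.

End fourier_uniqueness.

(** * Univariate change of variables *)

Section density_measure.
Context {dT : measure_display} {T : measurableType dT} {R : realType}.
Variables (mu : {measure set T -> \bar R}) (w : T -> R).
Hypotheses (mw : measurable_fun setT w) (w0 : forall x, 0 <= w x).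
Local Open Scope ereal_scope.
Import HBNNSimple.

(* The two unused proof arguments let the measure structure be inferred. *)
Definition density_measure of measurable_fun setT w & (forall x, (0 <= w x)%R) :=
  fun A : set T => \int[mu]_(x in A) (w x)%:E.

Local Notation nu := (density_measure mw w0).

Let density_measure0 : nu set0 = 0.
Proof. exact: integral_set0. Qed.

Let density_measure_ge0 A : 0 <= nu A.
Proof. by apply: integral_ge0 => x _; rewrite lee_fin. Qed.

Let density_measure_sigma_additive : semi_sigma_additive nu.
Proof.
move=> F mF tF mUF; rewrite /density_measure ge0_integral_bigcup//.
- by apply: is_cvg_ereal_nneg_natsum_cond => n _ _; exact: density_measure_ge0.
- exact/measurable_EFinP/measurable_funTS.
- by move=> x _; rewrite lee_fin.
Qed.

HB.instance Definition _ := isMeasure.Build _ _ _ nu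
  density_measure0 density_measure_ge0 density_measure_sigma_additive.

(** Simple functions first, then monotone convergence on both sides. *)
Lemma ge0_integral_density (f : T -> \bar R) :
  measurable_fun setT f -> (forall x, 0 <= f x) ->
  \int[nu]_x f x = \int[mu]_x (f x * (w x)%:E).
Proof.
move=> mf f0; pose h := nnsfun_approx measurableT mf.
have hf x : EFin \o h ^~ x @ \oo --> f x by apply: cvg_nnsfun_approx.
have hnd x m n : (m <= n)%N -> (h m x <= h n x)%R.
  by move=> mn; exact/lefP/nd_nnsfun_approx.
have mh n : measurable_fun setT (EFin \o h n).
  apply/measurable_EFinP. exact: measurable_funP.
have mwE : measurable_fun setT (EFin \o w) by exact/measurable_EFinP.
have L : \int[nu]_x f x =
    limn (fun n => \int[nu]_x (EFin \o h n) x).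
  rewrite -monotone_convergence//.
  - by apply: eq_integral => x _; apply/esym/cvg_lim => //; exact: hf.
  - by move=> n x _; rewrite lee_fin.
  - by move=> x _ m n mn; rewrite lee_fin; exact: hnd.
have H : \int[mu]_x (f x * (w x)%:E) = limn (fun n => \int[mu]_x ((EFin \o h n) x * (w x)%:E)).
  rewrite -monotone_convergence//.
  - by apply: eq_integral => x _; apply/esym/cvg_lim => //; apply: cvgeZr => //; exact: hf.
  - by move=> n; exact: emeasurable_funM.
  - by move=> n x _; rewrite mule_ge0 ?lee_fin.
  - by move=> x _ m n mn; rewrite lee_wpmul2r ?lee_fin//; exact: hnd.
rewrite {}L {}H; congr (limn _); apply/funext => n /=.
have hE x : (h n x)%:E = \sum_(r \in range (h n)) (r * \1_(h n @^-1` [set r]) x)%:E.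
  by rewrite fimfunE -fsumEFin.
under [LHS]eq_integral do rewrite hE.
under [RHS]eq_integral do rewrite hE.
rewrite ge0_integral_fsum//; last 2 first.
- by move=> r; exact/measurable_EFinP/measurable_funM.
- by move=> r x _; exact: nnfun_muleindic_ge0.
under [RHS]eq_integral => x _.
  rewrite ge0_mule_fsuml => [|r]; last exact: nnfun_muleindic_ge0.
  over.
rewrite ge0_integral_fsum//; last 2 first.
- move=> r; apply: emeasurable_funM => //.
  by apply/measurable_EFinP/measurable_funM.
- by move=> r x _; rewrite mule_ge0 ?lee_fin//; exact: nnfun_muleindic_ge0.
apply: eq_fsbigr => r /set_mem[x _ <-].
rewrite integralZl_indic_nnsfun//= integral_indic// setIT.
under [RHS]eq_integral do rewrite EFinM -muleA.
rewrite ge0_integralZl//; last 3 first.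
- by apply: emeasurable_funM => //; exact/measurable_EFinP.
- by move=> y _; rewrite mule_ge0 ?lee_fin.
- by rewrite lee_fin.
congr (_ * _); rewrite /density_measure [LHS]integral_mkcond.
by apply: eq_integral => y _; rewrite epatch_indic muleC.
Qed.

End density_measure.

Section univariate_change_of_variables.
Context {R : realType} (psi : R -> R).
Hypothesis hpsi : univariate_transformation psi.
Local Notation g := (transf_inv psi).
Local Notation lambda := (@lebesgue_measure R).

Lemma IhalfE (x : R) : Ihalf x = (- 2^-1 < x < 2^-1) :> Prop.
Proof. by rewrite /Ihalf/= in_itv. Qed.

Lemma near_Ihalf (x : R) : Ihalf x -> \forall y \near x, Ihalf y.
Proof. by move=> xI; apply: open_nbhs_nbhs; split => //; exact: interval_open. Qed.

Lemma Ihalf_convex (x y z : R) : Ihalf x -> Ihalf z -> x <= y <= z -> Ihalf y.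
Proof.
rewrite !IhalfE => /andP[x1 _] /andP[_ z2] /andP[xy yz].
by rewrite (lt_le_trans x1)//= (le_lt_trans yz).
Qed.

Let dpsi x : Ihalf x -> derivable psi x 1.
Proof. by move=> xI; exact: (@transf_derivable _ _ hpsi x xI). Qed.

Lemma transf_inj : {in Ihalf &, injective psi}.
Proof.
move=> x y; rewrite !inE => xI yI; have [xy|yx|//] := ltgtP x y => e.
- by have := transf_incr hpsi xI yI xy; rewrite e ltxx.
- by have := transf_incr hpsi yI xI yx; rewrite e ltxx.
Qed.

Lemma transf_invK x : Ihalf x -> g (psi x) = x.
Proof. by move=> xI; apply: pinvKV; [exact: transf_inj|rewrite inE]. Qed.

Lemma transf_continuous x : Ihalf x -> {for x, continuous psi}.
Proof.
move=> xI; apply: differentiable_continuous; apply/derivable1_diffP.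
exact: dpsi xI.
Qed.

Lemma transf_within_continuous a b : Ihalf a -> Ihalf b ->
  {within `[a, b], continuous psi}.
Proof.
move=> aI bI; apply: continuous_in_subspaceT => x; rewrite inE/= in_itv/= => axb.
by apply: transf_continuous; exact: Ihalf_convex axb.
Qed.

Let ltIhalf : - 2^-1 < 2^-1 :> R.
Proof. by rewrite gtrN// invr_gt0. Qed.

Lemma transf_surj y : exists2 x, Ihalf x & psi x = y.
Proof.
have [a aI ay] : exists2 a, Ihalf a & psi a <= y.
  near (- 2^-1 : R)^'+ => a; exists a.
    rewrite IhalfE; apply/andP; split; near: a; first exact: nbhs_right_gt.
    exact: nbhs_right_lt.
  by near: a; apply: cvgrNy_le; exact: (@transf_left _ _ hpsi).
have [b bI yb] : exists2 b, Ihalf b & y <= psi b.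
  near (2^-1 : R)^'- => b; exists b.
    rewrite IhalfE; apply/andP; split; near: b; last exact: nbhs_left_lt.
    exact: nbhs_left_gt.
  by near: b; apply: cvgry_ge; exact: (@transf_right _ _ hpsi).
have ab : a <= b.
  rewrite leNgt; apply/negP => ba; have := transf_incr hpsi bI aI ba.
  by rewrite ltNge (le_trans ay yb).
have pab : psi a <= psi b := le_trans ay yb.
have [|x] := @IVT R psi a b y ab (transf_within_continuous aI bI).
  by rewrite (min_idPl pab) (max_idPr pab) ay.
rewrite in_itv/= => axb <-; exists x => //; exact: Ihalf_convex axb.
Unshelve. all: by end_near.
Qed.

Lemma transf_inv_Ihalf y : Ihalf (g y).
Proof. by have [x xI <-] := transf_surj y; rewrite transf_invK. Qed.

Lemma transf_invV y : psi (g y) = y.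
Proof. by have [x xI <-] := transf_surj y; rewrite transf_invK. Qed.

Lemma transf_mono x y : Ihalf x -> Ihalf y -> (psi x < psi y) = (x < y).
Proof.
move=> xI yI; have [xy|yx|->] := ltgtP x y; last by rewrite ltxx.
- by rewrite (transf_incr hpsi xI yI xy).
- by apply/negbTE; rewrite -leNgt ltW// (transf_incr hpsi yI xI yx).
Qed.

Lemma near_transf_invK x : Ihalf x -> {near x, cancel psi g}.
Proof. by move=> /near_Ihalf; apply: filterS => y; exact: transf_invK. Qed.

Lemma near_transf_continuous x : Ihalf x -> {near x, continuous psi}.
Proof. by move=> /near_Ihalf; apply: filterS => y; exact: transf_continuous. Qed.

Lemma transf_inv_continuous : continuous g.
Proof.
move=> y; have [x xI <-] := transf_surj y.
exact: (nbhs_singleton (near_can_continuous (near_transf_invK xI) (near_transf_continuous xI))).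
Qed.

Lemma transf_derive_ge0 x : Ihalf x -> 0 <= derive1 psi x.
Proof.
move=> xI; apply: (@incr_derive1_ge0_itv _ _ false true (- 2^-1) (2^-1)); last by rewrite in_itv/= -IhalfE.
- by move=> y; rewrite inE; exact: dpsi.
- by move=> y z; rewrite !in_itv/= => yI zI; apply: (@transf_incr _ _ hpsi); rewrite IhalfE.
Qed.

Lemma density_transf x : Ihalf x -> derive1 psi x != 0 ->
  density psi (psi x) = (derive1 psi x)^-1.
Proof.
move=> xI dx; rewrite /density derive1E.
have D : is_derive x 1 psi (derive1 psi x).
  by rewrite derive1E; apply: derivableP; exact: dpsi xI.
have := is_derive_inverse (near_transf_invK xI) (near_transf_continuous xI) D dx.
by move=> H; rewrite derive_val.
Qed.

Hypothesis density_cont : continuous (density psi).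

(** The continuous function [phi], the product of [density psi] at [psi y] and [psi'], is 1 wherever
    [psi'] is nonzero, and would be 0 at a zero [x] of [psi']. As [psi] increases strictly, the mean
    value theorem yields points with nonzero [psi'] arbitrarily close to [x], a contradiction. *)
Lemma transf_derive_gt0 x : Ihalf x -> 0 < derive1 psi x.
Proof.
move=> xI; rewrite lt_neqAle transf_derive_ge0// andbT eq_sym; apply/eqP => d0.
pose phi y := density psi (psi y) * derive1 psi y.
have phic : {for x, continuous phi}.
  apply: continuousM; last exact: (@transf_C1 _ _ hpsi x xI).
  by apply: continuous_comp; [exact: transf_continuous|exact: density_cont].
have : \forall y \near x, Ihalf y /\ `|phi x - phi y| < 1.
  near=> y; split; first by near: y; exact: near_Ihalf.
  by near: y; move/cvgrPdist_lt : phic; apply.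
move=> /nbhs_ballP[e /= e0 eP].
have inball y : x <= y <= x + e / 2 -> ball x e y.
  move=> /andP[xy ye]; rewrite /ball/= distrC ger0_norm ?subr_ge0//.
  by rewrite ltrBlDl (le_lt_trans ye)// ltrD2l gtr_pMr// invf_lt1// ltr1n.
have xb : x < x + e / 2 by rewrite ltrDl divr_gt0.
have bI : Ihalf (x + e / 2) by have [] := eP _ (inball _ (introT andP (conj (ltW xb) (lexx _)))).
have [c] : exists2 c, c \in `]x, x + e / 2[ &
    psi (x + e / 2) - psi x = derive1 psi c * (x + e / 2 - x).
  apply: MVT => // [c|]; last exact: transf_within_continuous.
  rewrite in_itv/= => /andP[/ltW xc /ltW cb].
  rewrite derive1E; apply: derivableP; apply: dpsi.
  by apply: (Ihalf_convex xI bI); rewrite xc cb.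
rewrite in_itv/= => /andP[/ltW xc /ltW cb] dpc.
have dc : derive1 psi c != 0.
  apply/eqP => dc0; move: dpc; rewrite dc0 mul0r => /eqP; rewrite subr_eq0 => /eqP e1.
  by have := transf_incr hpsi xI bI xb; rewrite e1 ltxx.
have [|cI] := eP c; first by apply: inball; rewrite xc cb.
by rewrite /phi d0 mulr0 sub0r normrN (density_transf cI dc) mulVf// normr1 ltxx.
Unshelve. all: by end_near.
Qed.

Lemma density_transfE x : Ihalf x -> density psi (psi x) = (derive1 psi x)^-1.
Proof. by move=> xI; rewrite density_transf// gt_eqF// transf_derive_gt0. Qed.

Lemma density_gt0 y : 0 < density psi y.
Proof.
have [x xI <-] := transf_surj y.
by rewrite density_transfE// invr_gt0 transf_derive_gt0.
Qed.

Let pt : R -> R := psi \_ Ihalf.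
Let w : R -> R := derive1 psi \_ Ihalf.

Let mIhalf : measurable (@Ihalf R). Proof. exact: measurable_itv. Qed.

Let mpt : measurable_fun setT pt.
Proof.
apply/(measurable_restrictT _ mIhalf); apply: open_continuous_measurable_fun.
  exact: interval_open.
by move=> x; rewrite inE; exact: transf_continuous.
Qed.

Let mdpsi : measurable_fun Ihalf (derive1 psi).
Proof.
apply: open_continuous_measurable_fun; first exact: interval_open.
by move=> x; rewrite inE; exact: (@transf_C1 _ _ hpsi).
Qed.

Let mw : measurable_fun setT w.
Proof. exact/(measurable_restrictT _ mIhalf). Qed.

Let w0 x : 0 <= w x.
Proof. by rewrite /w patchE; case: ifPn => // /set_mem; exact: transf_derive_ge0. Qed.

Lemma integral_transf_derive a b : a < b ->
  (\int[lambda]_(x in `[g a, g b]) (derive1 psi x)%:E = (b - a)%:E)%E.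
Proof.
move=> ab; have aI := transf_inv_Ihalf a; have bI := transf_inv_Ihalf b.
have gab : g a < g b by rewrite -(transf_mono aI bI) !transf_invV.
have dcI x : x \in `[g a, g b] -> Ihalf x.
  by rewrite in_itv/=; exact: Ihalf_convex.
rewrite (@continuous_FTC2 _ _ psi)//.
- by rewrite !transf_invV EFinB.
- apply: continuous_in_subspaceT => x; rewrite inE => /dcI.
  exact: (@transf_C1 _ _ hpsi).
- split.
  + move=> x; rewrite in_itv/= => /andP[/ltW xa /ltW xb].
    by apply: dpsi; apply: dcI; rewrite in_itv/= xa xb.
  + by apply: cvg_at_right_filter; exact: transf_continuous.
  + by apply: cvg_at_left_filter; exact: transf_continuous.
Qed.

(** By uniqueness of Lebesgue measure it suffices to test half-open intervals, where the fundamental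
    theorem of calculus gives the length. *)
Lemma lebesgue_transf (A : set R) : measurable A ->
  lambda A = pushforward (density_measure lambda mw w0) (pt : _ -> measurableTypeR R) A.
Proof.
move=> mA; apply: lebesgue_measure_unique => //= _ [[a b]] _ <-.
rewrite lebesgue_measure_itv/= lte_fin; case: ifPn => [ab|]; last first.
  rewrite -leNgt => ba; rewrite set_itv_ge ?preimage_set0 ?measure0//.
  by rewrite bnd_simp -leNgt.
rewrite -EFinB -integral_transf_derive// /pushforward /density_measure.
have aI := transf_inv_Ihalf a; have bI := transf_inv_Ihalf b.
have sub x : `]g a, g b]%classic x -> Ihalf x.
  rewrite /= in_itv/= => /andP[/ltW ax xb].
  by apply: Ihalf_convex aI bI _; rewrite ax xb.
rewrite -integral_itv_obnd_cbnd; last first.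
  by apply/measurable_EFinP; exact: measurable_funS mdpsi.
rewrite [RHS]integral_mkcond [LHS]integral_mkcond; apply: eq_integral => x _.
rewrite !patchE /w patchE; have [xI|xI] := boolP (x \in Ihalf); last first.
  rewrite (memNset (A := `]g a, g b]%classic)) ?if_same// => /sub.
  by move/mem_set; exact/negP.
have E : (a < psi x <= b) = (g a < x <= g b).
  rewrite -{1}(transf_invV a) -{1}(transf_invV b) transf_mono//; last exact/set_mem.
  by rewrite !leNgt transf_mono//; exact/set_mem.
suff -> : (x \in pt @^-1` `]a, b]) = (x \in `]g a, g b]%classic) by [].
by apply/idP/idP; rewrite !inE/= !in_itv/= /pt patchE xI E.
Qed.

Lemma ge0_integral_transf (F : R -> \bar R) :
  measurable_fun setT F -> (forall x, 0 <= F x)%E ->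
  (\int[lambda]_x (F x * (\1_(@Ihalf R) x)%:E) =
   \int[lambda]_y (F (g y) * (density psi y)%:E))%E.
Proof.
move=> mF F0.
have mg : measurable_fun setT g by exact: continuous_measurable_fun transf_inv_continuous.
have mFg : measurable_fun setT (fun y => (F (g y) * (density psi y)%:E)%E).
  apply: emeasurable_funM; first exact: (measurableT_comp mF).
  by apply/measurable_EFinP; exact: continuous_measurable_fun.
have Fg0 y : (0 <= F (g y) * (density psi y)%:E)%E.
  by rewrite mule_ge0// lee_fin ltW// density_gt0.
rewrite [RHS](eq_measure_integral (pushforward (density_measure lambda mw w0)
  (pt : _ -> measurableTypeR R))); last by move=> A mA _; exact: lebesgue_transf.
rewrite [RHS]ge0_integral_pushforward//= preimage_setT.
rewrite [RHS]ge0_integral_density//; last exact: (measurableT_comp mFg).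
apply: eq_integral => x _; rewrite /= indicE /pt /w !patchE.
case: ifPn => [/set_mem xI|]; last by rewrite !mule0.
rewrite transf_invK// density_transfE// -muleA -EFinM mulVf//.
by rewrite gt_eqF// transf_derive_gt0.
Qed.

End univariate_change_of_variables.

(** * Unordered sums over frequencies *)

Section frequency_box.
Context {d : nat}.
Implicit Types (k : d.-tuple int).

(** The frequencies with all coordinates between [- n] and [n]: finite sets exhausting all
    frequencies, which turn unordered sums into limits of sequences. *)
Definition freq_box n : seq (d.-tuple int) :=
  [seq [tuple (tnth t j : nat)%:Z - n%:Z | j < d] |
    t : d.-tuple 'I_(n.*2.+1) <- enum {: d.-tuple 'I_(n.*2.+1)}].

Lemma freq_box_uniq n : uniq (freq_box n).
Proof.
rewrite map_inj_uniq ?enum_uniq// => s t st; apply: eq_from_tnth => j.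
have := congr1 (fun u => tnth u j) st; rewrite !tnth_mktuple => /addIr [].
exact: val_inj.
Qed.

Lemma mem_freq_box n k : (k \in freq_box n) = [forall j, (`|tnth k j| <= n)%N].
Proof.
apply/mapP/forallP => [[t _ ->] j|kn].
  rewrite tnth_mktuple; have := ltn_ord (tnth t j); rewrite ltnS.
  by move: (nat_of_ord _) => u; rewrite -addnn; lia.
exists [tuple inord (absz (tnth k j + n%:Z)) | j < d]; first by rewrite mem_enum.
apply: eq_from_tnth => j; rewrite !tnth_mktuple.
by have := kn j; move: (tnth k j : int) => q qn; rewrite inordK -?addnn; lia.
Qed.

Lemma freq_box_cross N n k : (N <= n)%N -> (omega_hc k <= N)%N -> k \in freq_box n.
Proof.
move=> Nn kN; rewrite mem_freq_box; apply/forallP => j.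
apply: leq_trans Nn; apply: leq_trans kN; rewrite /omega_hc (bigD1 j)//=.
apply: (@leq_trans (maxn 1 `|tnth k j|)); first by rewrite leq_maxr.
by rewrite leq_pmulr// prodn_gt0// => i; rewrite leq_max.
Qed.

Lemma freq_box_cofinal (s : seq (d.-tuple int)) :
  exists n0, forall n, (n0 <= n)%N -> {subset s <= freq_box n}.
Proof.
exists (\max_(k <- s) omega_hc k) => n sn k ks.
apply: freq_box_cross sn _; rewrite (big_rem k ks)/=; exact: leq_maxl.
Qed.

End frequency_box.

Section unordered_sums.
Context {R : realType} {d : nat}.
Local Notation freq := (d.-tuple int).
Import summability.
#[local] Existing Instance totally_filter.
Implicit Types (a : freq -> R).

Lemma partial_sumE a (A : {fset freq}) : partial_sum a A = \sum_(k <- A) a k.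
Proof. by rewrite /partial_sum big_seq_fsetE. Qed.

Lemma big_fset_subset (b : freq -> R) (A : {fset freq}) (s : seq freq) :
  (forall k, 0 <= b k) -> {subset A <= s} -> \sum_(k <- A) b k <= \sum_(k <- s) b k.
Proof.
move=> b0 As; rewrite [leRHS](bigID (fun k => k \in A))/=.
apply: (@le_trans _ _ (\sum_(k <- s | k \in A) b k)); last by rewrite lerDl sumr_ge0.
rewrite -[leRHS]big_filter.
rewrite (perm_big (undup [seq k <- s | k \in A]))/=; last first.
  apply: uniq_perm; rewrite ?fset_uniq ?undup_uniq// => k.
  by rewrite mem_undup mem_filter; case: (boolP (k \in A)) => //= /As ->.
elim: [seq _ <- _ | _] => //= k t IH; rewrite big_cons; case: ifP => _.
  by rewrite (le_trans IH)// lerDr.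
by rewrite big_cons lerD2l.
Qed.

Lemma cvg_partial_sum_ge0 a (S : R) : (forall k, 0 <= a k) ->
  (forall A : {fset freq}, \sum_(k <- A) a k <= S) ->
  exists l : R, partial_sum a @ totally --> l.
Proof.
move=> a0 aS; pose E := range (partial_sum a).
have supE : has_sup E.
  split; first by exists (partial_sum a fset0); exists fset0.
  by exists S => _ [A _ <-]; rewrite partial_sumE.
exists (sup E); apply/cvgrPdist_le => e e0.
have [_ [A _ <-] lA] := sup_adherent e0 supE.
exists A => // B /= AB.
have lB : partial_sum a B <= sup E by apply: ub_le_sup; [case: supE|exists B].
have lAB : partial_sum a A <= partial_sum a B.
  by rewrite !partial_sumE; apply: big_fset_subset => //; apply/fsubsetP.
by rewrite ger0_norm ?subr_ge0// lerBlDr -lerBlDl (le_trans (ltW lA)).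
Qed.

(** Writing [a] as [(|a| + a) - |a|] reduces to nonnegative families, whose partial sums increase to
    their supremum. *)
Lemma cvg_partial_sum a (S : R) :
  (forall A : {fset freq}, \sum_(k <- A) `|a k| <= S) ->
  partial_sum a @ totally --> sum (R := R^o) a.
Proof.
move=> aS.
have [|A|lp Hp] := @cvg_partial_sum_ge0 (fun k => `|a k| + a k) (S + S).
- by move=> k; have := ler_norm (- a k); rewrite normrN; lra.
- by rewrite big_split lerD//; apply: le_trans (aS A); apply: ler_sum => k _; exact: ler_norm.
have [||ln Hn] := @cvg_partial_sum_ge0 (fun k => `|a k|) S => //.
have H : partial_sum a @ totally --> lp - ln.
  rewrite (_ : partial_sum a = fun A => partial_sum (fun k => `|a k| + a k) A - partial_sum (fun k => `|a k|) A).
    exact: cvgB.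
  by apply/funext => A; rewrite !partial_sumE -sumrB; apply: eq_bigr => k _; rewrite addrAC subrr add0r.
rewrite /sum; have -> : lim (partial_sum a @ totally) = lp - ln by apply: cvg_lim.
exact: H.
Qed.

(** Every finite set is contained in all large boxes, so a limit along finite sets is also the limit
    along the boxes. *)
Lemma cvg_freq_box a (S : R) :
  (forall A : {fset freq}, \sum_(k <- A) `|a k| <= S) ->
  \sum_(k <- freq_box n) a k @[n --> \oo] --> (sum (R := R^o) a : R).
Proof.
move=> /cvg_partial_sum Ha.
have -> : (fun n => \sum_(k <- freq_box n) a k) =
    (fun n => partial_sum a [fset k in freq_box n]%fset).
  apply/funext => n; rewrite partial_sumE; apply: perm_big.
  apply: uniq_perm; rewrite ?fset_uniq ?freq_box_uniq// => k.
  by rewrite inE.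
apply: cvg_comp Ha => P [A _ AP].
have [n0 n0P] := freq_box_cofinal A.
exists n0 => // n /= n0n; apply: AP => /=; apply/fsubsetP => k kA.
by rewrite inE; exact: n0P kA.
Qed.

End unordered_sums.

(** * Fourier series of integrable functions *)

Section complex_limits.
Context {R : realType}.
Implicit Types (u v : nat -> R[i]) (y z w : R[i]).

Lemma ReM y z : complex.Re (y * z) =
  complex.Re y * complex.Re z - complex.Im y * complex.Im z.
Proof. by case: y z => [? ?] [? ?]. Qed.

Lemma ImM y z : complex.Im (y * z) =
  complex.Re y * complex.Im z + complex.Im y * complex.Re z.
Proof. by case: y z => [? ?] [? ?]. Qed.

Lemma ReD y z : complex.Re (y + z) = complex.Re y + complex.Re z.
Proof. by case: y z => [? ?] [? ?]. Qed.

Lemma ImD y z : complex.Im (y + z) = complex.Im y + complex.Im z.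
Proof. by case: y z => [? ?] [? ?]. Qed.

Lemma ReB y z : complex.Re (y - z) = complex.Re y - complex.Re z.
Proof. by case: y z => [? ?] [? ?]. Qed.

Lemma ImB y z : complex.Im (y - z) = complex.Im y - complex.Im z.
Proof. by case: y z => [? ?] [? ?]. Qed.

Lemma cabsE z : cabs z ^+ 2 = complex.Re z ^+ 2 + complex.Im z ^+ 2.
Proof. by case: z => a b; rewrite /cabs /= sqr_sqrtr// addr_ge0 ?sqr_ge0. Qed.

Lemma cabsM y z : cabs (y * z) = cabs y * cabs z.
Proof. exact: ComplexField.Normc.normcM. Qed.

Lemma cabs_expi2pi t : cabs (expi2pi t) = 1 :> R.
Proof. by rewrite /cabs/expi2pi/= cos2Dsin2 sqrtr1. Qed.

Lemma Re_le_cabs z : `|complex.Re z| <= cabs z.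
Proof.
rewrite -(@ler_pXn2r _ 2)// ?nnegrE ?cabs_ge0// cabsE real_normK ?num_real//.
by rewrite lerDl sqr_ge0.
Qed.

Lemma Im_le_cabs z : `|complex.Im z| <= cabs z.
Proof.
rewrite -(@ler_pXn2r _ 2)// ?nnegrE ?cabs_ge0// cabsE real_normK ?num_real//.
by rewrite lerDr sqr_ge0.
Qed.

Definition ccvg u z := (complex.Re (u n) @[n --> \oo] --> complex.Re z) /\
  (complex.Im (u n) @[n --> \oo] --> complex.Im z).

Lemma ccvg_cst z : ccvg (fun=> z) z.
Proof. by split; exact: cvg_cst. Qed.

Lemma ccvgD u v y z : ccvg u y -> ccvg v z -> ccvg (fun n => u n + v n) (y + z).
Proof.
move=> [u1 u2] [v1 v2]; split.
- under eq_fun do rewrite ReD; rewrite ReD; exact: cvgD.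
- under eq_fun do rewrite ImD; rewrite ImD; exact: cvgD.
Qed.

Lemma ccvgM u v y z : ccvg u y -> ccvg v z -> ccvg (fun n => u n * v n) (y * z).
Proof.
move=> [u1 u2] [v1 v2]; split.
- by under eq_fun do rewrite ReM; rewrite ReM; apply: cvgB; exact: cvgM.
- by under eq_fun do rewrite ImM; rewrite ImM; apply: cvgD; exact: cvgM.
Qed.

Lemma ccvgB u v y z : ccvg u y -> ccvg v z -> ccvg (fun n => u n - v n) (y - z).
Proof.
move=> uy vz; have := ccvgD uy (ccvgM (ccvg_cst (-1)) vz).
by rewrite mulN1r; under [X in ccvg X]eq_fun do rewrite mulN1r.
Qed.

Lemma ccvg_sum (I : Type) (s : seq I) (P : pred I) (u : I -> nat -> R[i]) (z : I -> R[i]) :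
  (forall i, ccvg (u i) (z i)) ->
  ccvg (fun n => \sum_(i <- s | P i) u i n) (\sum_(i <- s | P i) z i).
Proof.
move=> uz; elim: s => [|i s IH].
  rewrite big_nil; under [X in ccvg X]eq_fun do rewrite big_nil.
  exact: ccvg_cst.
rewrite big_cons; under [X in ccvg X]eq_fun do rewrite big_cons.
by case: ifP => // _; exact: ccvgD.
Qed.

Lemma ccvg_cabs u z : ccvg u z -> cabs (u n) ^+ 2 @[n --> \oo] --> cabs z ^+ 2.
Proof.
move=> [u1 u2]; under eq_fun do rewrite cabsE; rewrite cabsE.
by apply: cvgD; rewrite expr2; under eq_fun do rewrite expr2; exact: cvgM.
Qed.

End complex_limits.

Section fourier_inversion.
Context {R : realType} {d : nat}.
Local Notation Rn := (d.-tuple (measurableTypeR R)).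
Local Notation freq := (d.-tuple int).
Local Notation mu := (lebesgue_tuple d).
Local Notation e := (@expi2pi R).
Local Notation cube := (@cube R d).
Implicit Types (F : Rn -> R[i]) (k : freq) (a : R[i]).

Let mc : measurable cube. Proof. exact: measurable_cube. Qed.

Definition cintegrable F :=
  mu.-integrable cube (EFin \o (fun x => complex.Re (F x))) /\
  mu.-integrable cube (EFin \o (fun x => complex.Im (F x))).

Lemma measurable_Re_expi a k : measurable_fun setT (fun x => complex.Re (a * e (dotp k x))).
Proof.
under eq_fun do rewrite Re_mul_expi sin_cos2pi -[in X in X - _](addr0 (dotp k _)).
by apply: measurable_funB; apply: measurable_funM => //; exact: measurable_cos_dotp.
Qed.

Lemma measurable_Im_expi a k : measurable_fun setT (fun x => complex.Im (a * e (dotp k x))).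
Proof.
under eq_fun do rewrite Im_mul_expi sin_cos2pi -[in X in _ + X](addr0 (dotp k _)).
by apply: measurable_funD; apply: measurable_funM => //; exact: measurable_cos_dotp.
Qed.

Lemma integrable_mul_bounded (u h : Rn -> R) (M : R) :
  mu.-integrable cube (EFin \o u) -> measurable_fun setT h -> (forall x, `|h x| <= M) ->
  mu.-integrable cube (EFin \o (fun x => u x * h x)).
Proof.
move=> ui mh hM.
apply: (@integrableMl _ _ _ mu _ mc (EFin \o u) h) => //.
- exact: measurable_funTS.
- exists M; split; first by rewrite num_real.
  by move=> A MA x _; apply: le_trans (hM x) _; exact: ltW.
Qed.

Lemma cintegrableM_expi F a k : cintegrable F ->
  cintegrable (fun x => F x * (a * e (dotp k x))).
Proof.
move=> [F1 F2].
have bRe x : `|complex.Re (a * e (dotp k x))| <= cabs a.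
  by apply: le_trans (Re_le_cabs _) _; rewrite cabsM cabs_expi2pi mulr1.
have bIm x : `|complex.Im (a * e (dotp k x))| <= cabs a.
  by apply: le_trans (Im_le_cabs _) _; rewrite cabsM cabs_expi2pi mulr1.
have mRe := measurable_Re_expi a k; have mIm := measurable_Im_expi a k.
split.
- under [X in _.-integrable _ (_ \o X)]eq_fun do rewrite ReM.
  exact: (integrableB mc (integrable_mul_bounded F1 mRe bRe) (integrable_mul_bounded F2 mIm bIm)).
- under [X in _.-integrable _ (_ \o X)]eq_fun do rewrite ImM.
  exact: (integrableD mc (integrable_mul_bounded F1 mIm bIm) (integrable_mul_bounded F2 mRe bRe)).
Qed.

Definition freqN k : freq := [tuple - tnth k j | j < d].

Lemma dotpN k x : dotp (R := R) (freqN k) x = - dotp k x.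
Proof.
by rewrite /dotp -sumrN; apply: eq_bigr => j _; rewrite tnth_mktuple intrN mulNr.
Qed.

(** The multiplier [a] lets real integrals carry complex identities: [a = 1] reads off the real part
    and [a = - i] the imaginary part. *)
Lemma Rintegral_Re_coef F a k : cintegrable F ->
  \int[mu]_(x in cube) complex.Re (F x * (a * e (- dotp k x))) =
  complex.Re (a * torus_coef F k).
Proof.
move=> iF; have [H1 H2] := cintegrableM_expi 1 (freqN k) iF.
under [LHS]eq_Rintegral do rewrite mulrCA ReM.
rewrite ReM /torus_coef /cintegral /=.
have E x : F x * e (- dotp k x) = F x * (1 * e (dotp (freqN k) x)).
  by rewrite mul1r dotpN.
under [X in _ = _ * X - _]eq_Rintegral do rewrite E.
under [X in _ = _ - _ * X]eq_Rintegral do rewrite E.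
under [LHS]eq_Rintegral do rewrite E.
rewrite RintegralB//; last 2 first.
- exact: (integrableZl mc _ H1).
- exact: (integrableZl mc _ H2).
by rewrite !RintegralZl.
Qed.

End fourier_inversion.

Section fourier_series_limit.
Context {R : realType} {d : nat}.
Local Notation Rn := (d.-tuple (measurableTypeR R)).
Local Notation freq := (d.-tuple int).
Local Notation mu := (lebesgue_tuple d).
Local Notation e := (@expi2pi R).
Local Notation cube := (@cube R d).
Variables (f : Rn -> R[i]) (S : R).
Hypothesis fi : cintegrable f.
Local Notation c := (torus_coef f).
Local Notation g := (fourier_series f).
Hypothesis cS : forall A : {fset freq}, \sum_(k <- A) cabs (c k) <= S.

Let mc : measurable cube. Proof. exact: measurable_cube. Qed.

Lemma ccvg_fourier_series x : ccvg (fun n => trig_poly c (freq_box n) x) (g x).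
Proof.
have bound (p : R[i] -> R) : (forall z, `|p z| <= cabs z) ->
    forall A : {fset freq}, \sum_(k <- A) `|p (c k * e (dotp k x))| <= S.
  move=> pz A; apply: le_trans (cS A); apply: ler_sum => k _.
  by apply: le_trans (pz _) _; rewrite cabsM cabs_expi2pi mulr1.
split.
- under eq_fun do rewrite /trig_poly Re_sum.
  by apply: cvg_freq_box; apply: bound; exact: Re_le_cabs.
- under eq_fun do rewrite /trig_poly Im_sum.
  by apply: cvg_freq_box; apply: bound; exact: Im_le_cabs.
Qed.

Lemma trig_poly_box_le n x : cabs (trig_poly c (freq_box n) x) <= S.
Proof.
apply: le_trans (cabs_sum _ _ _) _; apply: le_trans (cS [fset k in freq_box n]%fset).
rewrite le_eqVlt; apply/orP; left; apply/eqP.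
under eq_bigr do rewrite cabsM cabs_expi2pi mulr1.
apply: perm_big; apply: uniq_perm; rewrite ?fset_uniq ?freq_box_uniq// => k.
by rewrite [in RHS]inE.
Qed.

Lemma measurable_trig_poly a (K : seq freq) k :
  measurable_fun setT (fun x => complex.Re (trig_poly c K x * (a * e (- dotp k x)))).
Proof.
rewrite (_ : (fun _ => _) =
    fun x => \sum_(l <- K) complex.Re (c l * a * e (dotp (freqB l k) x))).
  by apply: measurable_sum => l; exact: measurable_Re_expi.
apply/funext => x; rewrite /trig_poly big_distrl/= Re_sum; apply: eq_bigr => l _.
by rewrite dotpB expi2piD; congr complex.Re; ring.
Qed.

Lemma Rintegral_trig_poly a (K : seq freq) k : uniq K ->
  \int[mu]_(x in cube) complex.Re (trig_poly c K x * (a * e (- dotp k x))) =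
  if k \in K then complex.Re (a * c k) else 0.
Proof.
move=> uK.
transitivity (\int[mu]_(x in cube) \sum_(l <- K) complex.Re (c l * a * e (dotp (freqB l k) x))).
  apply: eq_Rintegral => x _; rewrite /trig_poly big_distrl/= Re_sum; apply: eq_bigr => l _.
  by rewrite dotpB expi2piD; congr complex.Re; ring.
rewrite Rintegral_sum//; last by move=> l; exact: integrable_Re_expi.
under eq_bigr do rewrite Rintegral_Re_expi freq0B.
case: ifPn => kK.
  rewrite (bigD1_seq k)//= eqxx mul1r mulrC big1 ?addr0// => l /negbTE ->.
  by rewrite mul0r.
rewrite big_seq big1// => l lK; case: eqP => [lk|]; last by rewrite mul0r.
by move: lK kK; rewrite lk => ->.
Qed.

Lemma measurable_fourier_series :
  measurable_fun setT (fun x => complex.Re (g x)) /\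
  measurable_fun setT (fun x => complex.Im (g x)).
Proof.
split.
- apply: (@measurable_fun_cvg _ _ _ _ (fun n x => complex.Re (trig_poly c (freq_box n) x))).
    move=> n; under eq_fun do rewrite /trig_poly Re_sum.
    by apply: measurable_sum => k; exact: measurable_Re_expi.
  by move=> x _; have [] := ccvg_fourier_series x.
- apply: (@measurable_fun_cvg _ _ _ _ (fun n x => complex.Im (trig_poly c (freq_box n) x))).
    move=> n; under eq_fun do rewrite /trig_poly Im_sum.
    by apply: measurable_sum => k; exact: measurable_Im_expi.
  by move=> x _; have [] := ccvg_fourier_series x.
Qed.

Lemma cintegrable_fourier_series : cintegrable g.
Proof.
have [m1 m2] := measurable_fourier_series.
split; apply: (@integrable_cube_bounded _ _ _ S); try exact: measurable_funTS.
- move=> x _; have [H _] := ccvg_fourier_series x.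
  apply: (cvgr_to_le (cvg_norm H)); apply: nearW => n.
  exact: le_trans (Re_le_cabs _) (trig_poly_box_le _ _).
- move=> x _; have [_ H] := ccvg_fourier_series x.
  apply: (cvgr_to_le (cvg_norm H)); apply: nearW => n.
  exact: le_trans (Im_le_cabs _) (trig_poly_box_le _ _).
Qed.

(** Dominated convergence along the boxes, with a constant majorant; the integrals are eventually
    constant, as soon as the box contains [k]. *)
Lemma Rintegral_fourier_series a k :
  \int[mu]_(x in cube) complex.Re (g x * (a * e (- dotp k x))) = complex.Re (a * c k).
Proof.
pose G n x := complex.Re (trig_poly c (freq_box n) x * (a * e (- dotp k x))).
have Gg x : G n x @[n --> \oo] --> complex.Re (g x * (a * e (- dotp k x))).
  by have [] := ccvgM (ccvg_fourier_series x) (ccvg_cst (a * e (- dotp k x))).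
have mG n : measurable_fun setT (G n) by exact: measurable_trig_poly.
have bG n x : `|G n x| <= S * cabs a.
  apply: le_trans (Re_le_cabs _) _; rewrite !cabsM cabs_expi2pi mulr1.
  by rewrite ler_wpM2r ?cabs_ge0 ?trig_poly_box_le.
have [] := @dominated_convergence _ _ _ mu _ mc (fun n => EFin \o G n)
  (EFin \o (fun x => complex.Re (g x * (a * e (- dotp k x))))) (EFin \o cst (S * cabs a)).
- by move=> n; apply/measurable_EFinP; exact: measurable_funTS.
- apply/measurable_EFinP; apply: measurable_funTS.
  exact: (measurable_fun_cvg mG (fun x _ => Gg x)).
- by apply: aeW => x _; apply: cvg_EFin; [exact: nearW|exact: Gg].
- apply: (@integrable_cube_bounded _ _ _ `|S * cabs a|) => //.
- by apply: aeW => x n _ /=; rewrite lee_fin.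
move=> ig _ H.
have [n0 n0P] := freq_box_cofinal [:: k].
have H0 : (\int[mu]_(x in cube) (EFin \o G n) x)%E @[n --> \oo] --> (complex.Re (a * c k))%:E.
  apply: cvg_near_cst; exists n0 => // n /= n0n.
  have iG : mu.-integrable cube (EFin \o G n).
    apply: (@integrable_cube_bounded _ _ _ (S * cabs a)) => //.
    exact: measurable_funTS.
  rewrite -[LHS]fineK ?integrable_fin_num//; congr _%:E.
  rewrite [LHS]Rintegral_trig_poly ?freq_box_uniq//.
  by rewrite (n0P n n0n)// inE.
by rewrite /Rintegral -(cvg_lim (@ereal_hausdorff R) H) (cvg_lim (@ereal_hausdorff R) H0).
Qed.

Let cintegrable_diff : cintegrable (fun x => f x - g x).
Proof.
have [f1 f2] := fi; have [g1 g2] := cintegrable_fourier_series.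
split.
- under [X in _.-integrable _ (_ \o X)]eq_fun do rewrite ReB.
  exact: (integrableB mc f1 g1).
- under [X in _.-integrable _ (_ \o X)]eq_fun do rewrite ImB.
  exact: (integrableB mc f2 g2).
Qed.

Let Rintegral_Re_diff a k :
  \int[mu]_(x in cube) complex.Re ((f x - g x) * (a * e (- dotp k x))) = 0.
Proof.
under eq_Rintegral do rewrite mulrBl ReB -dotpN.
rewrite RintegralB//; last 2 first.
- by have [] := cintegrableM_expi a (freqN k) fi.
- by have [] := cintegrableM_expi a (freqN k) cintegrable_fourier_series.
under eq_Rintegral do rewrite dotpN.
under [X in _ - X]eq_Rintegral do rewrite dotpN.
by rewrite Rintegral_Re_coef// Rintegral_fourier_series subrr.
Qed.

Let Re_prod (y z : R[i]) : complex.Re y * complex.Re z =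
  2^-1 * (complex.Re (y * z) + complex.Re (y * (z^*)%C)).
Proof. by rewrite !ReM; case: z => p q /=; field. Qed.

(** A cosine is the real part of an exponential, so by [Re_prod] the integral against it combines
    the Fourier coefficients of [f - g] at [k] and at its opposite, which vanish. *)
Lemma fourier_series_ae a :
  ae_eq mu cube (EFin \o (fun x => complex.Re ((f x - g x) * a))) (cst 0%E).
Proof.
apply: fourier_uniqueness.
  have [H _] := cintegrableM_expi a [tuple 0 | _ < d] cintegrable_diff.
  apply: eq_integrable H => // x _ /=; congr (complex.Re (_ * _))%:E.
  rewrite /dotp big1 ?expi2pi0 ?mulr1// => j _.
  by rewrite tnth_mktuple mul0r.
move=> k theta.
pose D x := f x - g x.
have E x : complex.Re (D x * a) * cos (2 * pi * (dotp k x + theta)) =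
    2^-1 * (complex.Re (D x * (a * e theta * e (- dotp (freqN k) x))) +
            complex.Re (D x * (a * e (- theta) * e (- dotp k x)))).
  have -> : cos (2 * pi * (dotp k x + theta)) = complex.Re (e (dotp k x + theta)) by [].
  rewrite Re_prod -expi2piN !dotpN opprK opprD !expi2piD.
  by congr (_ * (complex.Re _ + complex.Re _)); ring.
have I b l : mu.-integrable cube (EFin \o (fun x => complex.Re (D x * (b * e (- dotp l x))))).
  have [H _] := cintegrableM_expi b (freqN l) cintegrable_diff.
  by apply: eq_integrable H => // x _ /=; rewrite dotpN.
under eq_integral do rewrite E.
rewrite -[LHS]fineK; last first.
  apply: integrable_fin_num => //.
  exact: (integrableZl mc _ (integrableD mc (I _ _) (I _ _))).
rewrite [fine _](RintegralZl _ mc) ?RintegralD ?Rintegral_Re_diff ?addr0 ?mulr0//.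
exact: (integrableD mc (I _ _) (I _ _)).
Qed.

End fourier_series_limit.

(** * Lattice error of an absolutely convergent Fourier series *)

Section lattice_error.
Context {R : realType} {d : nat}.
Local Notation Rn := (d.+1.-tuple (measurableTypeR R)).
Local Notation freq := (d.+1.-tuple int).
Local Notation mu := (lebesgue_tuple d.+1).
Local Notation e := (@expi2pi R).
Local Notation cube := (@cube R d.+1).
Variables (m N M : nat) (z : freq) (f : Rn -> R[i]) (B : R).
Hypotheses (m0 : (0 < m)%N) (N1 : (1 < N)%N) (M0 : (0 < M)%N).
Hypothesis zM : reconstructing z M (hyperbolic_cross N).
Hypothesis fi : cintegrable f.
Local Notation c := (torus_coef f).
Local Notation g := (fourier_series f).
Hypothesis cB : forall A : {fset freq},
  \sum_(k <- A) (omega_hc k)%:R ^+ (2 * m) * cabs (c k) ^+ 2 <= B.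

(** Cauchy-Schwarz with [sum_omega_hc_sqr] at [n = 0], where the separation is trivial and the
    constant is [16 ^+ d.+1]; [m >= 1] bounds the weights by those of exponent 2. *)
Lemma sum_cabs_torus_coef (A : {fset freq}) :
  \sum_(k <- A) cabs (c k) <= Num.sqrt (16 ^+ d.+1 * B).
Proof.
have B0 : 0 <= B.
  by apply: le_trans (cB A); apply: sumr_ge0 => k _; rewrite mulr_ge0 ?sqr_ge0 ?exprn_ge0.
have w0 (k : freq) : 0 < (omega_hc k)%:R :> R by rewrite ltr0n omega_hc_gt0.
have X0 : 0 <= \sum_(k <- A) cabs (c k) by apply: sumr_ge0 => k _; exact: cabs_ge0.
rewrite -(ger0_norm X0) -sqrtr_sqr ler_wsqrtr//.
apply: (@le_trans _ _ ((\sum_(k <- A) (omega_hc k ^ m)%:R^-1 * ((omega_hc k ^ m)%:R * cabs (c k))) ^+ 2)).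
  rewrite le_eqVlt; apply/orP; left; apply/eqP; congr (_ ^+ 2).
  by apply: eq_bigr => k _; rewrite mulKf// natrX expf_neq0// gt_eqF.
apply: le_trans (cauchy_schwarz_sum _ _ _ _) _; apply: ler_pM.
- by apply: sumr_ge0 => k _; exact: sqr_ge0.
- by apply: sumr_ge0 => k _; exact: sqr_ge0.
- apply: (@le_trans _ _ (\sum_(k <- A) (omega_hc k)%:R ^- 2)).
    apply: ler_sum => k _; rewrite -exprVn lerXn2r ?nnegrE ?invr_ge0 ?ler0n//.
    rewrite lef_pV2 ?posrE ?ltr0n ?expn_gt0 ?omega_hc_gt0//.
    by rewrite ler_nat -[X in (X <= _)%N]expn1 leq_pexp2l ?omega_hc_gt0.
  have := @sum_omega_hc_sqr R d 0 A; rewrite expr0 expr1n mulr1 expr1n mulr1.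
  apply => //; first exact: fset_uniq.
    by move=> l _; rewrite expn0 omega_hc_gt0.
  by move=> l l' _ _ _; rewrite expn0 prodn_gt0// => j; rewrite leq_max.
- apply: le_trans (cB A); apply: ler_sum => k _.
  by rewrite exprMn natrX -exprM mulnC.
Qed.

Let S := Num.sqrt (16 ^+ d.+1 * B).
Let ccvg_g := ccvg_fourier_series sum_cabs_torus_coef.

Definition lattice_mean_coef (u : Rn -> R[i]) (k : freq) : R[i] :=
  M%:R^-1 * \sum_(j < M) u (lattice_point z M j) * e (- dotp k (lattice_point z M j)).

Definition lattice_partial_sum (u : Rn -> R[i]) (x : Rn) : R[i] :=
  \sum_(k \in hyperbolic_cross N) lattice_mean_coef u k * e (dotp k x).

Lemma fsbig_cross (V : nmodType) (F : freq -> V) n : (N <= n)%N ->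
  \sum_(k \in hyperbolic_cross N) F k = \sum_(k <- freq_box n | (omega_hc k <= N)%N) F k.
Proof.
move=> Nn; rewrite -[RHS]big_filter [RHS]fsbig_seq ?filter_uniq ?freq_box_uniq//.
apply: eq_fsbigl; apply/seteqP; split => k /=; rewrite /hyperbolic_cross/= mem_filter.
- by move=> kN; rewrite kN/=; exact: freq_box_cross Nn kN.
- by case/andP.
Qed.

Let u n (x : Rn) := trig_poly c (freq_box n) x - lattice_partial_sum (trig_poly c (freq_box n)) x.

Let uE n x : (N <= n)%N -> u n x = trig_poly (error_coef N M z c (freq_box n)) (freq_box n) x.
Proof.
move=> Nn; rewrite -error_trig_poly /u /lattice_partial_sum (fsbig_cross _ Nn).
congr (_ - _); apply: eq_bigr => k _; congr (_ * _).
exact: lattice_aliasing.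
Qed.

(** The lattice sum depends on finitely many point values, so pointwise convergence of the box sums
    suffices. *)
Let ccvg_u x : ccvg (u ^~ x) (g x - lattice_partial_sum g x).
Proof.
apply: ccvgB; first exact: ccvg_g.
rewrite /lattice_partial_sum; under [X in ccvg X]eq_fun do rewrite (fsbig_cross _ (leqnn N)).
rewrite (fsbig_cross _ (leqnn N)); apply: ccvg_sum => k.
apply: ccvgM; last exact: ccvg_cst.
apply: ccvgM; first exact: ccvg_cst.
apply: ccvg_sum => j; apply: ccvgM; last exact: ccvg_cst.
exact: ccvg_g.
Qed.

Definition lattice_error_const : R :=
  ((N ^ (2 * m))%:R)^-1 + @alias_const R d m N.

Lemma integral_lattice_error :
  (\int[mu]_(x in cube) (cabs (g x - lattice_partial_sum g x) ^+ 2)%:E <=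
   (lattice_error_const * B)%:E)%E.
Proof.
have mc := @measurable_cube R d.+1.
(* The shift by [N] makes every box contain the cross, as the aliasing identity [uE] requires. *)
pose F n x := (cabs (u (n + N) x) ^+ 2)%:E.
have mF n : measurable_fun cube (F n).
  apply/measurable_EFinP; rewrite (_ : (fun _ => _) = fun x => cabs (trig_poly
    (error_coef N M z c (freq_box (n + N))) (freq_box (n + N)) x) ^+ 2).
    exact: measurable_cabs_trig_poly.
  by apply/funext => x; rewrite uE// leq_addl.
have F0 n x : cube x -> (0 <= F n x)%E by move=> _; rewrite lee_fin sqr_ge0.
have := fatou mu mc mF F0.
have -> : (\int[mu]_(x in cube) limn_einf (F ^~ x) =
    \int[mu]_(x in cube) (cabs (g x - lattice_partial_sum g x) ^+ 2)%:E)%E.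
  apply: eq_integral => x _.
  have H : F n x @[n --> \oo] --> (cabs (g x - lattice_partial_sum g x) ^+ 2)%:E.
    apply: cvg_EFin; first exact: nearW.
    by have := ccvg_cabs (ccvg_u x); rewrite -(cvg_shiftn N).
  by rewrite (cvg_limn_einf_sup H).
move=> /le_trans; apply.
have E0 : 0 <= lattice_error_const.
  by rewrite addr_ge0 ?invr_ge0// !mulr_ge0 ?exprn_ge0 ?invr_ge0.
have bF n : (\int[mu]_(x in cube) F n x <= (lattice_error_const * B)%:E)%E.
  pose K : seq freq := freq_box (n + N).
  have uK : uniq K := freq_box_uniq _.
  rewrite (eq_integral (fun x => (cabs (trig_poly (error_coef N M z c K) K x) ^+ 2)%:E)); last first.
    by move=> x _; rewrite /F uE// leq_addl.
  rewrite -[leLHS]fineK; last first.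
    apply: integrable_fin_num => //; exact: integrable_cabs_trig_poly.
  rewrite lee_fin [leLHS](parseval _ uK); apply: le_trans (sum_error_coef m0 N1 M0 zM _ uK) _.
  apply: ler_wpM2l => //; apply: le_trans (cB [fset k in K]%fset).
  rewrite le_eqVlt; apply/orP; left; apply/eqP; apply: perm_big.
  by apply: uniq_perm; rewrite ?fset_uniq// => k; rewrite [in RHS]inE.
rewrite limn_einf_lim; apply: lime_le; first exact: is_cvg_einfs.
apply: nearW => n; apply: le_trans (bF n).
by apply: ereal_inf_lbound; exists n => /=.
Qed.

End lattice_error.

(** * Transfer to the whole space *)

Section complex_measurability.
Context {R : realType} {d : nat}.
Local Notation Rn := (d.-tuple (measurableTypeR R)).
Implicit Types f h : Rn -> R[i].

Lemma cmeasurable_cst (a : R[i]) : cmeasurable (fun _ : Rn => a).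
Proof. by split; exact: measurable_cst. Qed.

Lemma cmeasurableB f h : cmeasurable f -> cmeasurable h -> cmeasurable (fun x => f x - h x).
Proof.
move=> [f1 f2] [h1 h2]; split.
- by under eq_fun do rewrite ReB; exact: measurable_funB.
- by under eq_fun do rewrite ImB; exact: measurable_funB.
Qed.

Lemma cmeasurableM f h : cmeasurable f -> cmeasurable h -> cmeasurable (fun x => f x * h x).
Proof.
move=> [f1 f2] [h1 h2]; split.
- by under eq_fun do rewrite ReM; apply: measurable_funB; exact: measurable_funM.
- by under eq_fun do rewrite ImM; apply: measurable_funD; exact: measurable_funM.
Qed.

Lemma cmeasurable_sum (I : Type) (s : seq I) (P : pred I) (F : I -> Rn -> R[i]) :
  (forall i, cmeasurable (F i)) -> cmeasurable (fun x => \sum_(i <- s | P i) F i x).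
Proof.
move=> mF; split.
- under eq_fun do rewrite -big_filter Re_sum.
  by apply: measurable_sum => i; have [] := mF i.
- under eq_fun do rewrite -big_filter Im_sum.
  by apply: measurable_sum => i; have [] := mF i.
Qed.

Lemma cmeasurable_expi (k : d.-tuple int) :
  cmeasurable (fun x : Rn => @expi2pi R (dotp k x)).
Proof.
split.
- by under eq_fun do rewrite -[expi2pi _]mul1r; exact: measurable_Re_expi.
- by under eq_fun do rewrite -[expi2pi _]mul1r; exact: measurable_Im_expi.
Qed.

Lemma measurable_cabs h : cmeasurable h -> measurable_fun setT (fun x => cabs (h x) ^+ 2).
Proof.
move=> [h1 h2]; under eq_fun do rewrite cabsE.
by apply: measurable_funD; exact: measurable_funX.
Qed.

End complex_measurability.

Section multivariate_transformation.
Context {R : realType} {d : nat}.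
Local Notation Rn := (d.-tuple (measurableTypeR R)).
Local Notation mu := (lebesgue_tuple d).
Local Notation e := (@expi2pi R).
Local Notation cube := (@cube R d).
Variables psi omega : 'I_d -> R -> R.
Hypothesis hpsi : forall l, univariate_transformation (psi l).
Hypothesis hdens : forall l, continuous (density (psi l)).
Hypothesis homega : forall l y, 0 <= omega l y.
Local Notation s_ j := (sqrt_weight_transf (omega j) (psi j)).
Hypothesis ms : forall j, measurable_fun Ihalf (s_ j).
Local Notation G := (Psi_inv psi).
Local Notation rho := (rho psi).
Local Notation w := (weight omega).
Implicit Types (y x : Rn).

Let mc : measurable cube. Proof. exact: measurable_cube. Qed.

Lemma Psi_inv_cube y : cube (G y).
Proof. by move=> j; rewrite tnth_mktuple; exact: (transf_inv_Ihalf (hpsi j)). Qed.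

Lemma Psi_invK y : Psi psi (G y) = y.
Proof. by apply: eq_from_tnth => j; rewrite !tnth_mktuple (transf_invV (hpsi j)). Qed.

Lemma rho_gt0 y : 0 < rho y.
Proof. by apply: prodr_gt0 => j _; exact: (density_gt0 (hpsi j) (@hdens j)). Qed.

Lemma weight_ge0 y : 0 <= w y.
Proof. by apply: prodr_ge0 => j _; exact: homega. Qed.

Lemma Psi'_Psi_inv y : Psi' psi (G y) = (rho y)^-1.
Proof.
rewrite /Psi' /Defs.rho -prodfV; apply: eq_bigr => j _.
have := density_transfE (hpsi j) (@hdens j) (transf_inv_Ihalf (hpsi j) (tnth y j)).
by rewrite tnth_mktuple (transf_invV (hpsi j)) => ->; rewrite invrK.
Qed.

Lemma measurable_transf_inv j : measurable_fun setT (transf_inv (psi j)).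
Proof. by apply: continuous_measurable_fun; exact: (transf_inv_continuous (hpsi j)). Qed.

Lemma ge0_integral_cube_Psi_inv (F : Rn -> \bar R) :
  measurable_fun setT F -> (forall x, 0 <= F x)%E ->
  (\int[mu]_(x in cube) F x = \int[mu]_y (F (G y) * (rho y)%:E))%E.
Proof.
move=> mF F0; rewrite integral_cubeE.
rewrite (@ge0_integral_tuple_transfer R d (fun j => transf_inv (psi j))
  (fun=> \1_(@Ihalf R)) (fun j => density (psi j)))//.
- exact: measurable_transf_inv.
- by move=> j; apply: measurable_indic; exact: measurable_Ihalf.
- by move=> j; apply: continuous_measurable_fun; exact: (@hdens j).
- by move=> j x; rewrite ltW// (density_gt0 (hpsi j) (@hdens j)).
- by move=> j f mf f0; exact: (ge0_integral_transf (hpsi j) (@hdens j)).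
Qed.

Lemma Rintegral_cube_Psi_inv (F : Rn -> R) : measurable_fun setT F ->
  \int[mu]_(x in cube) F x = \int[mu]_y (F (G y) * rho y).
Proof.
move=> mF; have mFE : measurable_fun setT (EFin \o F) by exact/measurable_EFinP.
rewrite /Rintegral [in LHS]integralE [in RHS]integralE.
rewrite !ge0_integral_cube_Psi_inv//.
- have r0 y : (0 <= (rho y)%:E)%E by rewrite lee_fin ltW// rho_gt0.
  congr (fine (_ - _)); apply: eq_integral => y _.
  + by rewrite !funeposE /= EFinM maxe_pMl ?mul0e.
  + by rewrite !funenegE /= -mulNr EFinM maxe_pMl ?mul0e.
- exact: measurable_funeneg.
- exact: measurable_funepos.
Qed.

Lemma sqrt_prod (I : Type) (s : seq I) (P : pred I) (a : I -> R) :
  (forall i, P i -> 0 <= a i) ->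
  Num.sqrt (\prod_(i <- s | P i) a i) = \prod_(i <- s | P i) Num.sqrt (a i).
Proof.
move=> a0; elim: s => [|i s IH]; first by rewrite !big_nil sqrtr1.
by rewrite !big_cons; case: ifP => // Pi; rewrite sqrtrM ?IH// a0.
Qed.

Lemma sqrt_weight_prod x : cube x ->
  Num.sqrt (w (Psi psi x) * Psi' psi x) = \prod_j s_ j (tnth x j).
Proof.
move=> cx; rewrite /weight /Psi' -big_split/= sqrt_prod.
  by apply: eq_bigr => j _; rewrite tnth_mktuple.
move=> j _; by rewrite mulr_ge0// ltW// (transf_derive_gt0 (hpsi j) (@hdens j) (cx j)).
Qed.

(* The transformed function extended by zero outside of the cube. *)
Definition transformed0 (h : Rn -> R[i]) x : R[i] :=
  h (tuple_fun (fun j => psi j \_ Ihalf) x) *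
  (\prod_j (s_ j \_ Ihalf) (tnth x j))%:C%C.

Lemma transformed0E h x : cube x -> transformed0 h x = transformed psi omega h x.
Proof.
move=> cx; rewrite /transformed0 /transformed sqrt_weight_prod//.
congr (h _ * (_)%:C%C).
  by apply: eq_from_tnth => j; rewrite !tnth_mktuple patchE mem_set//; exact: cx.
by apply: eq_bigr => j _; rewrite patchE mem_set//; exact: cx.
Qed.

Lemma measurable_sqrt_weight_prod :
  measurable_fun setT (fun x : Rn => \prod_j (s_ j \_ Ihalf) (tnth x j)).
Proof.
apply: (measurable_tuple_prod (u := fun j => s_ j \_ Ihalf)) => j.
exact/(measurable_restrictT _ (@measurable_Ihalf R)).
Qed.

Lemma measurable_patch_psi :
  measurable_fun setT (tuple_fun (fun j => psi j \_ Ihalf)).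
Proof.
apply: (measurable_tuple_fun (g := fun j => psi j \_ Ihalf)) => j.
apply/(measurable_restrictT _ (@measurable_Ihalf R)).
apply: open_continuous_measurable_fun; first exact: interval_open.
by move=> x; rewrite inE; exact: (transf_continuous (hpsi j)).
Qed.

Lemma cmeasurable_transformed0 h : cmeasurable h -> cmeasurable (transformed0 h).
Proof.
move=> [h1 h2]; apply: cmeasurableM; split.
- exact: (measurableT_comp h1 measurable_patch_psi).
- exact: (measurableT_comp h2 measurable_patch_psi).
- exact: measurable_sqrt_weight_prod.
- exact: measurable_cst.
Qed.

Lemma transformed0_Psi_inv h y :
  transformed0 h (G y) = h y * (Num.sqrt (w y / rho y))%:C%C.
Proof.
rewrite transformed0E; last exact: Psi_inv_cube.
by rewrite /transformed Psi_invK Psi'_Psi_inv.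
Qed.

(** Both sides are the square root of [a * b]. This exchanges the normalisations of coefficients on
    the cube and on the whole space, also where the weight vanishes. *)
Lemma sqrt_quotM (a b : R) : 0 <= a -> 0 < b ->
  Num.sqrt (a / b) * b = Num.sqrt (b / a) * a.
Proof.
move=> a0 b0; have [->|an0] := eqVneq a 0; first by rewrite mul0r sqrtr0 mul0r mulr0.
have ap : 0 < a by rewrite lt_neqAle eq_sym an0.
rewrite !sqrtrM ?(ltW b0)// !sqrtrV ?(ltW b0)//.
have sa : Num.sqrt a != 0 by rewrite sqrtr_eq0 -ltNge.
have sb : Num.sqrt b != 0 by rewrite sqrtr_eq0 -ltNge.
rewrite -{2}(sqr_sqrtr (ltW b0)) -{3}(sqr_sqrtr a0).
by field; rewrite sa sb.
Qed.

Lemma cabs_real (r : R) : 0 <= r -> cabs (r%:C%C) = r.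
Proof. by move=> r0; rewrite /cabs /= expr0n addr0 sqrtr_sqr ger0_norm. Qed.

Lemma cabs_transformed0 h y :
  cabs (transformed0 h (G y)) ^+ 2 * rho y = cabs (h y) ^+ 2 * w y.
Proof.
rewrite transformed0_Psi_inv cabsM cabs_real ?sqrtr_ge0// exprMn sqr_sqrtr.
  by rewrite -mulrA divfK// gt_eqF// rho_gt0.
by rewrite divr_ge0 ?weight_ge0// ltW// rho_gt0.
Qed.

Lemma integral_cabs_transformed0 h : cmeasurable h ->
  (\int[mu]_(x in cube) (cabs (transformed0 h x) ^+ 2)%:E =
   \int[mu]_y (cabs (h y) ^+ 2 * w y)%:E)%E.
Proof.
move=> mh; rewrite ge0_integral_cube_Psi_inv.
- by apply: eq_integral => y _; rewrite -EFinM cabs_transformed0.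
- by apply/measurable_EFinP; apply: measurable_cabs; exact: cmeasurable_transformed0.
- by move=> x; rewrite lee_fin sqr_ge0.
Qed.

Lemma hhatE h k : cmeasurable h ->
  hhat psi omega h k = torus_coef (transformed psi omega h) k.
Proof.
move=> mh; pose F x := transformed0 h x * e (- dotp k x).
have [m1 m2] : cmeasurable F.
  apply: cmeasurableM; first exact: cmeasurable_transformed0.
  by under eq_fun do rewrite -dotpN; exact: cmeasurable_expi.
have Rer (z : R[i]) r : complex.Re (z * r%:C%C) = complex.Re z * r.
  by rewrite ReM mulr0 subr0.
have Imr (z : R[i]) r : complex.Im (z * r%:C%C) = complex.Im z * r.
  by rewrite ImM mulr0 add0r.
have conjr (r : R) (u : R[i]) : ((r%:C * u)^* = r%:C * u^*)%C.
  by case: u => a b /=; congr (_ +i* _)%C; ring.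
have E y : transformed0 h (G y) * e (- dotp k (G y)) * (rho y)%:C%C =
    h y * (phi_ psi omega k y)^*%C * (w y)%:C%C.
  rewrite transformed0_Psi_inv /phi_ expi2piN conjr.
  have := sqrt_quotM (weight_ge0 y) (rho_gt0 y) => /(congr1 (real_complex R)).
  rewrite !rmorphM => H.
  rewrite (_ : _ * _ * _ * (rho y)%:C%C = h y * (e (dotp k (G y)))^*%C *
    ((Num.sqrt (w y / rho y))%:C%C * (rho y)%:C%C)); last by ring.
  by rewrite H; ring.
rewrite /hhat /torus_coef /cintegral; congr (_ +i* _)%C.
- transitivity (\int[mu]_(x in cube) complex.Re (F x)).
    rewrite Rintegral_cube_Psi_inv//; apply: eq_Rintegral => y _.
    by rewrite -E Rer.
  by apply: eq_Rintegral => x /set_mem cx; rewrite /F transformed0E.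
- transitivity (\int[mu]_(x in cube) complex.Im (F x)).
    rewrite Rintegral_cube_Psi_inv//; apply: eq_Rintegral => y _.
    by rewrite -E Imr.
  by apply: eq_Rintegral => x /set_mem cx; rewrite /F transformed0E.
Qed.

End multivariate_transformation.

Section L2_transfer.
Context {R : realType}.

(* Contrary to [ge0_le_integral], no measurability is required. *)
Lemma ge0_le_integralT dT (T : measurableType dT) (nu : {measure set T -> \bar R})
    (f1 f2 : T -> \bar R) : (forall x, 0 <= f1 x)%E -> (forall x, f1 x <= f2 x)%E ->
  (\int[nu]_x f1 x <= \int[nu]_x f2 x)%E.
Proof.
move=> f10 f12; rewrite !ge0_integralTE//; last first.
  by move=> x; exact: le_trans (f12 x).
apply: le_ereal_sup => _ /= [g gf <-]; exists g => // x.
exact: le_trans (gf x) (f12 x).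
Qed.

(** On the cube, of measure 1, the integrable function [1 + |F|^2] dominates both parts of [F]. *)
Lemma cintegrable_L2 d (F : d.-tuple (measurableTypeR R) -> R[i]) : cmeasurable F ->
  (\int[lebesgue_tuple d]_(x in @cube R d) (cabs (F x) ^+ 2)%:E < +oo)%E ->
  cintegrable F.
Proof.
move=> mF Foo; have mc := @measurable_cube R d.
have i1 : (lebesgue_tuple d).-integrable cube (EFin \o (fun x => 1 + cabs (F x) ^+ 2)).
  apply: (@integrableD _ _ _ _ _ mc (EFin \o cst 1) (EFin \o (fun x => cabs (F x) ^+ 2))).
    by apply: (@integrable_cube_bounded _ _ _ 1) => //= x _; rewrite normr1.
  apply/integrableP; split.
    by apply/measurable_EFinP; apply: measurable_funTS; exact: measurable_cabs.
  by under eq_integral do rewrite /= ger0_norm ?sqr_ge0//.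
have H (a b : R) : `|a| <= b -> `|a| <= `|1 + b ^+ 2|.
  move=> ab; apply: (le_trans ab); apply: le_trans (ler_norm _); nra.
have [m1 m2] := mF.
split; apply: le_integrable i1 => //.
- by apply/measurable_EFinP; exact: measurable_funTS.
- by move=> x _; rewrite /= lee_fin; apply: H; exact: Re_le_cabs.
- by apply/measurable_EFinP; exact: measurable_funTS.
- by move=> x _; rewrite /= lee_fin; apply: H; exact: Im_le_cabs.
Qed.

End L2_transfer.

Section transformed_error.
Context {R : realType} {d : nat}.
Local Notation Rn := (d.+1.-tuple (measurableTypeR R)).
Local Notation freq := (d.+1.-tuple int).
Local Notation mu := (lebesgue_tuple d.+1).
Local Notation e := (@expi2pi R).
Local Notation cube := (@cube R d.+1).
Variables psi omega : 'I_d.+1 -> R -> R.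
Hypothesis hpsi : forall l, univariate_transformation (psi l).
Hypothesis hdens : forall l, continuous (density (psi l)).
Hypothesis homega : forall l y, 0 <= omega l y.
Hypothesis ms : forall j, measurable_fun Ihalf (sqrt_weight_transf (omega j) (psi j)).
Local Notation G := (Psi_inv psi).
Local Notation rho := (rho psi).
Local Notation w := (weight omega).
Variable h : Rn -> R[i].
Hypothesis mh : cmeasurable h.
Hypothesis hw : (\int[mu]_y (cabs (h y) ^+ 2 * w y)%:E < +oo)%E.
Local Notation f := (transformed psi omega h).
Local Notation f0 := (transformed0 psi omega h).

Let mc : measurable cube. Proof. exact: measurable_cube. Qed.

Lemma cintegrable_transformed : cintegrable f.
Proof.
have [] : cintegrable f0.
  apply: cintegrable_L2; first exact: (cmeasurable_transformed0 hpsi ms).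
  by rewrite (integral_cabs_transformed0 hpsi hdens homega ms).
move=> p q.
have E x : cube x -> f0 x = f x by exact: (transformed0E hpsi hdens homega).
split.
- by apply: eq_integrable p => // x /set_mem cx /=; rewrite E.
- by apply: eq_integrable q => // x /set_mem cx /=; rewrite E.
Qed.

(** Equality holds where the weight is positive. Where it vanishes the left side is 0, but the right
    side may be positive because of [Q]. *)
Lemma cabs_transformed_error (Q : R[i]) y :
  cabs (h y - (Num.sqrt (rho y / w y))%:C%C * Q) ^+ 2 * w y <=
  cabs (f0 (G y) - Q) ^+ 2 * rho y.
Proof.
have r0 : 0 < rho y := rho_gt0 hpsi hdens y.
have w0 : 0 <= w y := weight_ge0 homega y.
have [we|wn] := eqVneq (w y) 0; first by rewrite we mulr0 mulr_ge0 ?sqr_ge0// ltW.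
rewrite (transformed0_Psi_inv hpsi hdens homega).
have ab : Num.sqrt (rho y / w y) * Num.sqrt (w y / rho y) = 1.
  rewrite -sqrtrM ?divr_ge0// ?(ltW r0)// mulrA divfK// divff ?sqrtr1//.
  by rewrite gt_eqF.
rewrite (_ : h y - _ = (Num.sqrt (rho y / w y))%:C%C *
    (h y * (Num.sqrt (w y / rho y))%:C%C - Q)); last first.
  have := congr1 (real_complex R) ab; rewrite rmorphM rmorph1 => ab'.
  by rewrite mulrBr mulrCA ab' mulr1.
rewrite cabsM cabs_real ?sqrtr_ge0// exprMn sqr_sqrtr ?divr_ge0// ?(ltW r0)//.
by rewrite mulrAC divfK// mulrC.
Qed.

Variables (m N M : nat) (z : freq) (B : R).
Hypotheses (m0 : (0 < m)%N) (N1 : (1 < N)%N) (M0 : (0 < M)%N).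
Hypothesis zM : reconstructing z M (hyperbolic_cross N).
Local Notation g := (fourier_series f).
Hypothesis cB : forall A : {fset freq},
  \sum_(k <- A) (omega_hc k)%:R ^+ (2 * m) * cabs (torus_coef f k) ^+ 2 <= B.
Local Notation Q := (lattice_partial_sum N M z g).

Lemma partial_sum_latticeE y :
  partial_sum_lattice psi omega z M (hyperbolic_cross N) h y =
  (Num.sqrt (rho y / w y))%:C%C * Q (G y).
Proof.
rewrite /partial_sum_lattice /lattice_partial_sum !(fsbig_cross _ (leqnn N)).
by rewrite big_distrr/=; apply: eq_bigr => k _; rewrite mulrCA.
Qed.

Lemma integral_transformed_error :
  (\int[mu]_y (cabs (h y -
     partial_sum_lattice psi omega z M (hyperbolic_cross N) h y) ^+ 2 * w y)%:E
   <= (@lattice_error_const R d m N * B)%:E)%E.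
Proof.
have fi := cintegrable_transformed.
have cS := sum_cabs_torus_coef m0 cB.
have mg : cmeasurable g by exact: measurable_fourier_series cS.
have mf0 : cmeasurable f0 by exact: (cmeasurable_transformed0 hpsi ms).
have mQ : cmeasurable Q.
  rewrite /lattice_partial_sum; under eq_fun do rewrite (fsbig_cross _ (leqnn N)).
  apply: cmeasurable_sum => k; apply: cmeasurableM; last exact: cmeasurable_expi.
  exact: cmeasurable_cst.
apply: (@le_trans _ _ (\int[mu]_y (cabs (f0 (G y) - Q (G y)) ^+ 2 * rho y)%:E)%E).
  apply: ge0_le_integralT => y.
    by rewrite lee_fin mulr_ge0 ?sqr_ge0// (weight_ge0 homega).
  by rewrite lee_fin partial_sum_latticeE; exact: cabs_transformed_error.
have mfQ := measurable_cabs (cmeasurableB mf0 mQ).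
have mgQ := measurable_cabs (cmeasurableB mg mQ).
under eq_integral do rewrite EFinM.
rewrite -(ge0_integral_cube_Psi_inv hpsi hdens
  (F := fun x => (cabs (f0 x - Q x) ^+ 2)%:E)); last 2 first.
- by apply/measurable_EFinP; exact: mfQ.
- by move=> x; rewrite lee_fin sqr_ge0.
(* On the cube the transformed function may be replaced by its Fourier series, to which the lattice
   estimate applies. *)
rewrite (ge0_ae_eq_integral (g := fun x => (cabs (g x - Q x) ^+ 2)%:E))//.
- exact: integral_lattice_error.
- by apply/measurable_EFinP; exact: measurable_funTS.
- by apply/measurable_EFinP; exact: measurable_funTS.
- by move=> x _; rewrite lee_fin sqr_ge0.
- by move=> x _; rewrite lee_fin sqr_ge0.
(* The multipliers 1 and [- 'i] give the equality of the real and of the imaginary parts. *)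
have A1 := fourier_series_ae fi cS 1; have A2 := fourier_series_ae fi cS (- 'i%C).
apply: filterS2 A2 A1 => x /= H2 H1 cx.
have /eqP := H2 cx; have /eqP := H1 cx.
rewrite (transformed0E hpsi hdens homega)//.
case: (f x) => a b; case: (g x) => p q /=; rewrite !eqe => /eqP K1 /eqP K2.
congr ((cabs (_ - _) ^+ 2)%:E); congr (_ +i* _)%C; lra.
Qed.

End transformed_error.

(** * Explicit constants and conclusion *)

Section rate.
Context {R : realType}.

(** For [N >= 2] the truncated logarithm [n] is at least 1, so [n.+1 <= 2 * n]. *)
Lemma trunc_log_le_ln N : (1 < N)%N ->
  (trunc_log 2 N).+1%:R <= 2 / ln 2 * ln N%:R :> R.
Proof.
move=> N1; have l2 : 0 < ln 2 :> R by rewrite ln_gt0// ltr1n.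
have N0 : (0 < N)%N by exact: ltnW.
have H : (trunc_log 2 N)%:R * ln 2 <= ln N%:R :> R.
  rewrite mulr_natl -lnXn// ler_ln ?posrE ?exprn_gt0 ?ltr0n//.
  by rewrite -natrX ler_nat trunc_logP.
have t1 : (0 < trunc_log 2 N)%N by rewrite trunc_log_gt0.
rewrite mulrAC ler_pdivlMr//; apply: (@le_trans _ _ (2 * ((trunc_log 2 N)%:R * ln 2))).
  rewrite mulrA ler_wpM2r ?(ltW l2)// -natrM ler_nat; lia.
by rewrite ler_wpM2l.
Qed.

(** Under the root, 5 is the 4 of [alias_const] plus 1 for the truncation term, and [2 / ln 2]
    converts the binary logarithm. Here [d] is the dimension minus one. *)
Definition rate_const (d : nat) : R :=
  Num.sqrt (5 * 16 ^+ d.+1 * (2 / ln 2) ^+ d).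

Lemma rate_const_gt0 d : 0 < rate_const d.
Proof.
have l2 : 0 < ln 2 :> R by rewrite ln_gt0// ltr1n.
by rewrite sqrtr_gt0 !mulr_gt0 ?exprn_gt0// divr_gt0.
Qed.

Lemma lattice_error_const_le d m N : (1 < N)%N ->
  @lattice_error_const R d m N <=
  (rate_const d * N%:R ^- m * ln N%:R `^ (d%:R / 2)) ^+ 2.
Proof.
move=> N1; have l2 : 0 < ln 2 :> R by rewrite ln_gt0// ltr1n.
have lN : 0 < ln N%:R :> R by rewrite ln_gt0// ltr1n.
have N0 : 0 < N%:R :> R by rewrite ltr0n ltnW.
have c0 : 0 <= 5 * 16 ^+ d.+1 * (2 / ln 2) ^+ d :> R.
  by rewrite !mulr_ge0 ?exprn_ge0// divr_ge0 ?(ltW l2).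
rewrite exprMn exprMn sqr_sqrtr// -[ln N%:R `^ _ ^+ 2]powR_mulrn ?powR_ge0//.
rewrite -powRrM divfK// powR_mulrn ?(ltW lN)// -exprVn -exprM mulnC exprVn -[N%:R ^+ _]natrX.
set D : R := (N ^ (2 * m))%:R.
have D0 : 0 < D by rewrite ltr0n expn_gt0 ltnW.
set X := 2 / ln 2 * ln N%:R : R.
(* This absorbs the truncation term, which has no logarithm. *)
have X1 : 1 <= X ^+ d.
  apply: exprn_ege1; apply: le_trans (trunc_log_le_ln N1).
  by rewrite -[leLHS]/(1%:R) ler_nat.
have tX : (trunc_log 2 N).+1%:R ^+ d <= X ^+ d.
  by rewrite lerXn2r ?nnegrE ?(le_trans _ (trunc_log_le_ln N1))// trunc_log_le_ln.
have -> : 5 * 16 ^+ d.+1 * (2 / ln 2) ^+ d * D^-1 * ln N%:R ^+ d =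
    (5 * 16 ^+ d.+1 * X ^+ d) / D by rewrite /X [in RHS]exprMn; ring.
rewrite /lattice_error_const /alias_const -/D -[X in X + _]mul1r -mulrDl.
rewrite ler_wpM2r ?invr_ge0 ?(ltW D0)//.
have p1 : 1 <= 16 ^+ d.+1 :> R by apply: exprn_ege1; rewrite ler1n.
rewrite (_ : 5 * _ * _ = 16 ^+ d.+1 * X ^+ d + 4 * 16 ^+ d.+1 * X ^+ d); last by ring.
apply: lerD; last by rewrite ler_wpM2l// mulr_ge0// exprn_ge0.
by rewrite -[leLHS]mulr1 ler_pM.
Qed.

End rate.

Lemma derivable_measurable_Ihalf {R : realType} (s : R -> R) :
  nderivable_on Ihalf 1 s -> measurable_fun Ihalf s.
Proof.
move=> ds; apply: open_continuous_measurable_fun; first exact: interval_open.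
move=> x; rewrite inE => xI.
by apply: differentiable_continuous; apply/derivable1_diffP; exact: (ds 0%N).
Qed.

Theorem theorem3p7 (R : realType) (d m : nat) (psi omega : 'I_d -> R -> R)
  (hd : (0 < d)%N) (hm : (0 < m)%N)
  (hpsi : forall l, univariate_transformation (psi l))
  (homega : forall l y, 0 <= omega l y)
  (hass : forall mi : 'I_d -> nat, (forall l, (mi l <= m)%N) ->
     forall l : 'I_d,
     [/\ forall j, (j <= m)%N -> derivative_in_C0 j (density (psi l)),
         forall j, (j <= m)%N -> derivative_in_C_Ihalf j (psi l),
         nderivable_on Ihalf (mi l) (sqrt_weight_transf (omega l) (psi l)) &
         (\big[maxe/0]_(j < (mi l).+1) Linfty_norm_Ihalf (fun x : R =>
            (derive1n (mi l - j)%N (sqrt_weight_transf (omega l) (psi l)) x *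
             derive1 (psi l) x `^ Num.max (- 2^-1) (2 * j%:R - 3 / 2))%R)
          < +oo)%E]) :
  exists2 C : R, 0 < C &
    forall (N M : nat) (z : d.-tuple int) (h : d.-tuple (measurableTypeR R) -> R[i]),
      (2 ^ d.+1 <= N)%N -> (0 < M)%N ->
      reconstructing z M (hyperbolic_cross N) ->
      in_L2_weight (weight omega) h -> in_Hmix m h ->
      (L2_norm_weight (weight omega)
         (fun y => (h y -
            partial_sum_lattice psi omega z M (hyperbolic_cross N) h y)%R)
       <= (C * N%:R ^- m * ln N%:R `^ ((d.-1)%:R / 2))%:E
          * Hnorm psi omega m h)%E.
Proof.
have hdens l : continuous (density (psi l)).
  by have [+ _ _ _] := hass (fun=> 0%N) (fun=> leq0n m) l => /(_ 0%N (leq0n m))[].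
(* The multi-index with all entries 1 is admissible since [m >= 1]; it makes the weight factor
   differentiable, hence measurable. *)
have ms l : measurable_fun Ihalf (sqrt_weight_transf (omega l) (psi l)).
  by have [_ _ + _] := hass (fun=> 1%N) (fun=> hm) l; exact: derivable_measurable_Ihalf.
case: d psi omega hd hpsi homega hdens ms {hass} => // d psi omega _ hpsi homega hdens ms.
exists (rate_const d) => [|N M z h NN M0 zM [[mh _] hw] _]; first exact: rate_const_gt0.
have N1 : (1 < N)%N by apply: leq_trans NN; rewrite -[X in (X < _)%N](expn0 2) ltn_exp2l.
pose C : R := rate_const d * N%:R ^- m * ln N%:R `^ (d%:R / 2).
rewrite -[X in (X%:E * _)%E]/C.
have C0 : 0 < C.
  rewrite !mulr_gt0 ?rate_const_gt0 ?powR_gt0 ?ln_gt0 ?ltr1n//.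
  by rewrite invr_gt0 exprn_gt0// ltr0n ltnW.
rewrite /Hnorm /L2_norm_weight.
set S := esum _ _.
have S0 : (0 <= S)%E.
  by apply: esum_ge0 => k _; rewrite lee_fin mulr_ge0 ?sqr_ge0 ?exprn_ge0.
(* The infinite case relies on [C > 0], as 0 times infinity is 0. *)
have [Soo|Sfin] := eqVneq S +oo%E.
  by rewrite Soo poweRyr ?invr_eq0// gt0_muley ?lte_fin// leey.
have SE : S = (fine S)%:E by rewrite fineK// ge0_fin_numE// ltey.
have cB (A : {fset d.+1.-tuple int}) : \sum_(k <- A) (omega_hc k)%:R ^+ (2 * m) *
    cabs (torus_coef (transformed psi omega h) k) ^+ 2 <= fine S.
  rewrite -lee_fin -SE -sumEFin; apply: esum_ge; exists [set` A] => //.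
  rewrite fsbig_seq ?fset_uniq// le_eqVlt; apply/orP; left; apply/eqP.
  by apply: eq_fsbigr => k _; rewrite (hhatE hpsi hdens homega ms k mh).
have hwoo : (\int[lebesgue_tuple d.+1]_y (cabs (h y) ^+ 2 * weight omega y)%:E < +oo)%E.
  by apply: lty_poweRy hw; rewrite invr_eq0.
have := integral_transformed_error hpsi hdens homega ms mh hwoo hm N1 M0 zM cB.
set J := (\int[_]_y _)%E => JB.
have J0 : (0 <= J)%E.
  by apply: integral_ge0 => y _; rewrite lee_fin mulr_ge0 ?sqr_ge0// (weight_ge0 homega).
have JC : (J <= (C ^+ 2)%:E * S)%E.
  apply: (le_trans JB); rewrite EFinM -SE lee_wpmul2r// lee_fin.
  exact: lattice_error_const_le.
apply: (le_trans (gt0_ler_poweR _ _ _ JC)) => //.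
- by rewrite in_itv/= J0 leey.
- by rewrite in_itv/= leey mule_ge0// lee_fin sqr_ge0.
rewrite poweRM// ?lee_fin ?sqr_ge0// poweR_EFin powR12_sqrt ?sqr_ge0//.
by rewrite sqrtr_sqr gtr0_norm.
Qed.
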